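(* Let $\tau=1$, $q\in\mathcal S(\mathbb R,\mathbb C)$ and $\mathbf f\in\mathcal S(\mathbb R,\mathbb C^2)$. For $\lambda\in\mathbb R$ define $$c_+(\lambda)=\frac{1}{a(\lambda)}\int_{-\infty}^\infty\begin{bmatrix}-m_{1,-}^{(2)}(s;\lambda) & m_{1,-}^{(1)}(s;\lambda)\end{bmatrix}\mathbf f(s)\,\mathrm ds,\qquad c_-(\lambda)=-\frac{1}{A(\lambda)}\int_{-\infty}^\infty\begin{bmatrix}m_{1,+}^{(2)}(s;\lambda) & -m_{1,+}^{(1)}(s;\lambda)\end{bmatrix}\mathbf f(s)\,\mathrm ds .$$ Then the inversion formula $\mathbf f(x)=-\frac{\sigma_3}{2\pi}\int_{-\infty}^\infty\left(c_+(\lambda)\mathbf m_{2,+}(x;\lambda)+c_-(\lambda)\mathbf m_{2,-}(x;\lambda)\right)\mathrm d\lambda$ coincides with Stone's formula for the self-adjoint operator $\mathcal T$ applied to $i\sigma_3\mathbf f$, in the sense that for every $x\in\mathbb R$ $$\begin{aligned} i\sigma_3\mathbf f(x)&=\frac{1}{2\pi i}\int_{-\infty}^\infty\left(c_+(\lambda)\mathbf m_{2,+}(x;\lambda)+c_-(\lambda)\mathbf m_{2,-}(x;\lambda)\right)\mathrm d\lambda\\ &=\frac{1}{2\pi i}\int_{-\infty}^\infty\lim_{\epsilon\to0^+}\left[(\mathcal T-\lambda-i\epsilon)^{-1}-(\mathcal T-\lambda+i\epsilon)^{-1}\right](i\sigma_3\mathbf f)(x)\,\mathrm d\lambda\\ &=\lim_{\epsilon\to0^+}\left(\frac{1}{2\pi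 i}\int_{-\infty}^\infty\left[(\mathcal T-\lambda-i\epsilon)^{-1}-(\mathcal T-\lambda+i\epsilon)^{-1}\right](i\sigma_3\mathbf f)(x)\,\mathrm d\lambda\right).\end{aligned}$$
   Context: $\mathbb C^\pm$ are the open upper/lower half-planes and $\overline{\mathbb C^\pm}$ their closures. $\mathcal S(\mathbb R,\cdot)$ denotes Schwartz-class functions. Let $\sigma_3=\mathrm{diag}(1,-1)$, $\mathbf e_1=[1,0]^T$, $\mathbf e_2=[0,1]^T$, and $\mathbf Q(x)=\begin{bmatrix}0&q(x)\\ \tau\overline{q(x)}&0\end{bmatrix}$ (here $\tau=1$). The operator $\mathcal T=i\sigma_3\frac{\mathrm d}{\mathrm dx}-i\sigma_3\mathbf Q(x)$ acts on $L^2(\mathbb R,\mathbb C^2)$ with domain $H^1(\mathbb R,\mathbb C^2)$; for $\tau=1$ it is self-adjoint. Elements of $H^1$ are identified with their continuous representatives, so the resolvent applied to a function can be evaluated at a point $x$. Jost-like functions: for $\lambda\in\overline{\mathbb C^+}$, $\mathbf r_{1,-}(\cdot;\lambda)$ and $\mathbf r_{2,+}(\cdot;\lambda)$ are the unique bounded solutions $\mathbb R\to\mathbb C^2$ of $$\mathbf r_{1,-}(x;\lambda)=\mathbf e_1+\int_{-\infty}^x\mathrm{diag}(1,e^{2i\lambda(x-s)})\mathbf Q(s)\mathbf r_{1,-}(s;\lambda)\,\mathrm ds,\qquad \mathbf r_{2,+}(x;\lambda)=\mathbf e_2-\int_x^{\infty}\mathrm{diag}(e^{-2i\lambda(x-s)},1)\mathbf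 Q(s)\mathbf r_{2,+}(s;\lambda)\,\mathrm ds,$$ and for $\lambda\in\overline{\mathbb C^-}$, $\mathbf r_{2,-}(\cdot;\lambda)$ and $\mathbf r_{1,+}(\cdot;\lambda)$ are the unique bounded solutions of $$\mathbf r_{2,-}(x;\lambda)=\mathbf e_1-\int_x^{\infty}\mathrm{diag}(1,e^{2i\lambda(x-s)})\mathbf Q(s)\mathbf r_{2,-}(s;\lambda)\,\mathrm ds,\qquad \mathbf r_{1,+}(x;\lambda)=\mathbf e_2+\int_{-\infty}^x\mathrm{diag}(e^{-2i\lambda(x-s)},1)\mathbf Q(s)\mathbf r_{1,+}(s;\lambda)\,\mathrm ds.$$ Set $\mathbf m_{\ell,\pm}(x;\lambda)=e^{\pm i\lambda x}\mathbf r_{\ell,\pm}(x;\lambda)$ for $\ell\in\{1,2\}$; these solve $\mathbf m'=(-i\lambda\sigma_3+\mathbf Q)\mathbf m$. Superscripts $(1),(2)$ denote the two entries of a vector. The scattering coefficients are the ($x$-independent) determinants $a(\lambda)=\det[\mathbf m_{1,-}(x;\lambda)\ \ \mathbf m_{2,+}(x;\lambda)]$ for $\lambda\in\overline{\mathbb C^+}$ and $A(\lambda)=\det[\mathbf m_{2,-}(x;\lambda)\ \ \mathbf m_{1,+}(x;\lambda)]$ for $\lambda\in\overline{\mathbb C^-}$; for $\tau=1$ they have no zeros. *)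

(* Defs.v *)
From HB Require Import structures.
From mathcomp Require Import all_boot all_order all_algebra complex.
From mathcomp Require Import all_classical all_reals all_analysis.
Set Implicit Arguments.
Unset Strict Implicit.
Unset Printing Implicit Defensive.
Import Order.TTheory GRing.Theory Num.Theory.
Import numFieldNormedType.Exports.
Local Open Scope classical_set_scope.
Local Open Scope ring_scope.
Local Open Scope complex_scope.

(* Lebesgue integration of functions with values in R[i] and in R[i]^2, entry
   by entry on real and imaginary parts. *)

Definition cintegrable (R : realType) (D : set R) (h : R -> R[i]) : Prop :=
  lebesgue_measure.-integrable D (EFin \o (fun x => complex.Re (h x))) /\
  lebesgue_measure.-integrable D (EFin \o (fun x => complex.Im (h x))).

Definition cintegral (R : realType) (D : set R) (h : R -> R[i]) : R[i] :=
  (\int[lebesgue_measure]_(x in D) complex.Re (h x)) +i*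
  (\int[lebesgue_measure]_(x in D) complex.Im (h x)).

Definition vintegrable (R : realType) (D : set R) (v : R -> 'cV[R[i]]_2)
  : Prop := forall k, cintegrable D (fun x => v x k 0).

Definition vintegral (R : realType) (D : set R) (v : R -> 'cV[R[i]]_2)
  : 'cV[R[i]]_2 := \col_k cintegral D (fun x => v x k 0).

(* [R[i]^o] is the alias of [R[i]] that carries the norm topology. *)

Definition vcontinuous (R : realType) (v : R -> 'cV[R[i]]_2) : Prop :=
  continuous (v : R -> 'cV[R[i]^o]_2).

Definition vbounded (R : realType) (v : R -> 'cV[R[i]]_2) : Prop :=
  bounded_fun (v : R -> 'cV[R[i]^o]_2).

Definition cvg_0plus (R : realType) (v : R -> 'cV[R[i]]_2) : Prop :=
  cvg ((v eps : 'cV[R[i]^o]_2) @[eps --> 0^'+]).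

Definition lim_0plus (R : realType) (v : R -> 'cV[R[i]]_2) : 'cV[R[i]]_2 :=
  lim ((v eps : 'cV[R[i]^o]_2) @[eps --> 0^'+]).

Definition smooth (R : realType) (h : R -> R) : Prop :=
  forall (n : nat) (x : R), derivable (h^`(n))%classic x 1.

Definition schwartz (R : realType) (h : R -> R) : Prop :=
  smooth h /\
  forall j n : nat, exists C : R, forall x, `|x| ^+ j * `|(h^`(n))%classic x| <= C.

Definition cschwartz (R : realType) (h : R -> R[i]) : Prop :=
  schwartz (fun x => complex.Re (h x)) /\ schwartz (fun x => complex.Im (h x)).

Definition vschwartz (R : realType) (v : R -> 'cV[R[i]]_2) : Prop :=
  forall k, cschwartz (fun x => v x k 0).

Definition vL2 (R : realType) (v : R -> 'cV[R[i]]_2) : Prop :=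
  forall k, (fun x => complex.Re (v x k 0)) \in Lfun (@lebesgue_measure R) 2%:E /\
            (fun x => complex.Im (v x k 0)) \in Lfun (@lebesgue_measure R) 2%:E.

Definition test_function (R : realType) (phi : R -> R) : Prop :=
  smooth phi /\ exists M : R, forall x, M < `|x| -> phi x = 0.

Definition weak_derivative (R : realType) (u v : R -> 'cV[R[i]]_2) : Prop :=
  forall phi : R -> R, test_function phi ->
    vintegral setT (fun x => ((phi^`())%classic x)%:C *: u x) =
    - vintegral setT (fun x => (phi x)%:C *: v x).

(* [u] is the continuous representative of an element of H^1(R, C^2) whose
   weak derivative is (the class of) [v]. *)
Definition H1_derivative (R : realType) (u v : R -> 'cV[R[i]]_2) : Prop :=
  [/\ vcontinuous u, vL2 u, vL2 v & weak_derivative u v].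

Definition cexp (R : realType) (z : R[i]) : R[i] :=
  (expR (complex.Re z))%:C * (cos (complex.Im z) +i* sin (complex.Im z)).

Definition diag2 (R : realType) (a b : R[i]) : 'M[R[i]]_2 :=
  diag_mx (\row_k if k == 0 then a else b).

Definition sigma3 (R : realType) : 'M[R[i]]_2 := diag2 1 (-1).

Definition e1 (R : realType) : 'cV[R[i]]_2 := delta_mx 0 0.

Definition e2 (R : realType) : 'cV[R[i]]_2 := delta_mx 1 0.

Definition Qmx (R : realType) (q : R -> R[i]) (x : R) : 'M[R[i]]_2 :=
  \matrix_(j, k) if j == k then 0 else if j == 0 then q x else (q x)^*.

(* Graph of T = i sigma_3 d/dx - i sigma_3 Q with domain H^1: [w] represents
   the L^2 class T u. *)
Definition opT_graph (R : realType) (q : R -> R[i])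
    (u w : R -> 'cV[R[i]]_2) : Prop :=
  exists2 v : R -> 'cV[R[i]]_2, H1_derivative u v &
    {ae lebesgue_measure, forall x : R,
       w x = 'i%C *: (sigma3 R *m v x) - 'i%C *: (sigma3 R *m Qmx q x *m u x)}.

(* (T - z)^-1 g: the (continuous) element u of the domain of T such that
   T u - z u = g in L^2; the zero function if there is none. *)
Definition resolvent (R : realType) (q : R -> R[i]) (z : R[i])
    (g : R -> 'cV[R[i]]_2) : R -> 'cV[R[i]]_2 :=
  xget (fun=> 0) [set u | exists2 w, opT_graph q u w &
    {ae lebesgue_measure, forall x : R, w x - z *: u x = g x}].

(* Bounded solutions of the Volterra equations with kernel [K (x - s) Q(s)],
   from -oo and from +oo respectively; the integrals are required to converge
   absolutely. *)
Definition volterra_left (R : realType) (q : R -> R[i]) (b : 'cV[R[i]]_2)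
    (K : R -> 'M[R[i]]_2) (r : R -> 'cV[R[i]]_2) : Prop :=
  vbounded r /\ forall x : R,
    let h := fun s => K (x - s) *m Qmx q s *m r s in
    vintegrable `]-oo, x] h /\ r x = b + vintegral `]-oo, x] h.

Definition volterra_right (R : realType) (q : R -> R[i]) (b : 'cV[R[i]]_2)
    (K : R -> 'M[R[i]]_2) (r : R -> 'cV[R[i]]_2) : Prop :=
  vbounded r /\ forall x : R,
    let h := fun s => K (x - s) *m Qmx q s *m r s in
    vintegrable `[x, +oo[ h /\ r x = b - vintegral `[x, +oo[ h.

Definition kernel1 (R : realType) (lam : R[i]) (t : R) : 'M[R[i]]_2 :=
  diag2 1 (cexp (2%:R * 'i%C * lam * t%:C)).

Definition kernel2 (R : realType) (lam : R[i]) (t : R) : 'M[R[i]]_2 :=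
  diag2 (cexp (- (2%:R * 'i%C * lam * t%:C))) 1.

(* The first letter after [r] is the index 1 or 2, the second one stands for
   the sign. [r1m], [r2p] are meant for 0 <= Im lam and [r2m], [r1p] for
   Im lam <= 0, where the bounded solution is unique. *)
Definition r1m (R : realType) (q : R -> R[i]) (lam : R[i])
  : R -> 'cV[R[i]]_2 :=
  xget (fun=> 0) [set r | volterra_left q (e1 R) (kernel1 lam) r].

Definition r2p (R : realType) (q : R -> R[i]) (lam : R[i])
  : R -> 'cV[R[i]]_2 :=
  xget (fun=> 0) [set r | volterra_right q (e2 R) (kernel2 lam) r].

Definition r2m (R : realType) (q : R -> R[i]) (lam : R[i])
  : R -> 'cV[R[i]]_2 :=
  xget (fun=> 0) [set r | volterra_right q (e1 R) (kernel1 lam) r].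

Definition r1p (R : realType) (q : R -> R[i]) (lam : R[i])
  : R -> 'cV[R[i]]_2 :=
  xget (fun=> 0) [set r | volterra_left q (e2 R) (kernel2 lam) r].

Definition m1m (R : realType) (q : R -> R[i]) (lam : R[i]) (x : R)
  : 'cV[R[i]]_2 := cexp (- ('i%C * lam * x%:C)) *: r1m q lam x.

Definition m2p (R : realType) (q : R -> R[i]) (lam : R[i]) (x : R)
  : 'cV[R[i]]_2 := cexp ('i%C * lam * x%:C) *: r2p q lam x.

Definition m2m (R : realType) (q : R -> R[i]) (lam : R[i]) (x : R)
  : 'cV[R[i]]_2 := cexp (- ('i%C * lam * x%:C)) *: r2m q lam x.

Definition m1p (R : realType) (q : R -> R[i]) (lam : R[i]) (x : R)
  : 'cV[R[i]]_2 := cexp ('i%C * lam * x%:C) *: r1p q lam x.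

(* The determinants do not depend on the point at which they are evaluated. *)
Definition scat_a (R : realType) (q : R -> R[i]) (lam : R[i]) : R[i] :=
  \det (row_mx (m1m q lam 0) (m2p q lam 0)).

Definition scat_A (R : realType) (q : R -> R[i]) (lam : R[i]) : R[i] :=
  \det (row_mx (m2m q lam 0) (m1p q lam 0)).

Definition c_plus (R : realType) (q : R -> R[i]) (f : R -> 'cV[R[i]]_2)
    (lam : R) : R[i] :=
  (scat_a q lam%:C)^-1 *
  cintegral setT (fun s => - m1m q lam%:C s 1 0 * f s 0 0
                           + m1m q lam%:C s 0 0 * f s 1 0).

Definition c_minus (R : realType) (q : R -> R[i]) (f : R -> 'cV[R[i]]_2)
    (lam : R) : R[i] :=
  - (scat_A q lam%:C)^-1 *
  cintegral setT (fun s => m1p q lam%:C s 1 0 * f s 0 0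
                           - m1p q lam%:C s 0 0 * f s 1 0).

(* Main.v *)
Require Import Defs.
From HB Require Import structures.
From mathcomp Require Import all_boot all_order all_algebra complex.
From mathcomp Require Import all_classical all_reals all_analysis measurable_realfun.
From mathcomp Require Import ring lra.
Import Order.TTheory GRing.Theory Num.Theory.
Import numFieldNormedType.Exports.
Set Implicit Arguments.
Unset Strict Implicit.
Unset Printing Implicit Defensive.
Local Open Scope classical_set_scope.
Local Open Scope ring_scope.
Local Open Scope complex_scope.
Local Notation Re := complex.Re.
Local Notation Im := complex.Im.

(** Write T for the operator and sigma for sigma_3. For Im z <> 0 the equation
    (T - z) u = i sigma f is the first-order system
      u1' = - i z u1 + q u2 + f1,   u2' = conj q u1 + i z u2 + f2,
    written [is_sol] below. [resolventE] identifies its decaying solution with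
    the resolvent: a weak solution is classical by [du_bois_reymond], and two
    square-integrable solutions agree because (|u1|^2 - |u2|^2)' has a sign
    when the source vanishes ([homogeneous_L2_eq0]). Two facts then give the
    theorem.

    The jump. In the upper half-plane the solution is Green's formula
    ([green_sol]) built on the Jost solutions from both ends. All bounds hold
    up to the real axis, because the Wronskian of these solutions has modulus
    at least 1 ([jwr_ge1], again by monotonicity of |u1|^2 - |u2|^2, which is
    where tau = 1 enters). Complex conjugation, with exchange of the two entries,
    turns a solution at z into a solution at conj z, which reduces the lower
    half-plane to the upper one. So the difference of the resolvents at
    lambda +- i eps converges to a difference of two Green solutions at
    lambda. Each of these is a multiple of a Jost solution plus a term that
    vanishes at +oo, and a homogeneous solution that vanishes at +oo is zero;
    hence the limit is c_+ m_{2,+} + c_- m_{2,-} ([jump], [jumpv_lip0]).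

    The integral. Expanding the resolvent twice at infinity gives
      u = -+ i f / (z + i) + (c + B(z)) / (z + i)^2
    at each point, with B bounded and differentiable in the upper half-plane
    ([usol_cG]). The second term has integral zero along every horizontal line
    ([contour_zero]), while 1/(z + i) minus its conjugate is a multiple of a Poisson kernel,
    whose integral does not depend on the height. Therefore the integral of
    the jump at height eps is 2 pi i times i sigma f(x) for every eps > 0, not
    only in the limit ([jumpv_integral]).

    The jump at height eps <= 1 is dominated by a multiple of 1/(1+lambda^2)
    uniformly in eps, so that dominated convergence ([limit_integral]) carries
    the value of the integral to the real axis.

    Moduli of complex numbers are measured by the norm |Re z| + |Im z|,
    written [cn], and decay on the line by the weight [lorentz]. *)

(** * Real functions dominated by 1/(1+x^2) *)

Section real_tools.
Variable R : realType.
Implicit Types (F G H f g h : R -> R) (x X s t : R).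
Local Notation mu := (@lebesgue_measure R).

Lemma is_derive_ndecr F f X :
  (forall t, t <= X -> is_derive t 1 F (f t)) ->
  (forall t, t <= X -> 0 <= f t) ->
  forall s t, s <= t -> t <= X -> F s <= F t.
Proof.
move=> dF f0 s t st tX.
have dF' : forall y, y \in `]s, t[ -> is_derive y 1 F (f y).
  by move=> y; rewrite in_itv /= => /andP[_ yt]; apply: dF; lra.
have cF : {within `[s, t], continuous F}.
  apply: derivable_within_continuous => y; rewrite in_itv /= => /andP[_ yt].
  by have [] : is_derive y 1 F (f y) by apply: dF; lra.
have [c] := MVT_segment st dF' cF.
rewrite in_itv /= => /andP[_ ct] E.
by rewrite -subr_ge0 E mulr_ge0 ?subr_ge0 // f0; lra.
Qed.

Definition vanishes_left F := forall e, 0 < e -> exists A, forall x, x <= A -> `|F x| <= e.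

Lemma vanishes_left_le F G : vanishes_left G -> (forall x, `|F x| <= G x) ->
  vanishes_left F.
Proof.
move=> vG FG e e0; have [A hA] := vG e e0; exists A => x xA.
by apply: (le_trans (FG x)); apply: (le_trans (ler_norm _)); exact: hA.
Qed.

Lemma vanishes_leftZ F (c : R) : vanishes_left F -> vanishes_left (fun x => c * F x).
Proof.
move=> vF e e0.
have c1 : 0 < `|c| + 1 by rewrite ltr_wpDl.
have [A hA] := vF (e / (`|c| + 1)) (divr_gt0 e0 c1); exists A => x xA.
rewrite normrM; have := hA x xA; rewrite ler_pdivlMr // => h.
apply: (le_trans _ h); rewrite mulrC ler_wpM2l //; lra.
Qed.

Lemma vanishes_leftD F G : vanishes_left F -> vanishes_left G ->
  vanishes_left (fun x => F x + G x).
Proof.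
move=> vF vG e e0.
have e2 : 0 < e / 2 by lra.
have [A hA] := vF _ e2; have [B hB] := vG _ e2.
exists (Num.min A B) => x; rewrite le_min => /andP[/hA a /hB b].
by apply: (le_trans (ler_normD _ _)); lra.
Qed.

(** Integrated form of |g| <= h, both primitives starting from -oo; the upper
    primitive H is only known to be nonnegative. *)
Lemma comparison_left G g H h X :
  (forall t, t <= X -> is_derive t 1 G (g t)) -> vanishes_left G ->
  (forall t, t <= X -> is_derive t 1 H (h t)) ->
  (forall t, t <= X -> 0 <= H t) ->
  (forall t, t <= X -> `|g t| <= h t) -> `|G X| <= H X.
Proof.
move=> dG vG dH H0 gh.
have mono (b : bool) : - H X <= (-1) ^+ b * G X.
  apply/ler_addgt0Pl => e e0; have [A hA] := vG e e0.
  set x := Num.min A X.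
  have xA : x <= A by rewrite ge_min lexx.
  have xX : x <= X by rewrite ge_min lexx orbT.
  have dd t : t <= X -> is_derive t 1 (fun y => H y + (-1) ^+ b * G y) (h t + (-1) ^+ b * g t).
    move=> tX; have := dG t tX; have := dH t tX => hd gd.
    by apply: is_derive_eq; rewrite ?mulr0 ?addr0 // mulrC.
  have pos t : t <= X -> 0 <= h t + (-1) ^+ b * g t.
    move=> tX; have := gh t tX; rewrite ler_norml => /andP[].
    by case: b {dd} => /=; rewrite ?expr0 ?expr1; lra.
  have := is_derive_ndecr dd pos xX (lexx X).
  have := hA x xA; have := H0 x xX; rewrite ler_norml => h0 /andP[h1 h2].
  by case: b {dd pos} => /=; rewrite ?expr0 ?expr1; lra.
by rewrite ler_norml; have := mono true; have := mono false; rewrite expr0 expr1; lra.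
Qed.

Definition lorentz x : R := (1 + x ^+ 2)^-1.

Lemma lorentz_gt0 x : 0 < lorentz x.
Proof. by rewrite invr_gt0 ltr_pwDl // sqr_ge0. Qed.

Lemma lorentz_ge0 x : 0 <= lorentz x.
Proof. exact/ltW/lorentz_gt0. Qed.

Lemma lorentz_le1 x : lorentz x <= 1.
Proof. by rewrite invf_le1 ?lerDl ?sqr_ge0 // ltr_pwDl // sqr_ge0. Qed.

Lemma lorentzN x : lorentz (- x) = lorentz x.
Proof. by rewrite /lorentz sqrrN. Qed.

Lemma lorentz_cont : continuous lorentz.
Proof.
move=> x; apply: cvgV; first by rewrite gt_eqF // ltr_pwDl // sqr_ge0.
apply: cvgD; first exact: cvg_cst.
exact: exprn_continuous.
Qed.

Lemma integral_lorentzy a : (\int[mu]_(x in `[a, +oo[) (lorentz x)%:E = (pi / 2 - atan a)%:E)%E.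
Proof.
rewrite (@ge0_continuous_FTC2y _ lorentz (@atan R) a (pi / 2)) ?EFinB //.
- by move=> x _; exact: lorentz_ge0.
- by apply: continuous_subspaceT => x; exact: lorentz_cont.
- exact: cvgy_atan.
- exact: cvg_at_right_filter (@continuous_atan R a).
- by move=> x _; rewrite derive1E derive_val.
Qed.

Lemma integral_lorentzNy a : (\int[mu]_(x in `]-oo, a]) (lorentz x)%:E = (atan a + pi / 2)%:E)%E.
Proof.
rewrite -[a]opprK ge0_integration_by_substitutionNy.
- under eq_integral do rewrite /= lorentzN.
  by rewrite integral_lorentzy atanN !opprK addrC.
- by apply: continuous_subspaceT => x; exact: lorentz_cont.
- by move=> x _; exact: lorentz_ge0.
Qed.

Lemma cont_measurable f (D : set R) : measurable D -> continuous f -> measurable_fun D f.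
Proof. by move=> mD cf; apply: measurable_funS (continuous_measurable_fun cf). Qed.

Lemma lorentz_integrableNy a : mu.-integrable `]-oo, a] (EFin \o lorentz).
Proof.
apply/integrableP; split.
  by apply/measurable_EFinP; apply: cont_measurable => //; exact: lorentz_cont.
under eq_integral do rewrite /= ger0_norm ?lorentz_ge0 //.
by rewrite integral_lorentzNy ltry.
Qed.

Lemma lorentz_integrabley a : mu.-integrable `[a, +oo[ (EFin \o lorentz).
Proof.
apply/integrableP; split.
  by apply/measurable_EFinP; apply: cont_measurable => //; exact: lorentz_cont.
under eq_integral do rewrite /= ger0_norm ?lorentz_ge0 //.
by rewrite integral_lorentzy ltry.
Qed.

Lemma lorentz_integrable : mu.-integrable setT (EFin \o lorentz).
Proof.
apply/integrableP; split.
  by apply/measurable_EFinP; apply: cont_measurable => //; exact: lorentz_cont.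
under eq_integral do rewrite /= ger0_norm ?lorentz_ge0 //.
rewrite ge0_symfun_integralT; first by rewrite -set_itvcy integral_lorentzy -EFinM ltry.
- exact: lorentz_ge0.
- exact: lorentz_cont.
- by move=> x; rewrite /= lorentzN.
Qed.

End real_tools.

Section improper.
Variable R : realType.
Implicit Types (F G H f g h : R -> R) (x X s t : R).
Local Notation mu := (@lebesgue_measure R).

Lemma atan_pi2_gt0 x : 0 < atan x + pi / 2.
Proof. by have := atan_gtNpi2 x; lra. Qed.

Lemma pi2_atan_gt0 x : 0 < pi / 2 - atan x.
Proof. by have := atan_ltpi2 x; lra. Qed.

Lemma atan_vanishes_left : vanishes_left (fun x : R => atan x + pi / 2).
Proof.
move=> e e0.
have /cvgrPdist_le /(_ e e0) [A [_ hA]] := @cvgy_atan R.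
exists (- A - 1) => x xA; have := hA (- x); rewrite atanN opprK addrC; apply; lra.
Qed.

(** Decay at -oo only, with a constant that may grow with the right end point:
    kernels such as exp (- m s) are unbounded at +oo. *)
Definition left_dominated g := forall X, exists M, forall t, t <= X -> `|g t| <= M * lorentz t.

Lemma left_dominatedW g M : (forall t, `|g t| <= M * lorentz t) -> left_dominated g.
Proof. by move=> h X; exists M. Qed.

Lemma lorentz_dominated_integrable (D : set (measurableTypeR R)) g M : measurable D ->
  mu.-integrable D (EFin \o @lorentz R) -> continuous g ->
  (forall t, D t -> `|g t| <= M * lorentz t) -> mu.-integrable D (EFin \o g).
Proof.
move=> mD iD cg gM.
have iM : mu.-integrable D (EFin \o (fun t => M * lorentz t)).
  rewrite [X in _.-integrable _ X](_ : _ = fun t => M%:E * (EFin \o @lorentz R) t)%E //.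
  exact: integrableZl.
apply: le_integrable iM => //; first by apply/measurable_EFinP; exact: cont_measurable.
by move=> t Dt; rewrite /= lee_fin (le_trans (gM t Dt)) // ler_norm.
Qed.

Lemma left_integrable g X : continuous g -> left_dominated g ->
  mu.-integrable `]-oo, X] (EFin \o g).
Proof.
move=> cg dg; have [M gM] := dg X.
apply: (@lorentz_dominated_integrable _ _ M) => //.
  exact: lorentz_integrableNy.
Qed.

Lemma dominated_integrable g M : continuous g -> (forall t, `|g t| <= M * lorentz t) ->
  mu.-integrable setT (EFin \o g).
Proof.
move=> cg gM; apply: (@lorentz_dominated_integrable _ _ M) => //.
exact: lorentz_integrable.
Qed.

Definition lint g x := \int[mu]_(t in `]-oo, x]) g t.

Lemma lint_lorentz x : lint (@lorentz R) x = atan x + pi / 2.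
Proof. by rewrite /lint /Rintegral integral_lorentzNy. Qed.

Lemma lint_derive g x : continuous g -> left_dominated g ->
  is_derive x 1 (lint g) (g x).
Proof.
move=> cg dg.
have [] := @continuous_FTC1 R g -oo%O x (x + 1) _ (left_integrable _ cg dg) _ (cg x).
- by rewrite ltrDl.
- by rewrite ltNyr.
- by move=> d e; apply: (DeriveDef d); rewrite -derive1E; exact: e.
Qed.

Lemma Rintegral_dominated (D : set (measurableTypeR R)) g M : measurable D ->
  mu.-integrable D (EFin \o @lorentz R) -> mu.-integrable D (EFin \o g) ->
  (forall t, D t -> `|g t| <= M * lorentz t) ->
  `|\int[mu]_(t in D) g t| <= M * \int[mu]_(t in D) lorentz t.
Proof.
move=> mD iD ig gM.
apply: (le_trans (le_normr_Rintegral mD ig)).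
rewrite -RintegralZl //; apply: le_Rintegral => //.
  by apply: eq_integrable (integrable_abse ig).
rewrite [X in _.-integrable _ X](_ : _ = fun t => M%:E * (EFin \o @lorentz R) t)%E //.
exact: integrableZl.
Qed.

Lemma lint_bound g M X x : continuous g -> left_dominated g ->
  (forall t, t <= X -> `|g t| <= M * lorentz t) -> x <= X ->
  `|lint g x| <= M * (atan x + pi / 2).
Proof.
move=> cg dg gM xX; rewrite -lint_lorentz.
apply: Rintegral_dominated => //; first exact: lorentz_integrableNy.
  exact: left_integrable.
by move=> t; rewrite /= in_itv /= => tx; apply: gM; lra.
Qed.

Lemma lint_vanishes g : continuous g -> left_dominated g -> vanishes_left (lint g).
Proof.
move=> cg dg; have [M gM] := dg 0.
have v := vanishes_leftZ (`|M|) atan_vanishes_left.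
move=> e e0; have [A hA] := v e e0; exists (Num.min A 0) => x.
rewrite le_min => /andP[xA x0].
apply: (le_trans (lint_bound cg dg gM x0)).
apply: (le_trans _ (hA x xA)); apply: (le_trans _ (ler_norm _)).
by rewrite ler_wpM2r ?ler_norm //; exact/ltW/atan_pi2_gt0.
Qed.

(** Characterises the integral from -oo as the primitive that vanishes at -oo;
    differential equations are turned into integrals through it. *)
Lemma lint_unique g G : continuous g -> left_dominated g ->
  (forall t, is_derive t 1 G (g t)) -> vanishes_left G -> forall x, G x = lint g x.
Proof.
move=> cg dg dG vG x.
suff : `|G x - lint g x| <= 0 by rewrite normr_le0 subr_eq0 => /eqP.
apply: (@comparison_left R (fun y => G y - lint g y) (fun=> 0) (fun=> 0) (fun=> 0)) => //.
- move=> t _; have := dG t; have := lint_derive t cg dg => d1 d2.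
  by apply: is_derive_eq; rewrite subrr.
- rewrite (_ : (fun y => _) = fun y => G y + (-1) * lint g y); last first.
    by apply/funext => y; rewrite mulN1r.
  by apply: vanishes_leftD => //; apply: vanishes_leftZ; exact: lint_vanishes.
- by move=> t _; rewrite normr0.
Qed.

Lemma Rintegral_lint g M x : continuous g -> (forall t, `|g t| <= M * lorentz t) ->
  `|\int[mu]_t g t - lint g x| <= M * (pi / 2 - atan x).
Proof.
move=> cg gM; have iT := dominated_integrable cg gM.
have E : \int[mu]_t g t = lint g x + \int[mu]_(t in `]x, +oo[) g t.
  rewrite /lint -Rintegral_setU //.
  - congr Rintegral; apply/seteqP; split => t //= _; rewrite !in_itv /= andbT.
    by have [] := leP t x; [left|right].
  - by apply: integrableS iT => //; exact: measurableU.
  - apply/disj_setPS => t /= []; rewrite !in_itv /= andbT => a b; lra.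
rewrite E addrAC subrr add0r Rintegral_itv_obnd_cbnd; last first.
  exact: integrableS iT.
have -> : pi / 2 - atan x = \int[mu]_(t in `[x, +oo[) lorentz t.
  by rewrite /Rintegral integral_lorentzy.
apply: Rintegral_dominated => //; first exact: lorentz_integrabley.
by apply: integrableS iT.
Qed.

End improper.

(** * Complex-valued functions of a real variable *)

Section complex_tools.
Variable R : realType.
Implicit Types (f g h : R -> R[i]) (x X s t : R) (z w m l : R[i]).

Lemma ReM z w : Re (z * w) = Re z * Re w - Im z * Im w.
Proof. by case: z; case: w. Qed.
Lemma ImM z w : Im (z * w) = Re z * Im w + Im z * Re w.
Proof. by case: z; case: w. Qed.
Lemma ReD z w : Re (z + w) = Re z + Re w.
Proof. by case: z; case: w. Qed.
Lemma ImD z w : Im (z + w) = Im z + Im w.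
Proof. by case: z; case: w. Qed.
Lemma ReN z : Re (- z) = - Re z.
Proof. by case: z. Qed.
Lemma ImN z : Im (- z) = - Im z.
Proof. by case: z. Qed.
Lemma ReC z : Re (z^*) = Re z.
Proof. by case: z. Qed.
Lemma ImC z : Im (z^*) = - Im z.
Proof. by case: z. Qed.
Lemma complexP z w : Re z = Re w -> Im z = Im w -> z = w.
Proof. by case: z; case: w => /= a b c d -> ->. Qed.

(** Reduces identities with conjugates to real ring identities. *)
Definition reim := (ReM, ImM, ReD, ImD, ReN, ImN, ReC, ImC).

Definition sqn z : R := Re z ^+ 2 + Im z ^+ 2.

Lemma sqn_ge0 z : 0 <= sqn z.
Proof. by rewrite addr_ge0 ?sqr_ge0. Qed.

Lemma sqn_eq0 z : sqn z = 0 -> z = 0.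
Proof.
move/eqP; rewrite paddr_eq0 ?sqr_ge0 // !sqrf_eq0 => /andP[/eqP a /eqP b].
by apply: complexP.
Qed.

(** The l1 norm is submultiplicative and splits into real integrals without
    square roots. *)
Definition cn z : R := `|Re z| + `|Im z|.

Lemma cn_ge0 z : 0 <= cn z. Proof. by rewrite addr_ge0. Qed.
Lemma cn0 : cn 0 = 0. Proof. by rewrite /cn normr0 addr0. Qed.
Lemma cn1 : cn 1 = 1. Proof. by rewrite /cn /= normr0 normr1 addr0. Qed.
Lemma cni : cn 'i%C = 1. Proof. by rewrite /cn /= normr0 normr1 add0r. Qed.
Lemma cnN z : cn (- z) = cn z. Proof. by rewrite /cn !reim !normrN. Qed.
Lemma cnC z : cn (z^*) = cn z. Proof. by rewrite /cn !reim normrN. Qed.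
Lemma cnR (r : R) : cn r%:C = `|r|. Proof. by rewrite /cn /= normr0 addr0. Qed.

Lemma cnD z w : cn (z + w) <= cn z + cn w.
Proof.
rewrite /cn !reim.
by have := ler_normD (Re z) (Re w); have := ler_normD (Im z) (Im w); lra.
Qed.

Lemma cnB z w : cn (z - w) <= cn z + cn w.
Proof. by rewrite -(cnN w); exact: cnD. Qed.

Lemma cnM z w : cn (z * w) <= cn z * cn w.
Proof.
rewrite /cn !reim.
have := ler_normB (Re z * Re w) (Im z * Im w).
have := ler_normD (Re z * Im w) (Im z * Re w).
rewrite !normrM; lra.
Qed.

Lemma cn_eq0 z : cn z <= 0 -> z = 0.
Proof.
move=> h; have [h1 h2] : Re z = 0 /\ Im z = 0.
  by move: h; rewrite /cn; have := normr_ge0 (Re z); have := normr_ge0 (Im z) => a b c;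
    split; apply: normr0_eq0; lra.
by apply: complexP.
Qed.

Lemma Re_le_cn z : `|Re z| <= cn z. Proof. by rewrite lerDl. Qed.
Lemma Im_le_cn z : `|Im z| <= cn z. Proof. by rewrite lerDr. Qed.

Lemma sqn_le_cn z : sqn z <= cn z ^+ 2.
Proof.
rewrite /sqn /cn -(real_normK (num_real (Re z))) -(real_normK (num_real (Im z))).
by have := normr_ge0 (Re z); have := normr_ge0 (Im z); nra.
Qed.

Lemma cn_le_sqn z : cn z ^+ 2 <= 2 * sqn z.
Proof.
rewrite /sqn /cn -(real_normK (num_real (Re z))) -(real_normK (num_real (Im z))).
by have := sqr_ge0 (`|Re z| - `|Im z|); nra.
Qed.

Lemma sqnM z w : sqn (z * w) = sqn z * sqn w.
Proof. rewrite /sqn !reim; ring. Qed.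

Lemma cnV_le z (b : R) : 0 < b -> b ^+ 2 <= sqn z -> cn z^-1 <= 2 / b.
Proof.
move=> b0 bz.
have z0 : z != 0 by apply/eqP => z0; move: bz; rewrite z0 /sqn expr0n /= addr0; nra.
have s1 : sqn z^-1 * sqn z = 1 by rewrite -sqnM mulVf // /sqn /= expr1n expr0n addr0.
have s0 := sqn_ge0 z^-1.
have h : sqn z^-1 * b ^+ 2 <= 1 by rewrite -s1 ler_wpM2l.
have h2 := cn_le_sqn z^-1.
rewrite ler_pdivlMr //.
have : (cn z^-1 * b) ^+ 2 <= 2 ^+ 2.
  by rewrite exprMn; apply: (@le_trans _ _ (2 * sqn z^-1 * b ^+ 2)); [rewrite ler_wpM2r // sqr_ge0|lra].
rewrite ler_pXn2r ?nnegrE // ?ler0n // mulr_ge0 ?cn_ge0 //; lra.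
Qed.

Definition cderive f x l := is_derive x (1:R) (fun t => Re (f t)) (Re l) /\
  is_derive x (1:R) (fun t => Im (f t)) (Im l).

Lemma cderive_eq f x l l' : cderive f x l -> l = l' -> cderive f x l'.
Proof. by move=> ? <-. Qed.

Lemma cderive_ext f g x l : f =1 g -> cderive f x l -> cderive g x l.
Proof. by move=> /funext ->. Qed.

Lemma cderive_cst z x : cderive (fun=> z) x 0.
Proof. by split => /=; exact: is_derive_cst. Qed.

Lemma cderiveD f g x l m : cderive f x l -> cderive g x m ->
  cderive (fun t => f t + g t) x (l + m).
Proof.
move=> [a b] [c d]; split.
  rewrite (_ : (fun t => _) = fun t => Re (f t) + Re (g t)); last by apply/funext => t; rewrite reim.
  by rewrite reim; exact: is_deriveD.
rewrite (_ : (fun t => _) = fun t => Im (f t) + Im (g t)); last by apply/funext => t; rewrite reim.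
by rewrite reim; exact: is_deriveD.
Qed.

Lemma cderiveM f g x l m : cderive f x l -> cderive g x m ->
  cderive (fun t => f t * g t) x (l * g x + f x * m).
Proof.
move=> [a b] [c d]; split.
  rewrite (_ : (fun t => _) = fun t => Re (f t) * Re (g t) - Im (f t) * Im (g t)); last first.
    by apply/funext => t; rewrite reim.
  by apply: is_derive_eq; rewrite !reim /GRing.scale /=; ring.
rewrite (_ : (fun t => _) = fun t => Re (f t) * Im (g t) + Im (f t) * Re (g t)); last first.
  by apply/funext => t; rewrite reim.
by apply: is_derive_eq; rewrite !reim /GRing.scale /=; ring.
Qed.

Lemma cderiveZ z f x l : cderive f x l -> cderive (fun t => z * f t) x (z * l).
Proof.
by move=> /(cderiveM (cderive_cst z x)) d; apply: cderive_eq d _; rewrite mul0r add0r.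
Qed.

Lemma cderiveN f x l : cderive f x l -> cderive (fun t => - f t) x (- l).
Proof.
move=> /(cderiveZ (-1)) d; rewrite -mulN1r; apply: cderive_ext d => t.
by rewrite mulN1r.
Qed.

Lemma cderiveB f g x l m : cderive f x l -> cderive g x m ->
  cderive (fun t => f t - g t) x (l - m).
Proof. by move=> a /cderiveN; exact: cderiveD. Qed.

Lemma cderiveC f x l : cderive f x l -> cderive (fun t => (f t)^*) x (l^*).
Proof.
move=> [a b]; split; rewrite reim.
  by rewrite (_ : (fun t => _) = fun t => Re (f t)) //; apply/funext => t; rewrite reim.
rewrite (_ : (fun t => _) = fun t => - Im (f t)); last by apply/funext => t; rewrite reim.
exact: is_deriveN.
Qed.

Lemma is_derive_opparg (F : R -> R) x (d : R) : is_derive (- x) (1:R) F d ->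
  is_derive x (1:R) (fun t => F (- t)) (- d).
Proof.
move=> h; have h2 : is_derive x (1:R) (fun t : R => - t) (-1).
  by apply: is_derive_eq.
have := @is_derive1_comp R F (fun t => - t) x d (-1) h h2.
by rewrite mulrN1.
Qed.

Lemma cderive_opparg f x l : cderive f (- x) l -> cderive (fun t => f (- t)) x (- l).
Proof.
by move=> [a b]; split; rewrite reim; exact: (is_derive_opparg (F := fun t => _ (f t))).
Qed.

Definition ccont f := continuous (fun t => Re (f t)) /\ continuous (fun t => Im (f t)).

Lemma is_derive_continuous (F F' : R -> R) : (forall x, is_derive x (1:R) F (F' x)) ->
  continuous F.
Proof.
move=> h x; apply: differentiable_continuous; apply/derivable1_diffP.
by have [] := h x.
Qed.

Lemma cderive_cont f g : (forall x, cderive f x (g x)) -> ccont f.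
Proof.
by move=> h; split; [apply: (is_derive_continuous (F' := fun x => Re (g x)))|
  apply: (is_derive_continuous (F' := fun x => Im (g x)))] => x; have [] := h x.
Qed.

Lemma ccont_cst z : ccont (fun=> z).
Proof. by split => x; exact: cvg_cst. Qed.

Lemma ccont_ext f g : f =1 g -> ccont f -> ccont g.
Proof. by move=> /funext ->. Qed.

Lemma ccontD f g : ccont f -> ccont g -> ccont (fun t => f t + g t).
Proof.
move=> [a b] [c d]; split.
  rewrite (_ : (fun t => _) = fun t => Re (f t) + Re (g t)); last by apply/funext => t; rewrite reim.
  by move=> x; apply: cvgD; [exact: a|exact: c].
rewrite (_ : (fun t => _) = fun t => Im (f t) + Im (g t)); last by apply/funext => t; rewrite reim.
by move=> x; apply: cvgD; [exact: b|exact: d].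
Qed.

Lemma ccontM f g : ccont f -> ccont g -> ccont (fun t => f t * g t).
Proof.
move=> [a b] [c d]; split.
  rewrite (_ : (fun t => _) = fun t => Re (f t) * Re (g t) - Im (f t) * Im (g t)); last first.
    by apply/funext => t; rewrite reim.
  by move=> x; apply: cvgB; apply: cvgM; [exact: a|exact: c|exact: b|exact: d].
rewrite (_ : (fun t => _) = fun t => Re (f t) * Im (g t) + Im (f t) * Re (g t)); last first.
  by apply/funext => t; rewrite reim.
by move=> x; apply: cvgD; apply: cvgM; [exact: a|exact: d|exact: b|exact: c].
Qed.

Lemma ccontZ z f : ccont f -> ccont (fun t => z * f t).
Proof. by move=> /(ccontM (ccont_cst z)). Qed.

Lemma ccontN f : ccont f -> ccont (fun t => - f t).
Proof. by move=> /(ccontZ (-1)); apply: ccont_ext => t; rewrite mulN1r. Qed.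

Lemma ccontB f g : ccont f -> ccont g -> ccont (fun t => f t - g t).
Proof. by move=> a /ccontN; exact: ccontD. Qed.

Lemma ccontC f : ccont f -> ccont (fun t => (f t)^*).
Proof.
move=> [a b]; split.
  by rewrite (_ : (fun t => _) = fun t => Re (f t)) //; apply/funext => t; rewrite reim.
rewrite (_ : (fun t => _) = fun t => - Im (f t)); last by apply/funext => t; rewrite reim.
by move=> x; apply: cvgN; exact: b.
Qed.

Lemma ccont_opparg f : ccont f -> ccont (fun t => f (- t)).
Proof.
move=> [a b]; split => x.
  by apply: (@continuous_comp _ _ _ (fun t : R => - t) (fun t => Re (f t))); [exact: oppr_continuous|exact: a].
by apply: (@continuous_comp _ _ _ (fun t : R => - t) (fun t => Im (f t))); [exact: oppr_continuous|exact: b].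
Qed.

(** The copy of the exponential is opaque because matching products against
    [cexp] would unfold it. *)
Fact ce_key : unit. Proof. exact: tt. Qed.
Definition ce : R[i] -> R[i] := locked_with ce_key (@cexp R).
Lemma ceE : @cexp R = ce. Proof. by rewrite /ce unlock. Qed.

Lemma Re_ce z : Re (ce z) = expR (Re z) * cos (Im z).
Proof. by rewrite -ceE /cexp reim /= mul0r subr0. Qed.
Lemma Im_ce z : Im (ce z) = expR (Re z) * sin (Im z).
Proof. by rewrite -ceE /cexp reim /= mul0r addr0. Qed.

Lemma ce0 : ce 0 = 1.
Proof. by apply: complexP; rewrite ?Re_ce ?Im_ce /= expR0 ?cos0 ?sin0 mul1r. Qed.

Lemma ceD z w : ce (z + w) = ce z * ce w.
Proof.
apply: complexP; rewrite !(reim, Re_ce, Im_ce) expRD ?cosD ?sinD; ring.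
Qed.

Lemma ceNK z : ce z * ce (- z) = 1.
Proof. by rewrite -ceD subrr ce0. Qed.

Lemma ceC z : ce (z^*) = (ce z)^*.
Proof.
by apply: complexP; rewrite !(reim, Re_ce, Im_ce) ?cosN ?sinN ?mulrN.
Qed.

Lemma cn_ce z : cn (ce z) <= 2 * expR (Re z).
Proof.
rewrite /cn Re_ce Im_ce !normrM (ger0_norm (expR_ge0 _)).
have e0 := expR_ge0 (Re z).
have c1 : `|cos (Im z)| <= 1 by rewrite ler_norml cos_geN1 cos_le1.
have s1 : `|sin (Im z)| <= 1 by rewrite ler_norml sin_geN1 sin_le1.
nra.
Qed.

Lemma cderive_lin m x : cderive (fun t => m * t%:C) x m.
Proof.
have h : cderive (fun t => t%:C) x 1.
  by split; [exact: is_derive_id|exact: is_derive_cst].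
by have := cderiveZ m h; rewrite mulr1.
Qed.

Lemma cderive_ce f x l : cderive f x l ->
  cderive (fun t => ce (f t)) x (l * ce (f x)).
Proof.
move=> [a b]; split.
  rewrite (_ : (fun t => _) = fun t => expR (Re (f t)) * cos (Im (f t))); last first.
    by apply/funext => t; rewrite Re_ce.
  have h1 := @is_derive1_comp R expR (fun t => Re (f t)) x _ _ (is_derive_expR _) a.
  have h2 := @is_derive1_comp R cos (fun t => Im (f t)) x _ _ (is_derive_cos _) b.
  have h3 := is_deriveM h1 h2; apply: (@is_derive_eq R _ _ _ _ _ _ _ h3).
  by rewrite reim Re_ce Im_ce /GRing.scale /=; ring.
rewrite (_ : (fun t => _) = fun t => expR (Re (f t)) * sin (Im (f t))); last first.
  by apply/funext => t; rewrite Im_ce.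
have h1 := @is_derive1_comp R expR (fun t => Re (f t)) x _ _ (is_derive_expR _) a.
have h2 := @is_derive1_comp R sin (fun t => Im (f t)) x _ _ (is_derive_sin _) b.
have h3 := is_deriveM h1 h2; apply: (@is_derive_eq R _ _ _ _ _ _ _ h3).
by rewrite reim Re_ce Im_ce /GRing.scale /=; ring.
Qed.

Lemma cderive_ce_lin m x : cderive (fun t => ce (m * t%:C)) x (m * ce (m * x%:C)).
Proof. exact/cderive_ce/cderive_lin. Qed.

Lemma cont_ce_lin m : ccont (fun t => ce (m * t%:C)).
Proof. exact: (cderive_cont (g := fun x => m * ce (m * x%:C)) (cderive_ce_lin m)). Qed.

Definition cvanish f := vanishes_left (fun x => cn (f x)).

Definition cleft f := ccont f /\ forall X, exists M, forall t, t <= X -> cn (f t) <= M * lorentz t.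

Lemma cleft_re f : cleft f ->
  continuous (fun t => Re (f t)) /\ left_dominated (fun t => Re (f t)).
Proof.
move=> [[a b] d]; split => // X; have [M hM] := d X; exists M => t tX.
exact: (le_trans (Re_le_cn _) (hM t tX)).
Qed.

Lemma cleft_im f : cleft f ->
  continuous (fun t => Im (f t)) /\ left_dominated (fun t => Im (f t)).
Proof.
move=> [[a b] d]; split => // X; have [M hM] := d X; exists M => t tX.
exact: (le_trans (Im_le_cn _) (hM t tX)).
Qed.

Definition clint f x := cintegral `]-oo, x] f.

Lemma clint_derive f x : cleft f -> cderive (clint f) x (f x).
Proof.
move=> lf; have [a b] := cleft_re lf; have [c d] := cleft_im lf.
by split; [exact: (lint_derive x a b)|exact: (lint_derive x c d)].
Qed.

Lemma cvanish_re f : cvanish f -> vanishes_left (fun x => Re (f x)).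
Proof.
by move=> v; apply: vanishes_left_le v _ => x; exact: Re_le_cn.
Qed.
Lemma cvanish_im f : cvanish f -> vanishes_left (fun x => Im (f x)).
Proof.
by move=> v; apply: vanishes_left_le v _ => x; exact: Im_le_cn.
Qed.

Lemma vanishes_left_norm (F : R -> R) : vanishes_left F -> vanishes_left (fun x => `|F x|).
Proof.
by move=> v e e0; have [A hA] := v e e0; exists A => x xA; rewrite normr_id; exact: hA.
Qed.

Lemma cvanish_reim f : vanishes_left (fun x => Re (f x)) ->
  vanishes_left (fun x => Im (f x)) -> cvanish f.
Proof. by move=> /vanishes_left_norm a /vanishes_left_norm b; exact: vanishes_leftD. Qed.

Lemma clint_vanish f : cleft f -> cvanish (clint f).
Proof.
move=> lf; have [a b] := cleft_re lf; have [c d] := cleft_im lf.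
by apply: cvanish_reim; [exact: (lint_vanishes a b)|exact: (lint_vanishes c d)].
Qed.

Lemma clint_unique f g : cleft f -> (forall t, cderive g t (f t)) -> cvanish g ->
  forall x, g x = clint f x.
Proof.
move=> lf dg vg x; have [a b] := cleft_re lf; have [c d] := cleft_im lf.
apply: complexP.
  by apply: (lint_unique a b (G := fun x => Re (g x))) => [t|]; [have [] := dg t|exact: cvanish_re].
by apply: (lint_unique c d (G := fun x => Im (g x))) => [t|]; [have [] := dg t|exact: cvanish_im].
Qed.

(** The factor 2 is the price of the l1 norm. *)
Lemma ccomparison_left g f (H h : R -> R) X :
  (forall t, t <= X -> cderive g t (f t)) -> cvanish g ->
  (forall t, t <= X -> is_derive t (1:R) H (h t)) ->
  (forall t, t <= X -> 0 <= H t) ->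
  (forall t, t <= X -> cn (f t) <= h t) -> cn (g X) <= 2 * H X.
Proof.
move=> dg vg dH H0 fh; rewrite mulr_natl mulr2n; apply: lerD.
  apply: (@comparison_left R (fun t => Re (g t)) (fun t => Re (f t)) H h) => //.
  - by move=> t tX; have [] := dg t tX.
  - exact: cvanish_re.
  - by move=> t tX; exact: (le_trans (Re_le_cn _) (fh t tX)).
apply: (@comparison_left R (fun t => Im (g t)) (fun t => Im (f t)) H h) => //.
- by move=> t tX; have [] := dg t tX.
- exact: cvanish_im.
- by move=> t tX; exact: (le_trans (Im_le_cn _) (fh t tX)).
Qed.

End complex_tools.

(** * Convolution with an exponential on a half-line *)

Section decaying_convolution.
Variable R : realType.
Implicit Types (f g h v : R -> R[i]) (x X s t M : R) (z w m l : R[i]).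

Definition cdom M h := ccont h /\ forall t, cn (h t) <= M * lorentz t.

Lemma cdom_ge0 M h : cdom M h -> 0 <= M.
Proof.
move=> [_ /(_ 0)]; rewrite /lorentz expr0n /= addr0 invr1 mulr1.
exact/le_trans/cn_ge0.
Qed.

(** The integral of exp (m (x - s)) h s over s <= x, which is the solution of
    y' = m y + h that vanishes at -oo when Re m <= 0. *)
Definition Lam m h x := ce (m * x%:C) * clint (fun s => ce (- m * s%:C) * h s) x.

Lemma Lam_left m M h : Re m <= 0 -> cdom M h -> cleft (fun s => ce (- m * s%:C) * h s).
Proof.
move=> m0 dh; have M0 := cdom_ge0 dh; have [ch hM] := dh; split.
  by apply: ccontM => //; exact: cont_ce_lin.
move=> X; exists (2 * expR (- Re m * X) * M) => t tX.
apply: (le_trans (cnM _ _)); rewrite -mulrA.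
apply: ler_pM; rewrite ?cn_ge0 //.
apply: (le_trans (cn_ce _)); rewrite !reim /= mulr0 subr0.
by rewrite ler_pM2l ?ltr0n // ler_expR ler_wpM2l // oppr_ge0.
Qed.

Lemma cvanishZ z g : cvanish g -> cvanish (fun t => z * g t).
Proof.
move=> /(vanishes_leftZ (cn z)) v; apply: vanishes_left_le v _ => t.
by rewrite ger0_norm ?cn_ge0 // cnM.
Qed.

Lemma cvanishD f g : cvanish f -> cvanish g -> cvanish (fun t => f t + g t).
Proof.
move=> /vanishes_leftD a /a v; apply: vanishes_left_le v _ => t.
by rewrite ger0_norm ?cn_ge0 // cnD.
Qed.

Lemma cvanishB f g : cvanish f -> cvanish g -> cvanish (fun t => f t - g t).
Proof.
move=> a /(cvanishZ (-1)) /(cvanishD a).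
by rewrite (_ : (fun t => _) = fun t => f t - g t) //; apply/funext => t; rewrite mulN1r.
Qed.

Lemma Lam_derive m M h x : Re m <= 0 -> cdom M h ->
  cderive (Lam m h) x (m * Lam m h x + h x).
Proof.
move=> m0 dh.
apply: cderive_eq.
  by apply: cderiveM; [exact: cderive_ce_lin|exact: clint_derive (Lam_left m0 dh)].
rewrite /Lam !mulrA; congr (_ + _).
by rewrite mulNr ceNK mul1r.
Qed.

(** At a fixed end point x the integral is a primitive in its upper bound, so
    an explicit real primitive H can dominate it. *)
Lemma Lam_comparison m M h (H H' : R -> R) x : Re m <= 0 -> cdom M h ->
  (forall t, t <= x -> is_derive t (1:R) H (H' t)) ->
  (forall t, t <= x -> 0 <= H t) ->
  (forall t, t <= x -> 2 * expR (Re m * (x - t)) * cn (h t) <= H' t) ->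
  cn (Lam m h x) <= 2 * H x.
Proof.
move=> m0 dh dH H0 hH; have lf := Lam_left m0 dh.
pose g t := ce (m * x%:C) * clint (fun s => ce (- m * s%:C) * h s) t.
apply: (@ccomparison_left R g (fun t => ce (m * x%:C) * (ce (- m * t%:C) * h t)) H H') => //.
- by move=> t _; apply: cderiveZ; exact: clint_derive.
- by apply: cvanishZ; exact: clint_vanish.
- move=> t tx; apply: le_trans (hH t tx).
  rewrite mulrA -ceD; apply: (le_trans (cnM _ _)); rewrite ler_wpM2r ?cn_ge0 //.
  apply: (le_trans (cn_ce _)); rewrite !reim /= !mulr0 !subr0.
  by rewrite mulNr -mulrBr.
Qed.

(** A weight exp (K (atan x + pi/2)) with K large compared with C is reproduced
    with a small factor; this makes Picard's iteration contract on the whole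
    line at once. *)
Lemma Lam_contraction m M h (C K S : R) x : Re m <= 0 -> cdom M h -> 0 < K -> 0 <= S -> 0 <= C ->
  (forall t, t <= x -> cn (h t) <= C * lorentz t * (S * expR (K * (atan t + pi / 2)))) ->
  cn (Lam m h x) <= 4 * C / K * S * expR (K * (atan x + pi / 2)).
Proof.
move=> m0 dh K0 S0 C0 hC.
have -> : 4 * C / K * S * expR (K * (atan x + pi / 2)) =
  2 * (2 * C / K * S * expR (K * (atan x + pi / 2))) by ring.
apply: (@Lam_comparison m M h (fun t => 2 * C / K * S * expR (K * (atan t + pi / 2)))
  (fun t => 2 * C * S * lorentz t * expR (K * (atan t + pi / 2)))) => //.
- move=> t _.
  have h1 : is_derive t (1:R) (fun t => K * (atan t + pi / 2)) (K * lorentz t).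
    by apply: is_derive_eq; rewrite /GRing.scale /= /lorentz; ring.
  have h2 := @is_derive1_comp R expR _ t _ _ (is_derive_expR _) h1.
  apply: is_derive_eq.
  rewrite /GRing.scale /=; field; exact: lt0r_neq0.
- by move=> t _; have K1 := ltW K0; rewrite !mulr_ge0 ?expR_ge0 ?invr_ge0.
- move=> t tx; have := hC t tx.
  have : expR (Re m * (x - t)) <= 1.
    by rewrite -expR0 ler_expR mulr_le0_ge0 // subr_ge0.
  have := expR_ge0 (Re m * (x - t)); have := cn_ge0 (h t); nra.
Qed.

Lemma Lam_bound m M h x : Re m <= 0 -> cdom M h ->
  cn (Lam m h x) <= 4 * M * (atan x + pi / 2).
Proof.
move=> m0 dh; have M0 := cdom_ge0 dh; have [ch hM] := dh.
have -> : 4 * M * (atan x + pi / 2) = 2 * (2 * M * (atan x + pi / 2)) by ring.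
apply: (@Lam_comparison m M h (fun t => 2 * M * (atan t + pi / 2)) (fun t => 2 * M * lorentz t)) => //.
- by move=> t _; apply: is_derive_eq; rewrite /GRing.scale /= /lorentz; ring.
- by move=> t _; rewrite !mulr_ge0 // ltW // atan_pi2_gt0.
- move=> t tx; have := hM t.
  have : expR (Re m * (x - t)) <= 1.
    by rewrite -expR0 ler_expR mulr_le0_ge0 // subr_ge0.
  have := expR_ge0 (Re m * (x - t)); have := cn_ge0 (h t); nra.
Qed.

Lemma Lam_bound_pi m M h x : Re m <= 0 -> cdom M h -> cn (Lam m h x) <= 4 * M * pi.
Proof.
move=> m0 dh; have M0 := cdom_ge0 dh; apply: (le_trans (Lam_bound x m0 dh)).
by rewrite ler_wpM2l ?mulr_ge0 //; have := atan_ltpi2 x; lra.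
Qed.

Lemma Lam_vanish m M h : Re m <= 0 -> cdom M h -> cvanish (Lam m h).
Proof.
move=> m0 dh; apply: vanishes_left_le (vanishes_leftZ (4 * M) (@atan_vanishes_left R)) _ => x.
by rewrite ger0_norm ?cn_ge0 //; exact: Lam_bound.
Qed.

Lemma Lam_unique m M h v : Re m <= 0 -> cdom M h ->
  (forall x, cderive v x (m * v x + h x)) -> cvanish v -> forall x, v x = Lam m h x.
Proof.
move=> m0 dh dv vv x; have lf := Lam_left m0 dh.
have := @clint_unique R _ (fun t => ce (- m * t%:C) * v t) lf _ _ x.
rewrite /Lam => <-; first by rewrite mulrA mulNr ceNK mul1r.
- move=> t; apply: cderive_eq.
    by apply: cderiveM; [exact: cderive_ce_lin|exact: dv].
  by rewrite /=; ring.
- move=> e e0; have e2 : 0 < e / 2 by lra.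
  have [A hA] := vv _ e2; exists (Num.min A 0) => t; rewrite le_min => /andP[tA t0].
  have := hA t tA; rewrite !ger0_norm ?cn_ge0 // => h1.
  apply: (le_trans (cnM _ _)).
  have : cn (ce (- m * t%:C)) <= 2 * 1.
    apply: (le_trans (cn_ce _)); rewrite ler_pM2l ?ltr0n //.
    by rewrite -expR0 ler_expR !reim /= mulr0 subr0 mulr_ge0_le0 // oppr_ge0.
  have := cn_ge0 (ce (- m * t%:C)); have := cn_ge0 (v t); nra.
Qed.

Lemma is_derive_shifted_lorentz (k : R) t : 0 < k ->
  is_derive t (1:R) (fun t => (k ^+ 2 + t ^+ 2)^-1) (- (2 * t) * (k ^+ 2 + t ^+ 2)^-1 ^+ 2).
Proof.
move=> k0.
have n0 : k ^+ 2 + t ^+ 2 != 0 by rewrite gt_eqF // ltr_wpDr ?sqr_ge0 ?exprn_gt0.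
have h : is_derive t (1:R) (fun t => k ^+ 2 + t ^+ 2) (2 * t).
  by apply: is_derive_eq; rewrite /GRing.scale /=; ring.
have := @is_deriveV R (fun t => k ^+ 2 + t ^+ 2) t _ 1 n0 h => h2.
by apply: (is_derive_eq h2); rewrite /GRing.scale /= exprVn; ring.
Qed.

(** An exponential kernel with a fixed rate preserves decay like 1/(1+x^2). The
    comparison function is exp (Re m (x - t)) / (k^2 + t^2), where k depends on
    the rate only. *)
Lemma Lam_decay (e0 : R) : 0 < e0 -> exists2 K, 0 <= K & forall m M h x,
  Re m <= - e0 -> cdom M h -> cn (Lam m h x) <= K * M * lorentz x.
Proof.
move=> e0_gt0; pose k := 1 + 2 / e0.
(* k is so large that 2 |t| / (k^2 + t^2) <= e0 / 2 *)
have k1 : 1 <= k by rewrite lerDl divr_ge0 // ltW.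
have ke : 2 <= k * e0 by rewrite mulrDl mul1r divfK ?gt_eqF //; lra.
exists (8 * k ^+ 2 / e0).
  by apply: divr_ge0; [apply: mulr_ge0 => //; exact: sqr_ge0|exact: ltW].
move=> m M h x me dh; have M0 := cdom_ge0 dh; have [ch hM] := dh.
have m0 : Re m <= 0 by lra.
pose p t := (k ^+ 2 + t ^+ 2)^-1.
have kt0 t : 0 < k ^+ 2 + t ^+ 2.
  by rewrite ltr_wpDr ?sqr_ge0 // exprn_gt0 //; lra.
have pp t : p t * (k ^+ 2 + t ^+ 2) = 1 by rewrite mulVf // gt_eqF.
have p0 t : 0 < p t by rewrite invr_gt0.
have ll t : lorentz t * (1 + t ^+ 2) = 1.
  by rewrite mulVf // gt_eqF // ltr_wpDr ?sqr_ge0.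
have lp t : lorentz t <= k ^+ 2 * p t.
  have -> : lorentz t = lorentz t * (p t * (k ^+ 2 + t ^+ 2)) by rewrite pp mulr1.
  have -> : k ^+ 2 * p t = k ^+ 2 * p t * (lorentz t * (1 + t ^+ 2)) by rewrite ll mulr1.
  have := lorentz_gt0 t; have := p0 t => a b.
  have ab : 0 < lorentz t * p t by rewrite mulr_gt0.
  have kt : k ^+ 2 + t ^+ 2 <= k ^+ 2 * (1 + t ^+ 2) by have := sqr_ge0 t; have : 1 <= k ^+ 2 by [apply: exprn_ege1]; nra.
  by have := ler_wpM2l (ltW ab) kt; lra.
have pl t : p t <= lorentz t.
  rewrite /p /lorentz lef_pV2 ?posrE // ?ltr_wpDr ?sqr_ge0 //.
  by rewrite lerD2r; nra.
have tp t : 2 * `|t| * p t <= e0 / 2.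
  have h1 : 2 * `|t| * k * p t <= 1.
    rewrite -[leRHS](pp t) [leRHS]mulrC ler_pM2r // -(real_normK (num_real t)).
    by have := sqr_ge0 (k - `|t|); nra.
  rewrite ler_pdivlMr // -(ler_pM2l (_ : 0 < k)); last by lra.
  nra.
(* the kernel of rate e0 loses at most half of its rate to the weight *)
pose C := 4 * M * k ^+ 2 / e0.
have C0 : 0 <= C.
  by apply: divr_ge0; [apply: mulr_ge0; [lra|exact: sqr_ge0]|exact: ltW].
have Ce : C * e0 = 4 * M * k ^+ 2 by rewrite /C divfK // gt_eqF.
apply: (@le_trans _ _ (2 * (C * expR (Re m * (x - x)) * p x))); last first.
  rewrite subrr mulr0 expR0 mulr1 (_ : 8 * _ / _ * M * _ = 2 * (C * lorentz x)).
    by rewrite ler_pM2l // ler_wpM2l.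
  by rewrite /C; field; rewrite gt_eqF.
apply: (@Lam_comparison m M h (fun t => C * expR (Re m * (x - t)) * p t)
  (fun t => C * expR (Re m * (x - t)) * (- Re m * p t + (- (2 * t) * p t ^+ 2))) x m0 dh).
- move=> t _.
  have h1 : is_derive t (1:R) (fun t => Re m * (x - t)) (- Re m).
    by apply: is_derive_eq; rewrite /GRing.scale /=; ring.
  have h2 := @is_derive1_comp R expR _ t _ _ (is_derive_expR _) h1.
  have h3 := @is_derive_shifted_lorentz k t (lt_le_trans ltr01 k1).
  by apply: is_derive_eq; rewrite /GRing.scale /= /p; ring.
- by move=> t _; apply: mulr_ge0; [apply: mulr_ge0; [exact: C0|exact: expR_ge0]|exact: ltW (p0 t)].
- move=> t tx.
  have E := expR_ge0 (Re m * (x - t)).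
  have h1 : e0 / 2 * p t <= - Re m * p t + - (2 * t) * p t ^+ 2.
    have a1 : e0 * p t <= - Re m * p t by apply: ler_wpM2r; [exact: ltW (p0 t)|lra].
    have a2 : 2 * t * p t * p t <= e0 / 2 * p t.
      rewrite ler_wpM2r ?(ltW (p0 t)) //; apply: le_trans (tp t).
      by rewrite ler_wpM2r ?(ltW (p0 t)) // ler_pM2l // ler_norm.
    lra.
  have h2 : C * (e0 / 2 * p t) = 2 * M * (k ^+ 2 * p t).
    have -> : C * (e0 / 2 * p t) = C * e0 / 2 * p t by ring.
    by rewrite Ce; field.
  apply: (@le_trans _ _ (C * expR (Re m * (x - t)) * (e0 / 2 * p t))); last first.
    by apply: ler_wpM2l h1; apply: mulr_ge0.
  rewrite [X in _ <= X](_ : _ = 2 * expR (Re m * (x - t)) * (M * (k ^+ 2 * p t))); last first.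
    by rewrite mulrAC h2; ring.
  apply: ler_wpM2l; first by apply: mulr_ge0.
  by apply: (le_trans (hM t)); apply: ler_wpM2l.
Qed.

(** The kernels differ by at most e (x - s) for s <= x. The additional power of
    decay in h absorbs the part |s| of this factor, and x is absorbed only for
    x <= 0, hence the maximum. *)
Lemma Lam_vertical_lipschitz m M h (e : R) x : Re m <= 0 -> 0 <= e ->
  ccont h -> (forall t, (1 + `|t|) * cn (h t) <= M * lorentz t) ->
  cn (Lam (m - e%:C) h x - Lam m h x) <= 4 * pi * M * (1 + Num.max x 0) * e.
Proof.
move=> m0 e0 ch hM.
have dh : cdom M h.
  split=> // t; apply: le_trans (hM t); rewrite mulrDl mul1r lerDl.
  by rewrite mulr_ge0 ?cn_ge0.
have M0 := cdom_ge0 dh.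
have m1 : Re (m - e%:C) <= 0 by rewrite !reim /=; lra.
have l0 := Lam_left m0 dh; have l1 := Lam_left m1 dh.
pose g t := ce ((m - e%:C) * x%:C) * clint (fun s => ce (- (m - e%:C) * s%:C) * h s) t
  - ce (m * x%:C) * clint (fun s => ce (- m * s%:C) * h s) t.
have x0 : 0 <= Num.max x 0 by rewrite le_max lexx orbT.
pose c := 2 * e * (1 + Num.max x 0) * M.
have c0 : 0 <= c by rewrite !mulr_ge0 // addr_ge0.
apply: (@le_trans _ _ (2 * (c * (atan x + pi / 2)))); last first.
  have -> : 4 * pi * M * (1 + Num.max x 0) * e = 2 * (c * pi) by rewrite /c; ring.
  by rewrite ler_pM2l // ler_wpM2l //; have := atan_ltpi2 x; lra.
apply: (@ccomparison_left R g (fun t =>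
  ce ((m - e%:C) * x%:C) * (ce (- (m - e%:C) * t%:C) * h t)
  - ce (m * x%:C) * (ce (- m * t%:C) * h t))
  (fun t => c * (atan t + pi / 2)) (fun t => c * lorentz t)).
- by move=> t _; apply: cderiveB; apply: cderiveZ; exact: clint_derive.
- by apply: cvanishB; apply: cvanishZ; exact: clint_vanish.
- by move=> t _; apply: is_derive_eq; rewrite /GRing.scale /= /lorentz; ring.
- by move=> t _; rewrite mulr_ge0 // ltW // atan_pi2_gt0.
move=> t tx; rewrite !mulrA -!ceD -mulrBl.
have -> : ce ((m - e%:C) * x%:C + - (m - e%:C) * t%:C) - ce (m * x%:C + - m * t%:C)
  = ce (m * (x - t)%:C) * (expR (- e * (x - t)) - 1)%:C.
  have -> : m * x%:C + - m * t%:C = m * (x - t)%:C by rewrite rmorphB /=; ring.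
  have -> : (m - e%:C) * x%:C + - (m - e%:C) * t%:C = m * (x - t)%:C + (- e * (x - t))%:C.
    by rewrite rmorphM rmorphB rmorphN /=; ring.
  rewrite ceD -[X in _ - X]mulr1 -mulrBr; congr (_ * _).
  by apply: complexP; rewrite !(reim, Re_ce, Im_ce) /= ?cos0 ?sin0 ?mulr1 ?mulr0 ?subr0.
apply: (le_trans (cnM _ _)); apply: (le_trans (ler_wpM2r (cn_ge0 _) (cnM _ _))).
have xt : 0 <= x - t by lra.
have h1 : cn (ce (m * (x - t)%:C)) <= 2.
  apply: (le_trans (cn_ce _)); rewrite !reim /= mulr0 subr0 ger_pMr //.
  by rewrite -expR0 ler_expR mulr_le0_ge0.
have h2 : cn (expR (- e * (x - t)) - 1)%:C <= e * (x - t).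
  rewrite cnR distrC ger0_norm.
    have := expR_ge1Dx (- e * (x - t)); lra.
  by rewrite subr_ge0 -expR0 ler_expR mulNr oppr_le0 mulr_ge0.
have h3 : x - t <= (1 + Num.max x 0) * (1 + `|t|).
  have : x <= Num.max x 0 by rewrite le_max lexx.
  have := ler_norm (- t); rewrite normrN.
  by have := mulr_ge0 x0 (normr_ge0 t); have := normr_ge0 t; lra.
have h4 := hM t; have h5 := cn_ge0 (h t); have h6 := lorentz_gt0 t.
apply: (@le_trans _ _ (2 * (e * (x - t)) * cn (h t))).
  by rewrite ler_wpM2r // ler_pM ?cn_ge0.
apply: (@le_trans _ _ (2 * (e * ((1 + Num.max x 0) * (1 + `|t|))) * cn (h t))).
  by rewrite ler_wpM2r // ler_pM2l // ler_wpM2l.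
have -> : 2 * (e * ((1 + Num.max x 0) * (1 + `|t|))) * cn (h t) =
  2 * e * (1 + Num.max x 0) * ((1 + `|t|) * cn (h t)) by ring.
rewrite /c -[X in _ <= X]mulrA; apply: ler_wpM2l => //.
by rewrite !mulr_ge0 // addr_ge0.
Qed.

End decaying_convolution.

(** * Existence of Jost solutions *)

Section sequences_aux.
Variable R : realType.

Lemma half_pow_small (e : R) : 0 < e -> exists n, (2^-1 : R) ^+ n <= e.
Proof.
move=> e0.
have h : (fun n : nat => (2^-1 : R) ^+ n) @ \oo --> (0 : R).
  by apply: cvg_expr; rewrite ger0_norm ?invr_ge0 // invf_lt1 // ltr1n.
have /cvgrPdist_le /(_ e e0) [N _ hN] := h; exists N.
have := hN N (leqnn N); rewrite /= sub0r normrN ger0_norm // exprn_ge0 // invr_ge0 //.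
Qed.

Lemma le_of_half_pow (x y B : R) : (forall n, x <= y + B * 2^-1 ^+ n) -> x <= y.
Proof.
move=> h; apply/ler_addgt0Pr => e e0.
have B1 : 0 < `|B| + 1 by rewrite ltr_wpDl.
have [n hn] := half_pow_small (divr_gt0 e0 B1).
apply: (le_trans (h n)); rewrite lerD2l.
have p0 : 0 <= (2^-1 : R) ^+ n by rewrite exprn_ge0 // invr_ge0.
apply: (@le_trans _ _ ((`|B| + 1) * (e / (`|B| + 1)))); last by rewrite mulrC divfK // gt_eqF.
apply: (@le_trans _ _ ((`|B| + 1) * 2^-1 ^+ n)); last by rewrite ler_pM2l.
by rewrite ler_wpM2r //; have := ler_norm B; lra.
Qed.

(** An a priori bound which each use of the equation halves up to a constant A
    is replaced by 2 A. It bounds Jost solutions independently of the bound that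
    comes with their definition. *)
Lemma halving (P : R -> Prop) (G E : R -> R) (A B : R) : 0 <= A -> 0 <= B ->
  (forall x, P x -> 0 <= E x) ->
  (forall x, P x -> G x <= B * E x) ->
  (forall S, 0 <= S -> (forall x, P x -> G x <= S * E x) ->
     forall x, P x -> G x <= (A + S / 2) * E x) ->
  forall x, P x -> G x <= 2 * A * E x.
Proof.
move=> A0 B0 E0 h0 hS.
have hn n : forall x, P x -> G x <= (2 * A + B * 2^-1 ^+ n) * E x.
  elim: n => [|n IH] x Px.
    rewrite expr0 mulr1; apply: (le_trans (h0 x Px)).
    by rewrite ler_wpM2r ?E0 //; lra.
  have p0 : 0 <= (2^-1 : R) ^+ n by rewrite exprn_ge0 // invr_ge0.
  have S0 : 0 <= 2 * A + B * 2^-1 ^+ n by have := mulr_ge0 B0 p0; lra.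
  apply: (le_trans (hS _ S0 IH x Px)).
  by rewrite exprS le_eqVlt; apply/orP; left; apply/eqP; field.
move=> x Px; apply: (@le_of_half_pow _ _ (B * E x)) => n.
apply: (le_trans (hn n x Px)); rewrite le_eqVlt; apply/orP; left; apply/eqP; ring.
Qed.

Lemma geometric_cauchy (u : nat -> R) (A : R) : 0 <= A ->
  (forall n, `|u n.+1 - u n| <= A * 2^-1 ^+ n) ->
  exists l, forall n, `|u n - l| <= 2 * A * 2^-1 ^+ n.
Proof.
move=> A0 hu.
have p0 n : 0 <= (2^-1 : R) ^+ n by rewrite exprn_ge0 // invr_ge0.
pose v n := u n - 2 * A * 2^-1 ^+ n; pose w n := u n + 2 * A * 2^-1 ^+ n.
have vS n : v n <= v n.+1.
  by have := hu n; rewrite ler_norml /v exprS => /andP[a b]; lra.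
have wS n : w n.+1 <= w n.
  by have := hu n; rewrite ler_norml /w exprS => /andP[a b]; lra.
have vmono n k : v n <= v (n + k)%N.
  by elim: k => [|k IH]; rewrite ?addn0 // addnS (le_trans IH).
have wmono n k : w (n + k)%N <= w n.
  by elim: k => [|k IH]; rewrite ?addn0 // addnS (le_trans _ IH).
have vw n k : v n <= w k.
  apply: (le_trans (vmono n k)); apply: (le_trans _ (wmono k n)); rewrite [(k + n)%N]addnC /v /w.
  by have := mulr_ge0 A0 (p0 (n + k)%N); lra.
have h0 : (range v) !=set0 by exists (v 0%N); exists 0%N.
exists (sup (range v)) => n; rewrite ler_norml.
have h1 : v n <= sup (range v).
  by apply: ub_le_sup; [exists (w 0%N) => _ [k _ <-]; exact: vw|exists n].
have h2 : sup (range v) <= w n by apply: ge_sup => // _ [k _ <-]; exact: vw.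
by move: h1 h2; rewrite /v /w => h1 h2; apply/andP; split; lra.
Qed.

End sequences_aux.

Section volterra.
Variable R : realType.
Implicit Types (q f g h a b : R -> R[i]) (x X s t M C S : R) (z w m l : R[i]).

Let eq_le' (x y : R) : x = y -> x <= y. Proof. by move->. Qed.

(** The power of decay beyond 1/(1+x^2) is needed for the Lipschitz dependence
    on the spectral parameter. *)
Definition qdom C q := [/\ 0 < C, ccont q & forall t, (1 + `|t|) * cn (q t) <= C * lorentz t].

Lemma qdomC C q : qdom C q -> qdom C (fun t => (q t)^*).
Proof. by move=> [? ? h]; split => // [|t]; [exact: ccontC|rewrite cnC; exact: h]. Qed.

Lemma qdom_le C q t : qdom C q -> cn (q t) <= C * lorentz t.
Proof.
move=> [_ _ h]; apply: le_trans (h t); rewrite mulrDl mul1r lerDl.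
by rewrite mulr_ge0 ?cn_ge0.
Qed.

Lemma qdom_cdom C q h B : qdom C q -> ccont h -> (forall t, cn (h t) <= B) ->
  cdom (C * B) (fun t => q t * h t).
Proof.
move=> dq ch hB; have [_ cq _] := dq; split; first exact: ccontM.
move=> t; apply: (le_trans (cnM _ _)); rewrite mulrAC.
by apply: ler_pM; rewrite ?cn_ge0 // qdom_le.
Qed.

Lemma qdom_strong C q h B : qdom C q -> (forall t, cn (h t) <= B) ->
  forall t, (1 + `|t|) * cn (q t * h t) <= C * B * lorentz t.
Proof.
move=> [_ _ qC] hB t; rewrite mulrAC.
apply: (@le_trans _ _ ((1 + `|t|) * cn (q t) * cn (h t))).
  by rewrite -mulrA ler_wpM2l ?addr_ge0 // cnM.
by apply: ler_pM; rewrite ?mulr_ge0 ?addr_ge0 ?cn_ge0.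
Qed.

(** The rate is chosen so that [Lam_contraction] gives the factor 1/2. *)
Definition wgt C x : R := expR (8 * C * (atan x + pi / 2)).

Lemma wgt_ge0 C x : 0 <= wgt C x. Proof. exact: expR_ge0. Qed.

Lemma wgt_ge1 C x : 0 < C -> 1 <= wgt C x.
Proof.
move=> C0; rewrite -expR0 ler_expR !mulr_ge0 ?(ltW C0) //; exact/ltW/atan_pi2_gt0.
Qed.

Definition wmax C : R := expR (8 * C * pi).

Lemma wgt_le C x : 0 < C -> wgt C x <= wmax C.
Proof.
move=> C0; rewrite ler_expR ler_wpM2l ?mulr_ge0 ?(ltW C0) //.
by have := atan_ltpi2 x; lra.
Qed.

Lemma wmax_ge1 C : 0 < C -> 1 <= wmax C.
Proof. by move=> C0; apply: le_trans (wgt_ge1 0 C0) (wgt_le 0 C0). Qed.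

Lemma volterra_contraction C q m h B S x : qdom C q -> Re m <= 0 -> ccont h ->
  (forall t, cn (h t) <= B) -> 0 <= S -> (forall t, t <= x -> cn (h t) <= S * wgt C t) ->
  cn (Lam m (fun t => q t * h t) x) <= S / 2 * wgt C x.
Proof.
move=> dq m0 ch hB S0 hS; have [C0 _ _] := dq.
have -> : S / 2 * wgt C x = 4 * C / (8 * C) * S * wgt C x.
  by field; rewrite gt_eqF.
apply: (Lam_contraction m0 (qdom_cdom dq ch hB)) => //; rewrite ?mulr_gt0 ?(ltW C0) //.
move=> t tx; apply: (le_trans (cnM _ _)).
by apply: ler_pM; rewrite ?cn_ge0 ?qdom_le ?hS.
Qed.

Lemma LamB m M M' h h' x : Re m <= 0 -> cdom M h -> cdom M' h' ->
  Lam m h x - Lam m h' x = Lam m (fun t => h t - h' t) x.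
Proof.
move=> m0 dh dh'.
have dd : cdom (M + M') (fun t => h t - h' t).
  have [c1 b1] := dh; have [c2 b2] := dh'; split; first exact: ccontB.
  by move=> t; apply: (le_trans (cnB _ _)); rewrite mulrDl lerD.
apply: (Lam_unique (v := fun x => Lam m h x - Lam m h' x) m0 dd) => [y|].
  by apply: cderive_eq; [apply: cderiveB; apply: Lam_derive; eassumption|ring].
by apply: cvanishB; apply: Lam_vanish; eassumption.
Qed.

Lemma Lam_cont m M h : Re m <= 0 -> cdom M h -> ccont (Lam m h).
Proof.
by move=> m0 dh; apply: (cderive_cont (g := fun x => m * Lam m h x + h x)) => x; exact: (Lam_derive x m0 dh).
Qed.

(** The solution of a' = q b, b' = m b + conj q a with a = 1, b = 0 at -oo. For
    m = 2 i lambda it is r_{1,-}; reflection of the line and conjugation give the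
    other three functions. *)
Definition jost q m a b := [/\ ccont a, ccont b,
  exists B, forall x, cn (a x) <= B /\ cn (b x) <= B &
  forall x, a x = 1 + Lam 0 (fun t => q t * b t) x /\ b x = Lam m (fun t => (q t)^* * a t) x].

Lemma Re0_le : Re (0 : R[i]) <= 0. Proof. by []. Qed.
Hint Resolve Re0_le : core.

Section existence.
Variables (C : R) (q : R -> R[i]) (m : R[i]).
Hypotheses (dq : qdom C q) (m0 : Re m <= 0).

Fixpoint picard n : (R -> R[i]) * (R -> R[i]) :=
  if n is n'.+1 then
    (fun x => 1 + Lam 0 (fun t => q t * (picard n').2 t) x,
     Lam m (fun t => (q t)^* * (picard n').1 t))
  else (fun=> 0, fun=> 0).

Let C0 : 0 < C. Proof. by case: dq. Qed.

Lemma picard_inv n :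
  [/\ ccont (picard n).1, ccont (picard n).2,
      forall x, cn ((picard n).1 x) <= 2 * wgt C x &
      forall x, cn ((picard n).2 x) <= 2 * wgt C x].
Proof.
elim: n => [|n [c1 c2 b1 b2]] /=.
  split; try exact: ccont_cst.
    by move=> x; rewrite cn0 mulr_ge0 // wgt_ge0.
  by move=> x; rewrite cn0 mulr_ge0 // wgt_ge0.
have B1 x : cn ((picard n).1 x) <= 2 * wmax C.
  by apply: (le_trans (b1 x)); rewrite ler_pM2l // wgt_le.
have B2 x : cn ((picard n).2 x) <= 2 * wmax C.
  by apply: (le_trans (b2 x)); rewrite ler_pM2l // wgt_le.
have d1 := qdom_cdom (qdomC dq) c1 B1; have d2 := qdom_cdom dq c2 B2.
split.
- by apply: ccontD; [exact: ccont_cst|exact: Lam_cont d2].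
- exact: Lam_cont d1.
- move=> x; apply: (le_trans (cnD _ _)); rewrite cn1.
  have := @volterra_contraction _ _ 0 _ _ 2 x dq Re0_le c2 B2 (ler0n _ 2) (fun t _ => b2 t).
  by have := wgt_ge1 x C0; lra.
- move=> x.
  have := @volterra_contraction _ _ m _ _ 2 x (qdomC dq) m0 c1 B1 (ler0n _ 2) (fun t _ => b1 t).
  by have := wgt_ge1 x C0; lra.
Qed.

Let pB n x : cn ((picard n).1 x) <= 2 * wmax C /\ cn ((picard n).2 x) <= 2 * wmax C.
Proof.
have [_ _ b1 b2] := picard_inv n.
by split; [apply: (le_trans (b1 x))|apply: (le_trans (b2 x))]; rewrite ler_pM2l // wgt_le.
Qed.

Lemma picard_dif n : forall x,
  cn ((picard n.+1).1 x - (picard n).1 x) <= 2^-1 ^+ n * wgt C x /\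
  cn ((picard n.+1).2 x - (picard n).2 x) <= 2^-1 ^+ n * wgt C x.
Proof.
have p0 n' : 0 <= (2^-1 : R) ^+ n' by rewrite exprn_ge0 // invr_ge0.
elim: n => [|n IH] x.
  have z m' (g : R -> R[i]) : Re m' <= 0 -> Lam m' (fun t => g t * 0) x = 0.
    move=> m'0; apply: cn_eq0; rewrite (_ : (fun t => g t * 0) = fun=> 0); last first.
      by apply/funext => t; rewrite mulr0.
    have d : cdom 0 (fun=> 0 : R[i]) by split; [exact: ccont_cst|move=> t; rewrite cn0 mul0r].
    by have := Lam_bound x m'0 d; rewrite mulr0 mul0r.
  rewrite /= !z // !subr0 addr0 cn1 cn0 expr0 mul1r.
  by split; [exact: wgt_ge1|exact: wgt_ge0].
have [c1 c2 _ _] := picard_inv n; have [c1' c2' _ _] := picard_inv n.+1.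
have b1 t := proj1 (pB n t); have b2 t := proj2 (pB n t).
have b1' t := proj1 (pB n.+1 t); have b2' t := proj2 (pB n.+1 t).
have d1 := qdom_cdom (qdomC dq) c1 b1; have d2 := qdom_cdom dq c2 b2.
have d1' := qdom_cdom (qdomC dq) c1' b1'; have d2' := qdom_cdom dq c2' b2'.
have bb (j : bool) t : cn ((if j then (picard n.+1).1 t else (picard n.+1).2 t) -
   (if j then (picard n).1 t else (picard n).2 t)) <= 4 * wmax C.
  apply: (le_trans (cnB _ _)).
  by case: j; have := b1 t; have := b2 t; have := b1' t; have := b2' t; lra.
rewrite exprSr; split.
- have -> : (picard n.+2).1 x - (picard n.+1).1 x =
    Lam 0 (fun t => q t * (picard n.+1).2 t) x - Lam 0 (fun t => q t * (picard n).2 t) x.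
    by rewrite /=; ring.
  rewrite (LamB _ _ d2' d2) //.
  rewrite (_ : (fun t => _ - _) = fun t => q t * ((picard n.+1).2 t - (picard n).2 t)); last first.
    by apply/funext => t; rewrite mulrBr.
  apply: (volterra_contraction dq _ _ (bb false)) => //.
    exact: ccontB.
  by move=> t _; have [] := IH t.
- have -> : (picard n.+2).2 x - (picard n.+1).2 x =
    Lam m (fun t => (q t)^* * (picard n.+1).1 t) x - Lam m (fun t => (q t)^* * (picard n).1 t) x by [].
  rewrite (LamB _ _ d1' d1) //.
  rewrite (_ : (fun t => _ - _) = fun t => (q t)^* * ((picard n.+1).1 t - (picard n).1 t)); last first.
    by apply/funext => t; rewrite mulrBr.
  apply: (volterra_contraction (qdomC dq) _ _ (bb true)) => //.
    exact: ccontB.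
  by move=> t _; have [] := IH t.
Qed.

Lemma cgeometric (u : nat -> R[i]) (A : R) : 0 <= A ->
  (forall n, cn (u n.+1 - u n) <= A * 2^-1 ^+ n) ->
  exists l, forall n, cn (u n - l) <= 4 * A * 2^-1 ^+ n.
Proof.
move=> A0 hu.
have [l1 h1] : exists l : R, forall n, `|Re (u n) - l| <= 2 * A * 2^-1 ^+ n.
  apply: (geometric_cauchy A0) => n; apply: le_trans (hu n).
  by apply: le_trans (Re_le_cn _); rewrite !reim.
have [l2 h2] : exists l : R, forall n, `|Im (u n) - l| <= 2 * A * 2^-1 ^+ n.
  apply: (geometric_cauchy A0) => n; apply: le_trans (hu n).
  by apply: le_trans (Im_le_cn _); rewrite !reim.
exists (l1 +i* l2) => n; rewrite /cn !reim /=; have := h1 n; have := h2 n; lra.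
Qed.

Lemma uniform_limit_cont (u : nat -> R -> R) (f : R -> R) (A : R) :
  (forall n, continuous (u n)) -> (forall n x, `|u n x - f x| <= A * 2^-1 ^+ n) ->
  continuous f.
Proof.
move=> cu uf x; apply/cvgrPdist_le => e e0.
have A1 : 0 < `|A| + 1 by rewrite ltr_wpDl.
have e3 : 0 < e / 3 by lra.
have [n hn] := half_pow_small (divr_gt0 e3 A1).
have small y : `|u n y - f y| <= e / 3.
  apply: (le_trans (uf n y)).
  have p0 : 0 <= (2^-1 : R) ^+ n by rewrite exprn_ge0 // invr_ge0.
  apply: (@le_trans _ _ ((`|A| + 1) * 2^-1 ^+ n)).
    by rewrite ler_wpM2r //; have := ler_norm A; lra.
  by rewrite mulrC -ler_pdivlMr.
have /cvgrPdist_le /(_ _ e3) := cu n x; apply: filterS => y hy.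
have := small x; have := small y.
have := ler_normD (f x - u n x) (u n x - u n y + (u n y - f y)).
have := ler_normD (u n x - u n y) (u n y - f y).
rewrite [`|f x - u n x|]distrC (_ : f x - u n x + _ = f x - f y); last by ring.
lra.
Qed.

Lemma jost_exists : exists a b, jost q m a b.
Proof.
have w0 x : 0 <= wgt C x := wgt_ge0 C x.
have /choice [a ha] x : exists l, forall n, cn ((picard n).1 x - l) <= 4 * wgt C x * 2^-1 ^+ n.
  by apply: (cgeometric (w0 x)) => n; have [+ _] := picard_dif n x; rewrite mulrC.
have /choice [b hb] x : exists l, forall n, cn ((picard n).2 x - l) <= 4 * wgt C x * 2^-1 ^+ n.
  by apply: (cgeometric (w0 x)) => n; have [_ +] := picard_dif n x; rewrite mulrC.
have p0 n' : 0 <= (2^-1 : R) ^+ n' by rewrite exprn_ge0 // invr_ge0.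
have ha' n x : cn ((picard n).1 x - a x) <= 4 * wmax C * 2^-1 ^+ n.
  by apply: (le_trans (ha x n)); rewrite ler_wpM2r // ler_pM2l // wgt_le.
have hb' n x : cn ((picard n).2 x - b x) <= 4 * wmax C * 2^-1 ^+ n.
  by apply: (le_trans (hb x n)); rewrite ler_wpM2r // ler_pM2l // wgt_le.
have cpic n := picard_inv n.
have ca : ccont a.
  split.
    apply: (@uniform_limit_cont (fun n x => Re ((picard n).1 x)) _ (4 * wmax C)) => [n|n x].
      by have [[]] := cpic n.
    by apply: le_trans (ha' n x); apply: le_trans (Re_le_cn _); rewrite !reim.
  apply: (@uniform_limit_cont (fun n x => Im ((picard n).1 x)) _ (4 * wmax C)) => [n|n x].
    by have [[]] := cpic n.
  by apply: le_trans (ha' n x); apply: le_trans (Im_le_cn _); rewrite !reim.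
have cb : ccont b.
  split.
    apply: (@uniform_limit_cont (fun n x => Re ((picard n).2 x)) _ (4 * wmax C)) => [n|n x].
      by have [_ []] := cpic n.
    by apply: le_trans (hb' n x); apply: le_trans (Re_le_cn _); rewrite !reim.
  apply: (@uniform_limit_cont (fun n x => Im ((picard n).2 x)) _ (4 * wmax C)) => [n|n x].
    by have [_ []] := cpic n.
  by apply: le_trans (hb' n x); apply: le_trans (Im_le_cn _); rewrite !reim.
have Ba x : cn (a x) <= 4 * wmax C.
  by have := ha' 0%N x; rewrite /= sub0r cnN expr0 mulr1.
have Bb x : cn (b x) <= 4 * wmax C.
  by have := hb' 0%N x; rewrite /= sub0r cnN expr0 mulr1.
exists a, b; split=> //; first by exists (4 * wmax C).
have da := qdom_cdom (qdomC dq) ca Ba; have db := qdom_cdom dq cb Bb.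
have W0 : 0 <= wmax C by exact: le_trans (wmax_ge1 C0).
have W40 n : 0 <= 4 * wmax C * 2^-1 ^+ n by rewrite !mulr_ge0.
have W41 n : 4 * wmax C * 2^-1 ^+ n <= 4 * wmax C.
  rewrite ler_piMr ?mulr_ge0 // exprn_ile1 ?invr_ge0 // invf_le1 // ler1n //.
move=> x; split; apply/eqP; rewrite -subr_eq0; apply/eqP; apply: cn_eq0;
  apply: (@le_of_half_pow R _ _ (4 * wgt C x)) => n; rewrite add0r.
- have [c1 c2 _ _] := cpic n; have d2 := qdom_cdom dq c2 (fun t => proj2 (pB n t)).
  have -> : a x - (1 + Lam 0 (fun t => q t * b t) x) =
    Lam 0 (fun t => q t * (picard n).2 t) x - Lam 0 (fun t => q t * b t) x
    - ((picard n.+1).1 x - a x) by rewrite /=; ring.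
  apply: (le_trans (cnB _ _)); rewrite (LamB _ _ d2 db) //.
  rewrite (_ : (fun t => _ - _) = fun t => q t * ((picard n).2 t - b t)); last first.
    by apply/funext => t; rewrite mulrBr.
  have := @volterra_contraction C q 0 (fun t => (picard n).2 t - b t) (4 * wmax C) (4 * 2^-1 ^+ n) x
    dq Re0_le (ccontB c2 cb) (fun t => le_trans (hb' n t) (W41 n)).
  move=> /(_ (mulr_ge0 (ler0n _ 4) (p0 n))) h.
  have {h} := h (fun t _ => le_trans (hb t n) (eq_le' (mulrAC _ _ _))).
  by have := ha x n.+1; rewrite exprS; lra.
- have [c1 c2 _ _] := cpic n; have d1 := qdom_cdom (qdomC dq) c1 (fun t => proj1 (pB n t)).
  have -> : b x - Lam m (fun t => (q t)^* * a t) x =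
    Lam m (fun t => (q t)^* * (picard n).1 t) x - Lam m (fun t => (q t)^* * a t) x
    - ((picard n.+1).2 x - b x) by rewrite /=; ring.
  apply: (le_trans (cnB _ _)); rewrite (LamB _ _ d1 da) //.
  rewrite (_ : (fun t => _ - _) = fun t => (q t)^* * ((picard n).1 t - a t)); last first.
    by apply/funext => t; rewrite mulrBr.
  have := @volterra_contraction C _ m (fun t => (picard n).1 t - a t) (4 * wmax C) (4 * 2^-1 ^+ n) x
    (qdomC dq) m0 (ccontB c1 ca) (fun t => le_trans (ha' n t) (W41 n)).
  move=> /(_ (mulr_ge0 (ler0n _ 4) (p0 n))) h.
  have {h} := h (fun t _ => le_trans (ha t n) (eq_le' (mulrAC _ _ _))).
  by have := hb x n.+1; rewrite exprS; lra.
Qed.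

End existence.
End volterra.

(** * Bounds for Jost solutions *)

Section jost_properties.
Variable R : realType.
Implicit Types (q f g h a b : R -> R[i]) (x X s t M C S : R) (z w m l : R[i]).

Let Re0_le : Re (0 : R[i]) <= 0. Proof. by []. Qed.
Hint Resolve Re0_le : core.

Section one_solution.
Variables (C : R) (q : R -> R[i]) (m : R[i]) (a b : R -> R[i]).
Hypotheses (dq : qdom C q) (m0 : Re m <= 0) (J : jost q m a b).

Let C0 : 0 < C. Proof. by case: dq. Qed.

Lemma jost_dom : exists M, cdom M (fun t => (q t)^* * a t) /\ cdom M (fun t => q t * b t).
Proof.
have [ca cb [B hB] _] := J; exists (C * B).
split; first exact: (qdom_cdom (qdomC dq) ca (fun t => proj1 (hB t))).
exact: (qdom_cdom dq cb (fun t => proj2 (hB t))).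
Qed.

Lemma jost_derive1 x : cderive a x (q x * b x).
Proof.
have [M [d1 d2]] := jost_dom; have [_ _ _ e] := J.
apply: (@cderive_ext R (fun x => 1 + Lam 0 (fun t => q t * b t) x)) => [y|].
  by rewrite (proj1 (e y)).
apply: cderive_eq; first by apply: cderiveD; [exact: cderive_cst|exact: (Lam_derive x _ d2)].
by rewrite mul0r !add0r.
Qed.

Lemma jost_derive2 x : cderive b x (m * b x + (q x)^* * a x).
Proof.
have [M [d1 d2]] := jost_dom; have [_ _ _ e] := J.
apply: (@cderive_ext R (Lam m (fun t => (q t)^* * a t))) => [y|].
  by rewrite (proj2 (e y)).
by rewrite (proj2 (e x)); exact: (Lam_derive x m0 d1).
Qed.

Lemma jost_vanish1 : cvanish (fun x => a x - 1).
Proof.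
have [M [d1 d2]] := jost_dom; have [_ _ _ e] := J.
rewrite (_ : (fun x => _) = Lam 0 (fun t => q t * b t)); first exact: Lam_vanish d2.
by apply/funext => x; rewrite (proj1 (e x)) addrC addKr.
Qed.

Lemma jost_vanish2 : cvanish b.
Proof.
have [M [d1 d2]] := jost_dom; have [_ _ _ e] := J.
rewrite (_ : b = Lam m (fun t => (q t)^* * a t)); first exact: Lam_vanish d1.
by apply/funext => x; rewrite (proj2 (e x)).
Qed.

(** The bound depends on q only, not on the spectral parameter. *)
Lemma jost_bound x : cn (a x) <= 2 * wmax C /\ cn (b x) <= 2 * wmax C.
Proof.
have [ca cb [B0 hB0] e] := J.
pose B := `|B0|.
have hB t : cn (a t) <= B /\ cn (b t) <= B.
  by have [h1 h2] := hB0 t; split; [apply: (le_trans h1)|apply: (le_trans h2)]; exact: ler_norm.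
have Ba t := proj1 (hB t); have Bb t := proj2 (hB t).
have H : forall x : R, True -> Num.max (cn (a x)) (cn (b x)) <= 2 * 1 * wgt C x.
  have Bge0 : 0 <= B by exact: normr_ge0.
  apply: (@halving R (fun=> True) _ _ 1 B) => //.
  - by move=> y _; exact: wgt_ge0.
  - move=> y _; apply: (@le_trans _ _ B); first by rewrite ge_max Ba Bb.
    by rewrite ler_peMr // wgt_ge1.
  - move=> S S0 hS y _.
    have h1 t : cn (a t) <= S * wgt C t.
      by apply: le_trans (hS t I); rewrite le_max lexx.
    have h2 t : cn (b t) <= S * wgt C t.
      by apply: le_trans (hS t I); rewrite le_max lexx orbT.
    have k1 := volterra_contraction (qdomC dq) m0 ca Ba S0 (fun t (_ : t <= y) => h1 t).
    have k2 := volterra_contraction dq Re0_le cb Bb S0 (fun t (_ : t <= y) => h2 t).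
    rewrite ge_max; apply/andP; split.
      rewrite (proj1 (e y)); apply: (le_trans (cnD _ _)); rewrite cn1.
      by have := wgt_ge1 y C0; lra.
    by rewrite (proj2 (e y)); have := wgt_ge0 C y; lra.
have := H x I; rewrite mulr1 ge_max => /andP[h1 h2].
by split; [apply: (le_trans h1)|apply: (le_trans h2)]; rewrite ler_pM2l // wgt_le.
Qed.

(** The derivative of |a|^2 - |b|^2 is - 2 Re m |b|^2, which is nonnegative, and
    the value at -oo is 1. *)
Lemma jost_energy x : 1 <= sqn (a x) - sqn (b x).
Proof.
pose F t := sqn (a t) - sqn (b t).
have dF t : is_derive t (1:R) F (- 2 * Re m * sqn (b t)).
  have [a1 a2] := jost_derive1 t; have [b1 b2] := jost_derive2 t.
  rewrite /F /sqn; apply: is_derive_eq; rewrite !reim /GRing.scale /=; ring.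
have mono y : y <= x -> F y <= F x.
  move=> yx; apply: (is_derive_ndecr (fun t _ => dF t) _ yx (lexx x)) => t _.
  by rewrite mulr_ge0 ?sqn_ge0 // mulNr oppr_ge0 mulr_ge0_le0.
apply/ler_addgt0Pr => e e0.
pose d := Num.min (e / 3) 1.
have d0 : 0 < d by rewrite lt_min ltr01 andbT; lra.
have d1 : d <= 1 by rewrite ge_min lexx orbT.
have de : 3 * d <= e.
  have : d <= e / 3 by rewrite ge_min lexx.
  lra.
have [A hA] := jost_vanish1 d0; have [B hB] := jost_vanish2 d0.
(* y lies so far to the left that a is close to 1 and b to 0 *)
pose y := Num.min x (Num.min A B).
have yx : y <= x by rewrite ge_min lexx.
have yA : y <= A by rewrite !ge_min lexx !orbT.
have yB : y <= B by rewrite !ge_min lexx !orbT.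
have := mono y yx; have := hA y yA; have := hB y yB; rewrite !ger0_norm ?cn_ge0 // => hb ha.
have : sqn (b y) <= d.
  apply: (le_trans (sqn_le_cn _)); have := cn_ge0 (b y); nra.
have : 1 - 2 * d <= sqn (a y).
  have : `|Re (a y - 1)| <= d by apply: le_trans ha; exact: Re_le_cn.
  rewrite !reim /= ler_norml => /andP[h _]; rewrite /sqn.
  by have := sqr_ge0 (Im (a y)); have := sqr_ge0 (Re (a y) - 1); lra.
by rewrite /F; lra.
Qed.

End one_solution.

(** The difference of the two solutions solves the Volterra system with a source
    of size O(e), given by [Lam_vertical_lipschitz]; [halving] removes the
    unknown from the right-hand side. *)
Lemma jost_lipschitz C q m a b a' b' (e : R) X : qdom C q -> Re m <= 0 -> 0 <= e ->
  jost q m a b -> jost q (m - e%:C) a' b' ->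
  forall x, x <= X ->
    cn (a' x - a x) <= 16 * pi * (C * wmax C ^+ 2) * (1 + Num.max X 0) * e /\
    cn (b' x - b x) <= 16 * pi * (C * wmax C ^+ 2) * (1 + Num.max X 0) * e.
Proof.
move=> dq m0 e0 J J'.
have [C0 _ _] := dq.
have m0' : Re (m - e%:C) <= 0 by rewrite !reim /=; lra.
have [ca cb _ eq] := J; have [ca' cb' _ eq'] := J'.
have Ba t := proj1 (jost_bound dq m0 J t); have Bb t := proj2 (jost_bound dq m0 J t).
have Ba' t := proj1 (jost_bound dq m0' J' t); have Bb' t := proj2 (jost_bound dq m0' J' t).
have W1 := wmax_ge1 C0.
have W0 : 0 <= wmax C by lra.
have X0 : 0 <= Num.max X 0 by rewrite le_max lexx orbT.
pose A := 4 * pi * (C * (2 * wmax C)) * (1 + Num.max X 0) * e.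
have A0 : 0 <= A.
  rewrite /A !mulr_ge0 ?(ltW C0) //; first exact: pi_ge0.
  by rewrite addr_ge0.
have Bda t : cn (a' t - a t) <= 4 * wmax C.
  by apply: (le_trans (cnB _ _)); have := Ba t; have := Ba' t; lra.
have Bdb t : cn (b' t - b t) <= 4 * wmax C.
  by apply: (le_trans (cnB _ _)); have := Bb t; have := Bb' t; lra.
have da := qdom_cdom (qdomC dq) ca Ba; have db := qdom_cdom dq cb Bb.
have da' := qdom_cdom (qdomC dq) ca' Ba'; have db' := qdom_cdom dq cb' Bb'.
have H : forall x, x <= X -> Num.max (cn (a' x - a x)) (cn (b' x - b x)) <= 2 * A * wgt C x.
  apply: (@halving R (fun x => x <= X) _ _ A (4 * wmax C)) => //.
  - by rewrite mulr_ge0.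
  - by move=> y _; exact: wgt_ge0.
  - move=> y _; apply: (@le_trans _ _ (4 * wmax C)); first by rewrite ge_max Bda Bdb.
    by rewrite ler_peMr ?mulr_ge0 // wgt_ge1.
  - move=> S S0 hS y yX.
    have h1 t : t <= y -> cn (a' t - a t) <= S * wgt C t.
      by move=> ty; apply: le_trans (hS t (le_trans ty yX)); rewrite le_max lexx.
    have h2 t : t <= y -> cn (b' t - b t) <= S * wgt C t.
      by move=> ty; apply: le_trans (hS t (le_trans ty yX)); rewrite le_max lexx orbT.
    have k1 := volterra_contraction (qdomC dq) m0' (ccontB ca' ca) Bda S0 h1.
    have k2 := volterra_contraction dq Re0_le (ccontB cb' cb) Bdb S0 h2.
    have wg := wgt_ge1 y C0.
    rewrite ge_max; apply/andP; split.
      rewrite (proj1 (eq y)) (proj1 (eq' y)) opprD addrACA subrr add0r.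
      rewrite (LamB _ _ db' db) //.
      rewrite (_ : (fun t => _ - _) = fun t => q t * (b' t - b t)); last first.
        by apply/funext => t; rewrite mulrBr.
      by apply: (le_trans k2); rewrite ler_wpM2r ?wgt_ge0 //; lra.
    rewrite (proj2 (eq y)) (proj2 (eq' y)).
    have -> : Lam (m - e%:C) (fun t => (q t)^* * a' t) y - Lam m (fun t => (q t)^* * a t) y =
      (Lam (m - e%:C) (fun t => (q t)^* * a' t) y - Lam (m - e%:C) (fun t => (q t)^* * a t) y) +
      (Lam (m - e%:C) (fun t => (q t)^* * a t) y - Lam m (fun t => (q t)^* * a t) y) by ring.
    apply: (le_trans (cnD _ _)); rewrite (LamB _ _ da' da) //.
    rewrite (_ : (fun t => _ - _) = fun t => (q t)^* * (a' t - a t)); last first.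
      by apply/funext => t; rewrite mulrBr.
    have := Lam_vertical_lipschitz y m0 e0 (proj1 da) (qdom_strong (qdomC dq) Ba).
    have : 4 * pi * (C * (2 * wmax C)) * (1 + Num.max y 0) * e <= A.
      rewrite /A ler_wpM2r // ler_wpM2l //.
        by rewrite !mulr_ge0 ?(ltW C0) // pi_ge0.
      by rewrite lerD2l ge_max !le_max yX lexx !orbT.
    have := mulr_ge0 A0 (_ : 0 <= wgt C y - 1); rewrite subr_ge0 => /(_ wg); lra.
move=> x xX; have := H x xX; rewrite ge_max => /andP[h1 h2].
have h3 : 2 * A * wgt C x <= 16 * pi * (C * wmax C ^+ 2) * (1 + Num.max X 0) * e.
  apply: (@le_trans _ _ (2 * A * wmax C)).
    apply: ler_wpM2l; [exact: mulr_ge0|exact: wgt_le].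
  by rewrite /A le_eqVlt; apply/orP; left; apply/eqP; ring.
by split; apply: le_trans h3.
Qed.

End jost_properties.

(** * Integrals of complex-valued functions *)

Section complex_integral.
Variable R : realType.
Implicit Types (q f g h a b : R -> R[i]) (x X s t M C S : R) (z w m l : R[i]).
Local Notation mu := (@lebesgue_measure R).
Implicit Types D : set (measurableTypeR R).

Section real.
Implicit Types (F G : R -> R).

Lemma integrable_scale D (k : R) F : measurable D -> mu.-integrable D (EFin \o F) ->
  mu.-integrable D (EFin \o (fun t => k * F t)).
Proof.
move=> mD iF.
rewrite [X in _.-integrable _ X](_ : _ = fun t => k%:E * (EFin \o F) t)%E //.
exact: integrableZl.
Qed.

Lemma integrable_add D F G : measurable D -> mu.-integrable D (EFin \o F) ->
  mu.-integrable D (EFin \o G) -> mu.-integrable D (EFin \o (fun t => F t + G t)).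
Proof.
move=> mD iF iG.
rewrite [X in _.-integrable _ X](_ : _ = fun t => (EFin \o F) t + (EFin \o G) t)%E //.
exact: integrableD.
Qed.

Let opp_ := (-%R : measurableTypeR R -> measurableTypeR R).

Lemma measurable_opp : measurable_fun [set: measurableTypeR R] opp_.
Proof. by apply: continuous_measurable_fun; exact: opp_continuous. Qed.

Lemma integral_opp D (f : R -> \bar R) : measurable D -> measurable_fun D f ->
  (\int[mu]_(y in D) f y = \int[mu]_(x in opp_ @^-1` D) f (- x)%R)%E.
Proof.
move=> mD mf.
have ge0 (g : R -> \bar R) : measurable_fun D g -> (forall y, 0 <= g y)%E ->
    (\int[mu]_(y in D) g y = \int[mu]_(x in opp_ @^-1` D) g (- x)%R)%E.
  move=> mg g0.
  have E := @ge0_integral_pushforward _ _ _ (measurableTypeR R) R opp_ measurable_opp mu D g mD mg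
    (fun y _ => g0 y).
  rewrite -[RHS]E; apply: eq_measure_integral => /=; first exact: measurable_opp.
  by move=> mo A mA _; exact/esym/lebesgue_measureN.
rewrite integralE [RHS]integralE; congr (_ - _)%E.
  rewrite (ge0 (f^\+)%E (measurable_funepos mf) (fun y => funepos_ge0 f y)).
  by apply: eq_integral => x _; rewrite !funeposE.
rewrite (ge0 (f^\-)%E (measurable_funeneg mf) (fun y => funeneg_ge0 f y)).
by apply: eq_integral => x _; rewrite !funenegE.
Qed.

Lemma integrable_opp D (f : R -> \bar R) : measurable D -> mu.-integrable D f ->
  mu.-integrable (opp_ @^-1` D) (fun x => f (- x)).
Proof.
move=> mD /integrableP[mf fi]; apply/integrableP; split.
  apply: (@measurable_comp _ _ _ _ _ _ D f _ opp_) => //.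
    by move=> _ [y Dy <-].
  exact: measurable_funS measurable_opp.
apply: le_lt_trans fi; rewrite [leRHS]integral_opp //.
exact: measurableT_comp.
Qed.

End real.

Lemma cintegrable_scale D z h : measurable D -> cintegrable D h ->
  cintegrable D (fun t => z * h t).
Proof.
move=> mD [i1 i2]; split.
  rewrite (_ : (fun t => _) = fun t => Re z * Re (h t) + (- Im z) * Im (h t)); last first.
    by apply/funext => t; rewrite reim mulNr.
  by apply: integrable_add => //; exact: integrable_scale.
rewrite (_ : (fun t => _) = fun t => Re z * Im (h t) + Im z * Re (h t)); last first.
  by apply/funext => t; rewrite reim.
by apply: integrable_add => //; exact: integrable_scale.
Qed.

Lemma cintegrable_ext D f h : f =1 h -> cintegrable D f -> cintegrable D h.
Proof. by move=> /funext ->. Qed.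

Lemma cintegral_ext D f h : f =1 h -> cintegral D f = cintegral D h.
Proof. by move=> /funext ->. Qed.

Lemma cintegralZ D z h : measurable D -> cintegrable D h ->
  cintegral D (fun t => z * h t) = z * cintegral D h.
Proof.
move=> mD [i1 i2]; apply: complexP; rewrite !reim /=.
  rewrite (_ : (fun t => _) = fun t => Re z * Re (h t) + (- Im z) * Im (h t)); last first.
    by apply/funext => t; rewrite reim mulNr.
  by rewrite RintegralD ?RintegralZl ?mulNr //; exact: integrable_scale.
rewrite (_ : (fun t => _) = fun t => Re z * Im (h t) + Im z * Re (h t)); last first.
  by apply/funext => t; rewrite reim.
by rewrite RintegralD ?RintegralZl //; exact: integrable_scale.
Qed.

Lemma cintegralN D h : measurable D -> cintegrable D h ->
  cintegral D (fun t => - h t) = - cintegral D h.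
Proof.
move=> mD ih; rewrite -mulN1r -cintegralZ //; apply: cintegral_ext => t.
by rewrite mulN1r.
Qed.

Lemma cintegralD D f h : measurable D -> cintegrable D f -> cintegrable D h ->
  cintegral D (fun t => f t + h t) = cintegral D f + cintegral D h.
Proof.
move=> mD [i1 i2] [j1 j2]; apply: complexP; rewrite !reim /=.
  rewrite (_ : (fun t => _) = fun t => Re (f t) + Re (h t)) ?RintegralD //.
  by apply/funext => t; rewrite reim.
rewrite (_ : (fun t => _) = fun t => Im (f t) + Im (h t)) ?RintegralD //.
by apply/funext => t; rewrite reim.
Qed.

Lemma cintegrableN D h : measurable D -> cintegrable D h -> cintegrable D (fun t => - h t).
Proof. by move=> mD /(cintegrable_scale (-1) mD); apply: cintegrable_ext => t; rewrite mulN1r. Qed.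

Lemma cintegrableC D h : measurable D -> cintegrable D h -> cintegrable D (fun t => (h t)^*).
Proof.
move=> mD [i1 i2]; split.
  by rewrite (_ : (fun t => _) = fun t => Re (h t)) //; apply/funext => t; rewrite reim.
rewrite (_ : (fun t => _) = fun t => (-1) * Im (h t)); last first.
  by apply/funext => t; rewrite reim mulN1r.
exact: integrable_scale.
Qed.

Lemma cintegralC D h : measurable D -> cintegrable D h ->
  cintegral D (fun t => (h t)^*) = (cintegral D h)^*.
Proof.
move=> mD [i1 i2]; apply: complexP; rewrite !reim /=.
  by rewrite (_ : (fun t => _) = fun t => Re (h t)) //; apply/funext => t; rewrite reim.
rewrite (_ : (fun t => _) = fun t => (-1) * Im (h t)); last first.
  by apply/funext => t; rewrite reim mulN1r.
by rewrite RintegralZl // mulN1r.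
Qed.

Lemma preimage_opp_right x : (-%R @^-1` `[x, +oo[ : set R) = `]-oo, (- x)%R]%classic.
Proof. by apply/seteqP; split => y /=; rewrite !in_itv /= andbT => h; lra. Qed.

Lemma preimage_opp_left x : (-%R @^-1` `]-oo, x] : set R) = `[(- x)%R, +oo[%classic.
Proof. by apply/seteqP; split => y /=; rewrite !in_itv /= andbT => h; lra. Qed.

Lemma cintegrable_opp_right x h : cintegrable `[- x, +oo[ h ->
  cintegrable `]-oo, x] (fun t => h (- t)).
Proof.
have e : `]-oo, x]%classic = -%R @^-1` `[- x, +oo[ by rewrite preimage_opp_right opprK.
by move=> [i1 i2]; split; rewrite e; [exact: (integrable_opp _ i1)|exact: (integrable_opp _ i2)].
Qed.

Lemma cintegrable_opp_left x h : cintegrable `]-oo, x] h ->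
  cintegrable `[- x, +oo[ (fun t => h (- t)).
Proof.
by move=> [i1 i2]; split; rewrite -preimage_opp_left; [exact: (integrable_opp _ i1)|exact: (integrable_opp _ i2)].
Qed.

Lemma cintegral_opp x h : cintegrable `[- x, +oo[ h ->
  cintegral `[- x, +oo[ h = cintegral `]-oo, x] (fun t => h (- t)).
Proof.
have e : `]-oo, x]%classic = -%R @^-1` `[- x, +oo[ by rewrite preimage_opp_right opprK.
move=> [/integrableP[i1 _] /integrableP[i2 _]]; rewrite e.
apply: complexP => /=; rewrite /Rintegral.
  by rewrite integral_opp.
by rewrite integral_opp.
Qed.

Lemma cleft_integrable f x : cleft f -> cintegrable `]-oo, x] f.
Proof.
move=> lf; have [a b] := cleft_re lf; have [c d] := cleft_im lf.
by split; exact: left_integrable.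
Qed.

(** Used for Volterra solutions, whose integrands are not known to be continuous
    beforehand. *)
Lemma lint_lipschitz (g : R -> R) M x y :
  (forall X, mu.-integrable `]-oo, X] (EFin \o g)) -> (forall t, `|g t| <= M) ->
  x <= y -> `|lint g y - lint g x| <= M * (y - x).
Proof.
move=> ig gM; rewrite le_eqVlt => /predU1P[->|xy]; first by rewrite !subrr normr0 mulr0.
have iM : mu.-integrable `]x, y] (EFin \o cst M).
  have i0 : mu.-integrable `[x, y] (EFin \o cst M).
    apply: continuous_compact_integrable; first exact: segment_compact.
    by apply: continuous_subspaceT => t; exact: cvg_cst.
  apply: integrableS i0 => //.
  by move=> t /=; rewrite !in_itv /= => /andP[/ltW -> ->].
have sub : `]x, y]%classic `<=` `]-oo, y].
  by move=> t /=; rewrite !in_itv /= => /andP[].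
have i1 : mu.-integrable `]x, y] (EFin \o g).
  by apply: integrableS (ig y) => //.
rewrite /lint Rintegral_itvB ?bnd_simp ?(ltW xy) //.
apply: (le_trans (le_normr_Rintegral _ i1)) => //.
apply: (@le_trans _ _ (\int[mu]_(t in `]x, y]) M)).
  apply: le_Rintegral => //.
  by apply: eq_integrable (integrable_abse i1).
by rewrite Rintegral_cst //= lebesgue_measure_itv /= lte_fin xy.
Qed.

Lemma lint_cont (g : R -> R) M :
  (forall X, mu.-integrable `]-oo, X] (EFin \o g)) -> (forall t, `|g t| <= M) ->
  continuous (lint g).
Proof.
move=> ig gM x; apply/cvgrPdist_le => e e0.
have M0 : 0 <= M by apply: le_trans (gM 0).
have M1 : 0 < M + 1 by rewrite ltr_wpDl.
have d0 : 0 < e / (M + 1) by rewrite divr_gt0.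
near=> y.
have xy : `|x - y| <= e / (M + 1) by near: y; apply: cvgr_dist_le.
have key u v : u <= v -> v - u <= e / (M + 1) -> `|lint g v - lint g u| <= e.
  move=> uv h; apply: (le_trans (lint_lipschitz ig gM uv)).
  have h2 : (M + 1) * (v - u) <= e by rewrite mulrC -ler_pdivlMr.
  by apply: le_trans h2; rewrite ler_wpM2r //; lra.
have [h|h] := leP x y.
  by rewrite distrC; apply: key => //; apply: le_trans xy; rewrite distrC ler_norm.
by apply: key; [lra|apply: le_trans xy; exact: ler_norm].
Unshelve. all: by end_near. Qed.

Lemma clint_cont h M : (forall X, cintegrable `]-oo, X] h) -> (forall t, cn (h t) <= M) ->
  ccont (clint h).
Proof.
move=> ih hM; split.
  apply: (@lint_cont (fun t => Re (h t)) M) => [X|t]; first by have [] := ih X.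
  exact: (le_trans (Re_le_cn _)).
apply: (@lint_cont (fun t => Im (h t)) M) => [X|t]; first by have [] := ih X.
exact: (le_trans (Im_le_cn _)).
Qed.

End complex_integral.

(** * Volterra systems in scalar form *)

Section volterra_forms.
Variable R : realType.
Implicit Types (q f g h a b : R -> R[i]) (x X s t M C S : R) (z w m l lam : R[i]).

Implicit Types (k : R -> R[i]).

(** Two entries instead of matrices, so that conjugation and reflection become
    symmetries of scalar systems. *)
Definition volL q (c0 c1 : R[i]) k0 k1 a b :=
  (exists B, forall x, cn (a x) <= B /\ cn (b x) <= B) /\ forall x,
  [/\ cintegrable `]-oo, x] (fun s => k0 (x - s) * (q s * b s)),
      cintegrable `]-oo, x] (fun s => k1 (x - s) * ((q s)^* * a s)),
      a x = c0 + cintegral `]-oo, x] (fun s => k0 (x - s) * (q s * b s)) &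
      b x = c1 + cintegral `]-oo, x] (fun s => k1 (x - s) * ((q s)^* * a s))].

Definition volR q (c0 c1 : R[i]) k0 k1 a b :=
  (exists B, forall x, cn (a x) <= B /\ cn (b x) <= B) /\ forall x,
  [/\ cintegrable `[x, +oo[ (fun s => k0 (x - s) * (q s * b s)),
      cintegrable `[x, +oo[ (fun s => k1 (x - s) * ((q s)^* * a s)),
      a x = c0 - cintegral `[x, +oo[ (fun s => k0 (x - s) * (q s * b s)) &
      b x = c1 - cintegral `[x, +oo[ (fun s => k1 (x - s) * ((q s)^* * a s))].

Definition volJ q m := volL q 1 0 (fun=> 1) (fun t => ce (m * t%:C)).

Lemma ce_split m x s : ce (m * (x - s)%:C) = ce (m * x%:C) * ce (- m * s%:C).
Proof. by rewrite -ceD rmorphB /=; congr ce; ring. Qed.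

Lemma cdom_cleft M h : cdom M h -> cleft h.
Proof. by move=> [ch hM]; split => // X; exists M. Qed.

Lemma ce_kernelE q m a x :
  (fun s => ce (m * (x - s)%:C) * ((q s)^* * a s)) =
  (fun s => ce (m * x%:C) * (ce (- m * s%:C) * ((q s)^* * a s))).
Proof. by apply/funext => s; rewrite ce_split mulrA. Qed.

Lemma Lam0E M h x : cdom M h -> Lam 0 h x = cintegral `]-oo, x] h.
Proof.
move=> dh; rewrite /Lam mul0r ce0 mul1r; apply: cintegral_ext => t.
by rewrite oppr0 mul0r ce0 mul1r.
Qed.

Lemma jost_volJ C q m a b : qdom C q -> Re m <= 0 -> jost q m a b -> volJ q m a b.
Proof.
move=> dq m0 J; have [ca cb hB e] := J; split=> // x.
have [M [d1 d2]] := jost_dom dq J.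
have l1 := Lam_left m0 d1; have l2 := cdom_cleft d2.
rewrite (_ : (fun s => 1 * _) = fun s => q s * b s); last by apply/funext => s; rewrite mul1r.
split.
- exact: cleft_integrable.
- by rewrite ce_kernelE; apply: cintegrable_scale => //; exact: cleft_integrable.
- by rewrite (proj1 (e x)) (Lam0E x d2).
- rewrite ce_kernelE cintegralZ //; last exact: cleft_integrable.
  by rewrite (proj2 (e x)) add0r.
Qed.

(** Boundedness makes the integrals continuous functions of the end point, first
    for a and then for b; only then the kernel operator applies. *)
Lemma volJ_jost C q m a b : qdom C q -> Re m <= 0 -> volJ q m a b -> jost q m a b.
Proof.
move=> dq m0 [[B hB] e0].
have e x : [/\ cintegrable `]-oo, x] (fun s => q s * b s),
      cintegrable `]-oo, x] (fun s => ce (m * (x - s)%:C) * ((q s)^* * a s)),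
      a x = 1 + cintegral `]-oo, x] (fun s => q s * b s) &
      b x = cintegral `]-oo, x] (fun s => ce (m * (x - s)%:C) * ((q s)^* * a s))].
  have := e0 x; rewrite add0r.
  by rewrite (_ : (fun s => 1 * _) = fun s => q s * b s) //; apply/funext => s; rewrite mul1r.
have Ba t := proj1 (hB t); have Bb t := proj2 (hB t).
have ca : ccont a.
  rewrite (_ : a = fun x => 1 + clint (fun s => q s * b s) x); last first.
    by apply/funext => x; have [_ _ ->] := e x.
  apply: ccontD; first exact: ccont_cst.
  apply: (@clint_cont R _ (C * B)) => [X|t]; first by have [] := e X.
  apply: (le_trans (cnM _ _)); apply: ler_pM; rewrite ?cn_ge0 //.
  apply: (le_trans (qdom_le t dq)); rewrite ger_pMr ?lorentz_le1 //.
  by have [] := dq.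
have da := qdom_cdom (qdomC dq) ca Ba.
have la := Lam_left m0 da.
have eb x : b x = Lam m (fun s => (q s)^* * a s) x.
  have [_ _ _ ->] := e x; rewrite ce_kernelE cintegralZ //.
  exact: cleft_integrable.
have cb : ccont b by rewrite (funext eb); exact: Lam_cont da.
have db := qdom_cdom dq cb Bb.
split=> //; first by exists B.
by move=> x; split=> //; have [_ _ -> _] := e x; rewrite (Lam0E x db).
Qed.

Lemma cintegral_conj_clause (D : set (measurableTypeR R)) f h : measurable D ->
  (forall s, h s = (f s)^*) -> cintegrable D f ->
  cintegrable D h /\ cintegral D h = (cintegral D f)^*.
Proof.
move=> mD E i; have -> : h = fun s => (f s)^* by exact: funext.
by split; [exact: cintegrableC|exact: cintegralC].
Qed.

Lemma cintegral_reflect_right x f h : (forall s, h s = - f (- s)) ->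
  cintegrable `[- x, +oo[ f ->
  cintegrable `]-oo, x] h /\ cintegral `]-oo, x] h = - cintegral `[- x, +oo[ f.
Proof.
move=> E i; have -> : h = fun s => - f (- s) by exact: funext.
have i2 := cintegrable_opp_right i.
by split; [exact: cintegrableN|rewrite cintegralN // -cintegral_opp].
Qed.

Lemma cintegral_reflect_left x f h : (forall s, h s = - f (- s)) ->
  cintegrable `]-oo, - x] f ->
  cintegrable `[x, +oo[ h /\ cintegral `[x, +oo[ h = - cintegral `]-oo, - x] f.
Proof.
move=> E i; have -> : h = fun s => - f (- s) by exact: funext.
have i2 := cintegrable_opp_left i; rewrite opprK in i2.
split; first exact: cintegrableN.
rewrite cintegralN //; congr (- _).
have := @cintegral_opp R (- x) (fun t => f (- t)); rewrite opprK => /(_ i2) ->.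
by apply: cintegral_ext => t; rewrite opprK.
Qed.

(** The potential seen after x -> - x, which exchanges the two ends. *)
Definition qhat q : R -> R[i] := fun x => - (q (- x))^*.

Lemma conjcD (z w : R[i]) : (z + w)^* = z^* + w^*. Proof. by rewrite rmorphD. Qed.
Lemma conjc1 : (1 : R[i])^* = 1. Proof. by rewrite rmorph1. Qed.
Lemma conjc0 : (0 : R[i])^* = 0. Proof. by rewrite rmorph0. Qed.

Lemma qhatK q : qhat (qhat q) = q.
Proof. by apply/funext => x; apply: complexP; rewrite /qhat !reim !opprK. Qed.

(** Conjugation exchanges the two entries and sends lambda to its conjugate. *)
Lemma volL_conj q c0 c1 k0 k1 a b : volL q c0 c1 k0 k1 a b ->
  volL q (c1^*) (c0^*) (fun t => (k1 t)^*) (fun t => (k0 t)^*) (fun t => (b t)^*) (fun t => (a t)^*).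
Proof.
move=> [[B hB] e]; split; first by exists B => x; rewrite !cnC; have [] := hB x.
move=> x; have [i0 i1 ea eb] := e x.
have [j1 E1] : cintegrable `]-oo, x] (fun s => (k1 (x - s))^* * (q s * (a s)^*)) /\
    cintegral `]-oo, x] (fun s => (k1 (x - s))^* * (q s * (a s)^*)) =
    (cintegral `]-oo, x] (fun s => k1 (x - s) * ((q s)^* * a s)))^*.
  by apply: cintegral_conj_clause i1 => // s; apply: complexP; rewrite !reim; ring.
have [j0 E0] : cintegrable `]-oo, x] (fun s => (k0 (x - s))^* * ((q s)^* * (b s)^*)) /\
    cintegral `]-oo, x] (fun s => (k0 (x - s))^* * ((q s)^* * (b s)^*)) =
    (cintegral `]-oo, x] (fun s => k0 (x - s) * (q s * b s)))^*.
  by apply: cintegral_conj_clause i0 => // s; apply: complexP; rewrite !reim; ring.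
by split; [exact: j1|exact: j0|rewrite E1 eb conjcD|rewrite E0 ea conjcD].
Qed.

(** Reflection of the line turns a system from +oo into a system from -oo. *)
Lemma volR_reflect q c0 c1 k0 k1 a b : volR q c0 c1 k0 k1 a b ->
  volL (qhat q) c1 c0 (fun t => k1 (- t)) (fun t => k0 (- t)) (fun t => b (- t)) (fun t => a (- t)).
Proof.
move=> [[B hB] e]; split; first by exists B => x; have [] := hB (- x).
move=> x; have [i0 i1 ea eb] := e (- x).
have [j1 E1] : cintegrable `]-oo, x] (fun s => k1 (- (x - s)) * (qhat q s * a (- s))) /\
    cintegral `]-oo, x] (fun s => k1 (- (x - s)) * (qhat q s * a (- s))) =
    - cintegral `[- x, +oo[ (fun s => k1 (- x - s) * ((q s)^* * a s)).
  by apply: cintegral_reflect_right i1 => // s; rewrite (opprD x (- s)); apply: complexP; rewrite /qhat !reim; ring.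
have [j0 E0] : cintegrable `]-oo, x] (fun s => k0 (- (x - s)) * ((qhat q s)^* * b (- s))) /\
    cintegral `]-oo, x] (fun s => k0 (- (x - s)) * ((qhat q s)^* * b (- s))) =
    - cintegral `[- x, +oo[ (fun s => k0 (- x - s) * (q s * b s)).
  apply: cintegral_reflect_right i0 => // s.
  by rewrite (opprD x (- s)); apply: complexP; rewrite /qhat !reim; ring.
by split; [exact: j1|exact: j0|rewrite E1 eb|rewrite E0 ea].
Qed.

Lemma volL_reflect q c0 c1 k0 k1 a b : volL q c0 c1 k0 k1 a b ->
  volR (qhat q) c1 c0 (fun t => k1 (- t)) (fun t => k0 (- t)) (fun t => b (- t)) (fun t => a (- t)).
Proof.
move=> [[B hB] e]; split; first by exists B => x; have [] := hB (- x).
move=> x; have [i0 i1 ea eb] := e (- x).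
have [j1 E1] : cintegrable `[x, +oo[ (fun s => k1 (- (x - s)) * (qhat q s * a (- s))) /\
    cintegral `[x, +oo[ (fun s => k1 (- (x - s)) * (qhat q s * a (- s))) =
    - cintegral `]-oo, - x] (fun s => k1 (- x - s) * ((q s)^* * a s)).
  by apply: cintegral_reflect_left i1 => // s; rewrite (opprD x (- s)); apply: complexP; rewrite /qhat !reim; ring.
have [j0 E0] : cintegrable `[x, +oo[ (fun s => k0 (- (x - s)) * ((qhat q s)^* * b (- s))) /\
    cintegral `[x, +oo[ (fun s => k0 (- (x - s)) * ((qhat q s)^* * b (- s))) =
    - cintegral `]-oo, - x] (fun s => k0 (- x - s) * (q s * b s)).
  apply: cintegral_reflect_left i0 => // s.
  by rewrite (opprD x (- s)); apply: complexP; rewrite /qhat !reim; ring.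
by split; [exact: j1|exact: j0|rewrite E1 opprK eb|rewrite E0 opprK ea].
Qed.

Lemma sum2 (F : 'I_2 -> R[i]) : \sum_j F j = F 0 + F 1.
Proof. by rewrite big_ord_recl big_ord1; congr (_ + F _); apply/val_inj. Qed.

Lemma diag2_mul z w (v : 'cV[R[i]]_2) (k : 'I_2) : (diag2 z w *m v) k 0 = (if k == 0 then z else w) * v k 0.
Proof. by rewrite /diag2 mul_diag_mx !mxE. Qed.

Lemma Qmx_mul0 q x (v : 'cV[R[i]]_2) : (Qmx q x *m v) 0 0 = q x * v 1 0.
Proof. by rewrite mxE sum2 !mxE /= mul0r add0r. Qed.

Lemma Qmx_mul1 q x (v : 'cV[R[i]]_2) : (Qmx q x *m v) 1 0 = (q x)^* * v 0 0.
Proof. by rewrite mxE sum2 !mxE /= mul0r addr0. Qed.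

Lemma e1E (k : 'I_2) : e1 R k 0 = if k == 0 then 1 else 0.
Proof. by rewrite mxE eqxx andbT; case: (k == 0). Qed.

Lemma e2E (k : 'I_2) : e2 R k 0 = if k == 0 then 0 else 1.
Proof. by rewrite mxE eqxx andbT; case: k => [[|[|]]]. Qed.

Lemma ord2P (k : 'I_2) : k = 0 \/ k = 1.
Proof. by case: k => [[|[|//]] h]; [left|right]; apply/val_inj. Qed.

Lemma col2P (u v : 'cV[R[i]]_2) : u 0 0 = v 0 0 -> u 1 0 = v 1 0 -> u = v.
Proof.
by move=> h0 h1; apply/matrixP => i j; rewrite (ord1 j); have [->|->] := ord2P i.
Qed.

Lemma normc_le_cn (z : R[i]) : `|z| <= (cn z)%:C.
Proof.
rewrite -[`|z|]/((ComplexField.Normc.normc z)%:C) lecR; case: z => a b /=.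
rewrite -(ger0_norm (cn_ge0 _)) -sqrtr_sqr ler_sqrt ?sqr_ge0 //.
exact: (sqn_le_cn (a +i* b)).
Qed.

Lemma cn_le_normc (z : R[i]) (B : R) : `|z| <= B%:C -> cn z <= 2 * B.
Proof.
rewrite -[`|z|]/((ComplexField.Normc.normc z)%:C) lecR; case: z => a b /= h.
have ha : `|a| <= B.
  apply: le_trans h; rewrite -sqrtr_sqr ler_sqrt ?addr_ge0 ?sqr_ge0 // lerDl sqr_ge0 //.
have hb : `|b| <= B.
  apply: le_trans h; rewrite -sqrtr_sqr ler_sqrt ?addr_ge0 ?sqr_ge0 // lerDr sqr_ge0 //.
rewrite /cn /=; lra.
Qed.

Lemma mx_norm_ltP (v : 'cV[R[i]^o]_2) (e : R) : 0 < e ->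
  `|v| < e%:C <-> forall k : 'I_2, `|v k 0 : R[i]^o| < e%:C.
Proof.
move=> e0.
have -> : (`|v| < e%:C) = (`|0 - v| < e%:C) by rewrite sub0r normrN.
have E : ball (0 : 'cV[R[i]^o]_2) e%:C v <-> `|0 - v| < e%:C.
  by have := @mx_norm_ball R[i]^o 2 1 => ->.
split.
  move=> /E [_ h] k; have := h k 0.
  by rewrite -ball_normE /= mxE sub0r normrN.
move=> h; apply/E; split; first by rewrite ltcR.
by move=> i j; rewrite (ord1 j) -ball_normE /= mxE sub0r normrN.
Qed.

Lemma vboundedP (r : R -> 'cV[R[i]]_2) : vbounded r <->
  exists B, forall x, cn (r x 0 0) <= B /\ cn (r x 1 0) <= B.
Proof.
split.
  move=> [M0 [M0r hM]].
  have M0E : M0 = (Re M0)%:C by rewrite RRe_real.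
  pose B := `|Re M0| + 1.
  have B0 : 0 < B by rewrite ltr_wpDl.
  have MB : M0 < B%:C.
    by rewrite M0E ltcR /B; have := ler_norm (Re M0); lra.
  have h := hM B%:C MB.
  exists (2 * (B + 1)) => x; have hx := h x I.
  have B1 : 0 < B + 1 by lra.
  have hlt : `|r x : 'cV[R[i]^o]_2| < (B + 1)%:C.
    by apply: (le_lt_trans hx); rewrite ltcR ltrDl.
  have := (mx_norm_ltP (r x) B1).1 hlt => nn.
  by split; apply: cn_le_normc; apply: ltW; exact: nn.
move=> [B hB].
have B0 : 0 <= B by have [h _] := hB 0; apply: le_trans h; exact: cn_ge0.
exists (B + 1)%:C; split; first by apply/complex_realP; exists (B + 1).
move=> M BM x _ /=; apply: ltW; apply: lt_trans BM.
have B1 : 0 < B + 1 by lra.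
apply/(mx_norm_ltP _ B1) => k.
have [h0 h1] := hB x.
have hk : cn (r x k 0) <= B by have [->|->] := ord2P k.
by apply: (le_lt_trans (normc_le_cn _)); rewrite ltcR; lra.
Qed.

Lemma volterra_left_entries q (c : 'cV[R[i]]_2) k0 k1 (r : R -> 'cV[R[i]]_2) :
  volterra_left q c (fun t => diag2 (k0 t) (k1 t)) r <->
  volL q (c 0 0) (c 1 0) k0 k1 (fun x => r x 0 0) (fun x => r x 1 0).
Proof.
have E0 x : (fun s => (diag2 (k0 (x - s)) (k1 (x - s)) *m Qmx q s *m r s) 0 0) =
    (fun s => k0 (x - s) * (q s * r s 1 0)).
  by apply/funext => s; rewrite -mulmxA diag2_mul Qmx_mul0.
have E1 x : (fun s => (diag2 (k0 (x - s)) (k1 (x - s)) *m Qmx q s *m r s) 1 0) =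
    (fun s => k1 (x - s) * ((q s)^* * r s 0 0)).
  by apply/funext => s; rewrite -mulmxA diag2_mul Qmx_mul1.
split=> [[/vboundedP hB e]|[/vboundedP hB e]]; split=> // x.
  have [i er] := e x; have := i 0; have := i 1; rewrite E0 E1 => i1 i0; split=> //.
    by have /= := congr1 (fun v : 'cV[R[i]]_2 => v 0 0) er; rewrite !mxE E0.
  by have /= := congr1 (fun v : 'cV[R[i]]_2 => v 1 0) er; rewrite !mxE E1.
have [i0 i1 e0 e1] := e x; split.
  by move=> k; have [->|->] := ord2P k; rewrite ?E0 ?E1.
by apply: col2P; rewrite !mxE ?E0 ?E1.
Qed.

Lemma volterra_right_entries q (c : 'cV[R[i]]_2) k0 k1 (r : R -> 'cV[R[i]]_2) :
  volterra_right q c (fun t => diag2 (k0 t) (k1 t)) r <->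
  volR q (c 0 0) (c 1 0) k0 k1 (fun x => r x 0 0) (fun x => r x 1 0).
Proof.
have E0 x : (fun s => (diag2 (k0 (x - s)) (k1 (x - s)) *m Qmx q s *m r s) 0 0) =
    (fun s => k0 (x - s) * (q s * r s 1 0)).
  by apply/funext => s; rewrite -mulmxA diag2_mul Qmx_mul0.
have E1 x : (fun s => (diag2 (k0 (x - s)) (k1 (x - s)) *m Qmx q s *m r s) 1 0) =
    (fun s => k1 (x - s) * ((q s)^* * r s 0 0)).
  by apply/funext => s; rewrite -mulmxA diag2_mul Qmx_mul1.
split=> [[/vboundedP hB e]|[/vboundedP hB e]]; split=> // x.
  have [i er] := e x; have := i 0; have := i 1; rewrite E0 E1 => i1 i0; split=> //.
    by have /= := congr1 (fun v : 'cV[R[i]]_2 => v 0 0) er; rewrite !mxE E0.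
  by have /= := congr1 (fun v : 'cV[R[i]]_2 => v 1 0) er; rewrite !mxE E1.
have [i0 i1 e0 e1] := e x; split.
  by move=> k; have [->|->] := ord2P k; rewrite ?E0 ?E1.
by apply: col2P; rewrite !mxE ?E0 ?E1.
Qed.

Lemma qdom_hat C q : qdom C q -> qdom C (qhat q).
Proof.
move=> [C0 cq h]; split => //.
  by apply: ccontN; apply: ccontC; exact: ccont_opparg.
by move=> t; rewrite /qhat cnN cnC -normrN -(lorentzN t); exact: h.
Qed.

Definition mI lam : R[i] := 2%:R * 'i%C * lam.

Lemma Re_mI lam : Re (mI lam) = - 2 * Im lam.
Proof. by rewrite /mI !reim /=; ring. Qed.

Lemma kernel1E lam : kernel1 lam = fun t => diag2 1 (ce (mI lam * t%:C)).
Proof. by apply/funext => t; rewrite /kernel1 ceE. Qed.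

Lemma kernel2E lam : kernel2 lam = fun t => diag2 (ce (- (mI lam * t%:C))) 1.
Proof. by apply/funext => t; rewrite /kernel2 ceE. Qed.

Lemma conj_mI lam t : (ce (- (mI lam * t%:C)))^* = ce (mI (lam^*) * t%:C).
Proof.
have mI2 l : mI l = 'i%C * l + 'i%C * l by rewrite /mI; ring.
by rewrite -ceC !mI2; congr ce; apply: complexP; rewrite !reim /=; ring.
Qed.

Lemma conjcK' f : (fun t => ((f t)^*)^*) = f. Proof. by apply/funext => t; rewrite conjcK. Qed.
Lemma opprK' f : (fun t => f (- - t)) = f. Proof. by apply/funext => t; rewrite opprK. Qed.

Lemma r1m_volJ q lam r : volterra_left q (e1 R) (kernel1 lam) r <->
  volJ q (mI lam) (fun x => r x 0 0) (fun x => r x 1 0).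
Proof. by rewrite kernel1E volterra_left_entries !e1E. Qed.

(** By conjugation the function meant for the lower half-plane is governed by
    conj lambda in the upper one. *)
Lemma r1p_volJ q lam r : volterra_left q (e2 R) (kernel2 lam) r <->
  volJ q (mI (lam^*)) (fun x => (r x 1 0)^*) (fun x => (r x 0 0)^*).
Proof.
rewrite kernel2E volterra_left_entries !e2E /= /volJ; split.
  move=> /volL_conj; rewrite conjc0 conjc1.
  by rewrite (_ : (fun t => (ce _)^*) = fun t => ce (mI (lam^*) * t%:C)) //; apply/funext => t; rewrite conj_mI.
move=> /volL_conj; rewrite conjc0 conjc1.
rewrite (_ : (fun t => (ce _)^*) = fun t => ce (- (mI lam * t%:C))); last first.
  by apply/funext => t; rewrite -conj_mI conjcK.
by rewrite (conjcK' (fun t => r t 0 0)) (conjcK' (fun t => r t 1 0)).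
Qed.

(** By reflection. *)
Lemma r2p_volJ q lam r : volterra_right q (e2 R) (kernel2 lam) r <->
  volJ (qhat q) (mI lam) (fun x => r (- x) 1 0) (fun x => r (- x) 0 0).
Proof.
rewrite kernel2E volterra_right_entries !e2E /= /volJ; split.
  move=> /volR_reflect.
  rewrite (_ : (fun t => ce (- (_ * (- t)%:C))) = fun t => ce (mI lam * t%:C)) //.
  by apply/funext => t; rewrite rmorphN mulrN opprK.
move=> /volL_reflect; rewrite qhatK.
rewrite (_ : (fun t => ce (_ * (- t)%:C)) = fun t => ce (- (mI lam * t%:C))); last first.
  by apply/funext => t; rewrite rmorphN mulrN.
by rewrite (opprK' (fun t => r t 0 0)) (opprK' (fun t => r t 1 0)).
Qed.

(** By reflection and conjugation. *)
Lemma r2m_volJ q lam r : volterra_right q (e1 R) (kernel1 lam) r <->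
  volJ (qhat q) (mI (lam^*)) (fun x => (r (- x) 0 0)^*) (fun x => (r (- x) 1 0)^*).
Proof.
rewrite kernel1E volterra_right_entries !e1E /= /volJ.
have E t : ce (mI lam * (- t)%:C) = ce (- (mI lam * t%:C)) by rewrite rmorphN mulrN.
split.
  move=> /volR_reflect /volL_conj; rewrite conjc0 conjc1.
  rewrite (_ : (fun t => (ce _)^*) = fun t => ce (mI (lam^*) * t%:C)) //.
  by apply/funext => t; rewrite E conj_mI.
move=> /volL_conj /volL_reflect; rewrite qhatK conjc0 conjc1.
rewrite (_ : (fun t => (ce _)^*) = fun t => ce (mI lam * t%:C)); last first.
  by apply/funext => t; rewrite -conj_mI conjcK rmorphN mulrN opprK.
by rewrite (opprK' (fun t => ((r t 0 0)^*)^*)) (opprK' (fun t => ((r t 1 0)^*)^*))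
  (conjcK' (fun t => r t 0 0)) (conjcK' (fun t => r t 1 0)).
Qed.

End volterra_forms.

(** * Solutions of the resolvent equation *)

Section green.
Variable R : realType.
Implicit Types (q f g h a b u v r t : R -> R[i]) (x X s M C S : R) (z w m l lam : R[i]).

Lemma cdomM B M r f : ccont r -> (forall x, cn (r x) <= B) -> cdom M f ->
  cdom (B * M) (fun x => r x * f x).
Proof.
move=> cr rB [cf fM]; split; first exact: ccontM.
move=> x; apply: (le_trans (cnM _ _)); rewrite -mulrA.
by apply: ler_pM; rewrite ?cn_ge0.
Qed.

Lemma cdomD M M' f g : cdom M f -> cdom M' g -> cdom (M + M') (fun x => f x + g x).
Proof.
move=> [cf fM] [cg gM]; split; first exact: ccontD.
by move=> x; apply: (le_trans (cnD _ _)); rewrite mulrDl lerD.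
Qed.

Lemma cdomB M M' f g : cdom M f -> cdom M' g -> cdom (M + M') (fun x => f x - g x).
Proof.
move=> [cf fM] [cg gM]; split; first exact: ccontB.
by move=> x; apply: (le_trans (cnB _ _)); rewrite mulrDl lerD.
Qed.

Lemma cdomZ z M f : cdom M f -> cdom (cn z * M) (fun x => z * f x).
Proof. by move=> d; apply: (cdomM (r := fun=> z)) => //; exact: ccont_cst. Qed.

Lemma cdom_opparg M f : cdom M f -> cdom M (fun x => f (- x)).
Proof.
by move=> [cf fM]; split; [exact: ccont_opparg|move=> x; rewrite -(lorentzN x)].
Qed.

Lemma cdomC M f : cdom M f -> cdom M (fun x => (f x)^*).
Proof. by move=> [cf fM]; split; [exact: ccontC|move=> x; rewrite cnC]. Qed.

Lemma cdom_le M M' f : M <= M' -> cdom M f -> cdom M' f.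
Proof.
move=> MM [cf fM]; split=> // x; apply: (le_trans (fM x)).
by rewrite ler_wpM2r ?lorentz_ge0.
Qed.

(** Entries of (T - z) u = i sigma_3 f, solved for u'. *)
Definition is_sol q z f1 f2 u1 u2 :=
  (forall x, cderive u1 x (- ('i%C * z) * u1 x + q x * u2 x + f1 x)) /\
  (forall x, cderive u2 x ((q x)^* * u1 x + 'i%C * z * u2 x + f2 x)).

(** The Jost solutions from -oo and from +oo, without their exponentials:
    (r1, r2) = r_{1,-} and (t1, t2) = r_{2,+}. *)
Definition jpair q z r1 r2 t1 t2 := jost q (mI z) r1 r2 /\
  jost (qhat q) (mI z) (fun x => t2 (- x)) (fun x => t1 (- x)).

Section one_pair.
Variables (C : R) (q : R -> R[i]) (z : R[i]) (r1 r2 t1 t2 : R -> R[i]).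
Hypotheses (dq : qdom C q) (z0 : 0 <= Im z) (J : jpair q z r1 r2 t1 t2).

Lemma mI_le0 : Re (mI z) <= 0.
Proof. by rewrite Re_mI; have := z0; lra. Qed.

Let C0 : 0 < C. Proof. by case: dq. Qed.
Let J1 : jost q (mI z) r1 r2 := proj1 J.
Let J2 := proj2 J.
Let dqh := qdom_hat dq.

Definition jB := 2 * wmax C.

Lemma jpair_cont : [/\ ccont r1, ccont r2, ccont t1 & ccont t2].
Proof.
have [c1 c2 _ _] := J1; have [c3 c4 _ _] := J2.
split=> //; first by apply: ccont_ext (ccont_opparg c4) => x; rewrite opprK.
by apply: ccont_ext (ccont_opparg c3) => x; rewrite opprK.
Qed.

Lemma jpair_bound x : [/\ cn (r1 x) <= jB, cn (r2 x) <= jB, cn (t1 x) <= jB & cn (t2 x) <= jB].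
Proof.
have [b1 b2] := jost_bound dq mI_le0 J1 x; have [b3 b4] := jost_bound dqh mI_le0 J2 (- x).
by rewrite opprK in b3 b4.
Qed.

Lemma jpair_derive x :
  [/\ cderive r1 x (q x * r2 x), cderive r2 x (mI z * r2 x + (q x)^* * r1 x),
      cderive t1 x (- mI z * t1 x + q x * t2 x) & cderive t2 x ((q x)^* * t1 x)].
Proof.
have E y : Num.conj (qhat q (- y)) = - q y.
  by rewrite /qhat opprK; apply: complexP; rewrite !reim ?opprK.
have E' y : qhat q (- y) = - (q y)^*%C by rewrite /qhat opprK.
split; first exact: jost_derive1 dq J1 x; first exact: jost_derive2 dq mI_le0 J1 x.
  have := cderive_opparg (jost_derive2 dqh mI_le0 J2 (- x)).
  rewrite !opprK E => d; apply: cderive_ext (cderive_eq d _) => [y|]; first by rewrite opprK.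
  by ring.
have := cderive_opparg (jost_derive1 dqh J2 (- x)).
rewrite !opprK E' => d; apply: cderive_ext (cderive_eq d _) => [y|]; first by rewrite opprK.
by ring.
Qed.

(** The Wronskian, where the two exponentials cancel. *)
Definition jwr x := r1 x * t2 x - r2 x * t1 x.

Lemma cderive0_cst f : (forall x, cderive f x 0) -> forall x y, f x = f y.
Proof.
move=> d x y; apply: complexP.
  by apply: (@is_derive_0_is_cst R (fun x => Re (f x))) => s; have [] := d s.
by apply: (@is_derive_0_is_cst R (fun x => Im (f x))) => s; have [] := d s.
Qed.

Lemma jwr_cst x : jwr x = jwr 0.
Proof.
apply: cderive0_cst => y; have [d1 d2 d3 d4] := jpair_derive y.
apply: cderive_eq; first by apply: cderiveB; apply: cderiveM; eassumption.
by ring.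
Qed.

(** Lagrange's identity: |det|^2 is a square plus the product of
    |r1|^2 - |r2|^2 and |t2|^2 - |t1|^2, both at least 1 by [jost_energy]. *)
Lemma jwr_ge1 : 1 <= sqn (jwr 0).
Proof.
have e1 := jost_energy dq mI_le0 J1 0; have e2 := jost_energy dqh mI_le0 J2 0.
rewrite oppr0 in e2; rewrite /jwr.
have E : sqn (r1 0 * t2 0 - r2 0 * t1 0) =
    sqn (r1 0 * (t1 0)^* - r2 0 * (t2 0)^*) +
    (sqn (r1 0) - sqn (r2 0)) * (sqn (t2 0) - sqn (t1 0)).
  by rewrite /sqn !reim; ring.
rewrite E; have := sqn_ge0 (r1 0 * (t1 0)^* - r2 0 * (t2 0)^*).
have := mulr_ge0 (_ : 0 <= sqn (r1 0) - sqn (r2 0) - 1) (_ : 0 <= sqn (t2 0) - sqn (t1 0) - 1).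
rewrite !subr_ge0 => /(_ e1 e2); lra.
Qed.

Lemma jwr_neq0 : jwr 0 != 0.
Proof.
by apply/eqP => h; have := jwr_ge1; rewrite h /sqn /= expr0n /= addr0; lra.
Qed.

Lemma cn_jwrV : cn (jwr 0)^-1 <= 2.
Proof.
have := @cnV_le R (jwr 0) 1 ltr01; rewrite divr1 expr1n; apply; exact: jwr_ge1.
Qed.

Section source.
Variables (M : R) (f1 f2 : R -> R[i]).
Hypotheses (df1 : cdom M f1) (df2 : cdom M f2).

Definition gsrc1 x := r1 x * f2 x - r2 x * f1 x.
Definition gsrc2 x := f1 x * t2 x - f2 x * t1 x.
(** Coefficients of the two Jost solutions by variation of constants, each
    multiplied by its exponential. *)
Definition gbeta := Lam ('i%C * z) gsrc1.
Definition galpha x := - Lam ('i%C * z) (fun s => gsrc2 (- s)) (- x).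
Definition green1 x := (jwr 0)^-1 * (gbeta x * t1 x + galpha x * r1 x).
Definition green2 x := (jwr 0)^-1 * (gbeta x * t2 x + galpha x * r2 x).

Lemma iz_le0 : Re ('i%C * z) <= 0.
Proof. by rewrite !reim /=; have := z0; lra. Qed.

Lemma gsrc1_dom : cdom (2 * jB * M) gsrc1.
Proof.
have [c1 c2 _ _] := jpair_cont.
rewrite (_ : 2 * jB * M = jB * M + jB * M); last by ring.
apply: cdomB; apply: cdomM => // x; by have [] := jpair_bound x.
Qed.

Lemma gsrc2_dom : cdom (2 * jB * M) (fun s => gsrc2 (- s)).
Proof.
have [_ _ c1 c2] := jpair_cont.
apply: (cdom_opparg (f := gsrc2)).
rewrite (_ : gsrc2 = fun x => t2 x * f1 x - t1 x * f2 x); last first.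
  by apply/funext => x; rewrite /gsrc2; ring.
rewrite (_ : 2 * jB * M = jB * M + jB * M); last by ring.
apply: cdomB; apply: cdomM => // x; by have [] := jpair_bound x.
Qed.

Lemma gbeta_derive x : cderive gbeta x ('i%C * z * gbeta x + gsrc1 x).
Proof. exact: Lam_derive iz_le0 gsrc1_dom. Qed.

Lemma galpha_derive x : cderive galpha x (- ('i%C * z) * galpha x + gsrc2 x).
Proof.
have d := cderiveN (cderive_opparg (Lam_derive (- x) iz_le0 gsrc2_dom)).
apply: cderive_eq d _; rewrite /galpha !opprK; ring.
Qed.

(** The terms that contain derivatives of the coefficients recombine to the source
    because the Wronskian is constant. *)
Lemma green_sol : is_sol q z f1 f2 green1 green2.
Proof.
have k : (jwr 0)^-1 * jwr 0 = 1 by rewrite mulVf // jwr_neq0.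
split=> x; have [d1 d2 d3 d4] := jpair_derive x;
  have db := gbeta_derive x; have da := galpha_derive x;
  have kx h : h x = (jwr 0)^-1 * (r1 x * t2 x - r2 x * t1 x) * h x
    by rewrite -/(jwr x) jwr_cst k mul1r.
  apply: cderive_eq.
    by apply: cderiveZ; apply: cderiveD; apply: cderiveM; eassumption.
  rewrite [f1 x in RHS](kx f1) /green1 /green2 /gsrc1 /gsrc2 /mI; ring.
apply: cderive_eq.
  by apply: cderiveZ; apply: cderiveD; apply: cderiveM; eassumption.
rewrite [f2 x in RHS](kx f2) /green1 /green2 /gsrc1 /gsrc2 /mI; ring.
Qed.

Lemma jB_ge0 : 0 <= jB.
Proof. by rewrite mulr_ge0 // (le_trans _ (wmax_ge1 C0)). Qed.

Lemma green_cn x (K : R) : 0 <= K -> cn (gbeta x) <= K -> cn (galpha x) <= K ->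
  cn (green1 x) <= 4 * jB * K /\ cn (green2 x) <= 4 * jB * K.
Proof.
move=> K0 hb ha; have [b1 b2 b3 b4] := jpair_bound x.
have P (u v : R[i]) : cn u <= K -> cn v <= jB -> cn (u * v) <= K * jB.
  by move=> h1 h2; apply: (le_trans (cnM _ _)); apply: ler_pM; rewrite ?cn_ge0.
have Q (u : R[i]) : cn u <= 2 * (K * jB) -> cn ((jwr 0)^-1 * u) <= 4 * jB * K.
  move=> h; apply: (le_trans (cnM _ _)).
  have -> : 4 * jB * K = 2 * (2 * (K * jB)) by ring.
  by apply: ler_pM; rewrite ?cn_ge0 ?cn_jwrV.
have h11 := P _ _ hb b3; have h12 := P _ _ ha b1.
have h21 := P _ _ hb b4; have h22 := P _ _ ha b2.
by split; apply: Q; apply: (le_trans (cnD _ _)); lra.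
Qed.

Lemma green_bound x : cn (green1 x) <= 32 * pi * jB ^+ 2 * M /\ cn (green2 x) <= 32 * pi * jB ^+ 2 * M.
Proof.
have M0 := cdom_ge0 df1.
have h1 := Lam_bound_pi x iz_le0 gsrc1_dom.
have h2 := Lam_bound_pi (- x) iz_le0 gsrc2_dom.
have -> : 32 * pi * jB ^+ 2 * M = 4 * jB * (4 * (2 * jB * M) * pi) by ring.
apply: green_cn; rewrite ?cnN //.
exact: mulr_ge0 (mulr_ge0 (ler0n _ 4) (mulr_ge0 (mulr_ge0 (ler0n _ 2) jB_ge0) M0)) (pi_ge0 R).
Qed.

End source.
End one_pair.

Lemma jpair_exists C q z : qdom C q -> 0 <= Im z ->
  exists r1 r2 t1 t2, jpair q z r1 r2 t1 t2.
Proof.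
move=> dq z0; have m0 := mI_le0 z0.
have [r1 [r2 h1]] := jost_exists dq m0.
have [t2 [t1 h2]] := jost_exists (qdom_hat dq) m0.
exists r1, r2, (fun x => t1 (- x)), (fun x => t2 (- x)); split => //.
by rewrite (opprK' t1) (opprK' t2).
Qed.

(** The two exponential kernels have rate Im z, so [Lam_decay] applies to both. *)
Lemma green_decay C q (e0 : R) : qdom C q -> 0 < e0 -> exists2 K, 0 <= K &
  forall z r1 r2 t1 t2 M f1 f2, e0 <= Im z -> jpair q z r1 r2 t1 t2 -> cdom M f1 -> cdom M f2 ->
    cdom (K * M) (green1 z r1 r2 t1 t2 f1 f2) /\ cdom (K * M) (green2 z r1 r2 t1 t2 f1 f2).
Proof.
move=> dq e00; have [K K0 hK] := @Lam_decay R e0 e00.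
have B0 := jB_ge0 dq.
exists (8 * jB C ^+ 2 * K); first exact: mulr_ge0 (mulr_ge0 (ler0n _ 8) (sqr_ge0 _)) K0.
move=> z r1 r2 t1 t2 M f1 f2 ez J d1 d2; have z0 : 0 <= Im z by lra.
have M0 := cdom_ge0 d1.
have iz : Re ('i%C * z) <= - e0 by rewrite !reim /=; lra.
have [s1 s2] := green_sol dq z0 J d1 d2.
have dec x : cn (green1 z r1 r2 t1 t2 f1 f2 x) <= 8 * jB C ^+ 2 * K * M * lorentz x /\
    cn (green2 z r1 r2 t1 t2 f1 f2 x) <= 8 * jB C ^+ 2 * K * M * lorentz x.
  have -> : 8 * jB C ^+ 2 * K * M * lorentz x = 4 * jB C * (K * (2 * jB C * M) * lorentz x) by ring.
  apply: (green_cn dq z0 J).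
  - exact: mulr_ge0 (mulr_ge0 K0 (mulr_ge0 (mulr_ge0 (ler0n _ 2) B0) M0)) (lorentz_ge0 x).
  - exact: hK iz (gsrc1_dom dq z0 J d1 d2).
  - rewrite cnN -(lorentzN x); exact: hK iz (gsrc2_dom dq z0 J d1 d2).
split; first by split; [exact: cderive_cont s1|move=> x; have [] := dec x].
by split; [exact: cderive_cont s2|move=> x; have [] := dec x].
Qed.

(** Two bounds are recorded: a weighted one that depends on a lower bound of Im z,
    and a pointwise one that is uniform up to the real axis. *)
Lemma green_exists C q (e0 : R) : qdom C q -> 0 < e0 -> exists2 K, 0 <= K &
  forall z M f1 f2, e0 <= Im z -> cdom M f1 -> cdom M f2 -> exists u1 u2,
    [/\ is_sol q z f1 f2 u1 u2, cdom (K * M) u1, cdom (K * M) u2 &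
        forall x, cn (u1 x) <= 32 * pi * jB C ^+ 2 * M /\ cn (u2 x) <= 32 * pi * jB C ^+ 2 * M].
Proof.
move=> dq e00; have [K K0 hK] := green_decay dq e00.
exists K => // z M f1 f2 ez d1 d2; have z0 : 0 <= Im z by lra.
have [r1 [r2 [t1 [t2 J]]]] := jpair_exists dq z0.
have [b1 b2] := hK z r1 r2 t1 t2 M f1 f2 ez J d1 d2.
exists (green1 z r1 r2 t1 t2 f1 f2), (green2 z r1 r2 t1 t2 f1 f2); split=> //.
  by have [s1 s2] := green_sol dq z0 J d1 d2; split.
by move=> x; exact: (green_bound dq z0 J d1 d2 x).
Qed.

End green.

(** * Uniqueness of square-integrable solutions *)

Section uniqueness.
Variable R : realType.
Implicit Types (q f g h a b u v r : R -> R[i]) (x X s M C S : R) (z w m l lam : R[i]).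
Local Notation mu := (@lebesgue_measure R).

Lemma dominated_L2 (F : R -> R) M : continuous F -> (forall x, `|F x| <= M * lorentz x) ->
  F \in Lfun mu 2%:E.
Proof.
move=> cF FM.
have M0 : 0 <= M.
  have := FM 0; rewrite /lorentz expr0n /= addr0 invr1 mulr1; exact: le_trans.
rewrite inE; apply/andP; split; rewrite inE /=; first exact: continuous_measurable_fun.
rewrite /finite_norm unlock poweR_lty //.
have i2 : mu.-integrable setT (EFin \o (fun x => F x ^+ 2)).
  apply: (@dominated_integrable R _ (M ^+ 2)).
    by move=> x; apply: (@continuous_comp _ _ _ F (fun y : R => y ^+ 2)); [exact: cF|exact: exprn_continuous].
  move=> x; rewrite normrX.
  have h := FM x; have l1 := lorentz_le1 x; have l0 := lorentz_ge0 x.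
  apply: (@le_trans _ _ ((M * lorentz x) ^+ 2)); first by rewrite lerXn2r // nnegrE mulr_ge0.
  by rewrite exprMn ler_wpM2l ?sqr_ge0 // expr2 ler_piMr.
move/integrableP : i2 => [_]; apply: le_lt_trans.
rewrite le_eqVlt; apply/orP; left; apply/eqP; apply: eq_integral => x _.
by rewrite /= normrX powR_mulrn.
Qed.

(** A positive value at x would persist on the whole half-line [x, +oo[. *)
Lemma monotone_integrable_le0 (G : R -> R) : {homo G : x y / x <= y} ->
  mu.-integrable setT (EFin \o G) -> forall x, G x <= 0.
Proof.
move=> mono iG x; rewrite leNgt; apply/negP => Gx0.
have i1 : mu.-integrable `[x, +oo[ (EFin \o G) by apply: integrableS iG.
have i2 : mu.-integrable `[x, +oo[ (cst (G x)%:E).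
  apply: le_integrable i1 => // y; rewrite /= in_itv /= andbT => xy.
  rewrite lee_fin (gtr0_norm Gx0); apply: le_trans (ler_norm _); exact: mono.
move/integrableP : i2 => [_]; rewrite /= integral_cst //= lebesgue_measure_itv /= ltry /=.
by rewrite gt0_muley ?ltxx // lte_fin normr_gt0 gt_eqF.
Qed.

Lemma monotone_integrable_eq0 (G : R -> R) : {homo G : x y / x <= y} ->
  mu.-integrable setT (EFin \o G) -> forall x, G x = 0.
Proof.
move=> mono iG x; apply/eqP; rewrite eq_le (monotone_integrable_le0 mono iG x) /=.
have : - G (- - x) <= 0.
  apply: (@monotone_integrable_le0 (fun y => - G (- y))) => [y y' h|].
    by rewrite lerN2; apply: mono; rewrite lerN2.
  have := integrable_opp (@measurableT _ (measurableTypeR R)) iG; rewrite preimage_setT => i.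
  have := @integrable_scale R setT (-1) (fun y : R => G (- y)) measurableT i.
  by rewrite (_ : (fun t : R => -1 * _) = fun y : R => - G (- y)) //; apply/funext => y; rewrite mulN1r.
by rewrite opprK; lra.
Qed.

(** The function |u1|^2 - |u2|^2 has derivative 2 Im z (|u1|^2 + |u2|^2), so it is
    monotone; it is also integrable, hence zero. *)
Lemma homogeneous_L2_eq0 q z u1 u2 : Im z != 0 ->
  is_sol q z (fun=> 0) (fun=> 0) u1 u2 ->
  mu.-integrable setT (EFin \o (fun x => sqn (u1 x))) ->
  mu.-integrable setT (EFin \o (fun x => sqn (u2 x))) ->
  forall x, u1 x = 0 /\ u2 x = 0.
Proof.
move=> z0 [d1 d2] i1 i2.
pose c := Num.sg (Im z).
pose G x := c * (sqn (u1 x) - sqn (u2 x)).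
have dG x : is_derive x (1:R) G (2 * `|Im z| * (sqn (u1 x) + sqn (u2 x))).
  have [a1 b1] := d1 x; have [a2 b2] := d2 x.
  rewrite /G /sqn; apply: is_derive_eq; rewrite !reim /GRing.scale /= normrEsg -/c; ring.
have pos x : 0 <= 2 * `|Im z| * (sqn (u1 x) + sqn (u2 x)).
  by apply: mulr_ge0; [exact: mulr_ge0|apply: addr_ge0; exact: sqn_ge0].
have mono : {homo G : x y / x <= y}.
  by move=> x y xy; apply: (is_derive_ndecr (fun t _ => dG t) (fun t _ => pos t) xy (lexx y)).
have iG : mu.-integrable setT (EFin \o G).
  apply: integrable_scale => //.
  rewrite (_ : (fun x => _) = fun x => sqn (u1 x) + (-1) * sqn (u2 x)); last first.
    by apply/funext => x; rewrite mulN1r.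
  by apply: integrable_add => //; exact: integrable_scale.
have G0 := monotone_integrable_eq0 mono iG.
move=> x.
have : 2 * `|Im z| * (sqn (u1 x) + sqn (u2 x)) = 0.
  have h0 : is_derive x (1:R) G 0.
    by rewrite (_ : G = cst 0); [exact: is_derive_cst|exact: funext].
  have [_ e1] := h0; have [_ e2] := dG x; by rewrite -e2 e1.
move/eqP; rewrite mulf_eq0 mulf_eq0 pnatr_eq0 normr_eq0 (negPf z0) /=.
rewrite paddr_eq0 ?sqn_ge0 // => /andP[/eqP h1 /eqP h2].
by split; exact: sqn_eq0.
Qed.

(** Relates the two half-planes; the source changes to (conj f2, conj f1). *)
Lemma is_sol_conj q z f1 f2 u1 u2 : is_sol q z f1 f2 u1 u2 ->
  is_sol q (z^*) (fun x => (f2 x)^*) (fun x => (f1 x)^*) (fun x => (u2 x)^*) (fun x => (u1 x)^*).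
Proof.
move=> [d1 d2]; split => x.
  by apply: cderive_eq (cderiveC (d2 x)) _; apply: complexP; rewrite !reim /=; ring.
by apply: cderive_eq (cderiveC (d1 x)) _; apply: complexP; rewrite !reim /=; ring.
Qed.

Lemma is_sol_combine q z f1 f2 g1 g2 u1 u2 v1 v2 k : is_sol q z f1 f2 u1 u2 -> is_sol q z g1 g2 v1 v2 ->
  is_sol q z (fun x => f1 x + k * g1 x) (fun x => f2 x + k * g2 x)
    (fun x => u1 x + k * v1 x) (fun x => u2 x + k * v2 x).
Proof.
move=> [d1 d2] [e1 e2]; split => x; apply: cderive_eq.
- by apply: cderiveD; [exact: d1|apply: cderiveZ; exact: e1].
- by ring.
- by apply: cderiveD; [exact: d2|apply: cderiveZ; exact: e2].
- by ring.
Qed.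

Lemma is_sol_ext q z f1 f2 g1 g2 u1 u2 : f1 =1 g1 -> f2 =1 g2 -> is_sol q z f1 f2 u1 u2 ->
  is_sol q z g1 g2 u1 u2.
Proof. by move=> /funext -> /funext ->. Qed.

Lemma sqn_integrable M u : cdom M u -> mu.-integrable setT (EFin \o (fun x => sqn (u x))).
Proof.
move=> [[c1 c2] uM].
have l1 := @dominated_L2 _ M c1 (fun x => le_trans (Re_le_cn _) (uM x)).
have l2 := @dominated_L2 _ M c2 (fun x => le_trans (Im_le_cn _) (uM x)).
exact: (integrable_add _ (Lfun2_integrable_sqr l1) (Lfun2_integrable_sqr l2)).
Qed.

Lemma is_sol_unique q z f1 f2 u1 u2 v1 v2 M : Im z != 0 ->
  is_sol q z f1 f2 u1 u2 -> is_sol q z f1 f2 v1 v2 ->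
  cdom M u1 -> cdom M u2 -> cdom M v1 -> cdom M v2 ->
  forall x, u1 x = v1 x /\ u2 x = v2 x.
Proof.
move=> z0 su sv a1 a2 b1 b2 x.
have s := is_sol_combine (-1) su sv.
have s0 : is_sol q z (fun=> 0) (fun=> 0) (fun x => u1 x + -1 * v1 x) (fun x => u2 x + -1 * v2 x).
  by apply: is_sol_ext s => y; ring.
have [h1 h2] := homogeneous_L2_eq0 z0 s0 (sqn_integrable (cdomD a1 (cdomZ (-1) b1)))
  (sqn_integrable (cdomD a2 (cdomZ (-1) b2))) x.
by split; apply/eqP; rewrite -subr_eq0; apply/eqP; rewrite -mulN1r.
Qed.

End uniqueness.

(** * A smooth bump *)

Section smooth_bump.
Variable R : realType.
Implicit Types (F G f g phi : R -> R) (x t : R) (n k : nat).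

(** Differentiability of order n without reference to iterated derivatives, which
    makes stability under products and sums an easy induction. *)
Fixpoint diffn n f : Prop :=
  if n is n'.+1 then exists2 f', forall x, is_derive x (1:R) f (f' x) & diffn n' f'
  else True.

Lemma diffnW n f : diffn n.+1 f -> diffn n f.
Proof.
elim: n f => [//|n IH] f [f' df' Df']; exists f' => //; exact: IH.
Qed.

Lemma diffn_smooth f : (forall n, diffn n f) -> smooth f.
Proof.
move=> h n x; have := h n.+1; elim: n f {h} => [|n IH] f [f' df' Df'].
  by have [] := df' x.
rewrite derive1Sn; apply: IH.
rewrite (_ : derive1 f = f') //; apply/funext => y.
by rewrite derive1E; have [] := df' y.
Qed.

Lemma diffnD n f g : diffn n f -> diffn n g -> diffn n (fun x => f x + g x).
Proof.
elim: n f g => [//|n IH] f g [f' df Df] [g' dg Dg].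
by exists (fun x => f' x + g' x) => [x|]; [exact: is_deriveD|exact: IH].
Qed.

Lemma diffnZ n (c : R) f : diffn n f -> diffn n (fun x => c * f x).
Proof.
elim: n f => [//|n IH] f [f' df Df].
exists (fun x => c * f' x) => [x|]; last exact: IH.
by have h := df x; apply: is_derive_eq; rewrite /GRing.scale /=; ring.
Qed.

Lemma diffnM n f g : diffn n f -> diffn n g -> diffn n (fun x => f x * g x).
Proof.
elim: n f g => [//|n IH] f g Df0 Dg0.
have [f' df Df] := Df0; have [g' dg Dg] := Dg0.
exists (fun x => f' x * g x + f x * g' x) => [x|].
  have h1 := df x; have h2 := dg x.
  by apply: is_derive_eq; rewrite /GRing.scale /=; ring.
by apply: diffnD; apply: IH => //; exact: diffnW.
Qed.

Lemma diffn_affine n (c d : R) f : diffn n f -> diffn n (fun x => f (c * x + d)).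
Proof.
elim: n f => [//|n IH] f [f' df Df].
exists (fun x => c * f' (c * x + d)) => [x|]; last by apply: diffnZ; exact: IH.
have h : is_derive x (1:R) (fun y : R => c * y + d) c.
  by apply: is_derive_eq; rewrite /GRing.scale /=; ring.
have := @is_derive1_comp R f (fun y => c * y + d) x _ _ (df (c * x + d)) h.
by rewrite mulrC.
Qed.

(** The power of x makes the family closed under differentiation. *)
Definition flat k x : R := if 0 < x then x ^- k * expR (- x^-1) else 0.

Lemma flat_ge0 k x : 0 <= flat k x.
Proof.
by rewrite /flat; case: ifPn => // x0; rewrite mulr_ge0 ?expR_ge0 // invr_ge0 exprn_ge0 // ltW.
Qed.

Lemma flat_gt0 k x : 0 < x -> 0 < flat k x.
Proof. by move=> x0; rewrite /flat x0 mulr_gt0 ?expR_gt0 // invr_gt0 exprn_gt0. Qed.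

Lemma flat_eq0 k x : x <= 0 -> flat k x = 0.
Proof. by move=> x0; rewrite /flat ltNge x0. Qed.

(** The expansion of exp at order k+2 gives quadratic vanishing at 0, whence the
    derivative there. *)
Lemma flat_le k x : flat k x <= (k.+2)`!%:R * x ^+ 2.
Proof.
rewrite /flat; case: ifPn => [x0|_]; last by rewrite mulr_ge0 ?sqr_ge0.
have h := expR_ge1Dxn k.+1 (ltW (_ : 0 < x^-1)).
have {h} := h (_ : 0 < x^-1); rewrite invr_gt0 => /(_ x0) h.
have f0 : 0 < (k.+2)`!%:R :> R by rewrite ltr0n fact_gt0.
have h2 : x^-1 ^+ k.+2 <= (k.+2)`!%:R * expR x^-1.
  rewrite mulrC -ler_pdivrMr //; apply: le_trans h; by rewrite lerDr.
have p0 : 0 < x ^+ k.+2 by rewrite exprn_gt0.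
have e0 : 0 < expR x^-1 by exact: expR_gt0.
rewrite expRN.
rewrite ler_pdivrMr //.
have -> : x ^- k = x^-1 ^+ k.+2 * x ^+ 2.
  have n0 : x != 0 by rewrite gt_eqF.
  by rewrite !exprS exprVn; field; rewrite ?n0 ?expf_neq0.
rewrite [leRHS]mulrAC; apply: ler_wpM2r => //; exact: sqr_ge0.
Qed.

Lemma is_derive_locally F G x d (e : R) : 0 < e -> (forall y, `|x - y| < e -> F y = G y) ->
  is_derive x (1:R) G d -> is_derive x (1:R) F d.
Proof.
move=> e0 FG [dG DG].
have near_eq : {near x, G =1 F}.
  by exists e => //= y hy; rewrite FG.
apply: DeriveDef.
  by apply: near_eq_derivable near_eq dG; rewrite oner_neq0.
by rewrite -DG; apply/esym; apply: near_eq_derive near_eq; rewrite oner_neq0.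
Qed.

Lemma is_derive_flat k x : is_derive x (1:R) (flat k) (- k%:R * flat k.+1 x + flat k.+2 x).
Proof.
have [x0|x0|x0] := ltgtP x 0.
- rewrite !flat_eq0 ?(ltW x0) // mulr0 addr0.
  have e0 : 0 < - x by lra.
  apply: (is_derive_locally (G := cst 0) e0) => y.
  by rewrite ltr_norml => /andP[a b]; rewrite flat_eq0 //; lra.
- apply: (is_derive_locally (G := fun y => y ^- k * expR (- y^-1)) x0) => [y|].
    rewrite ltr_norml => /andP[a b]; rewrite /flat ifT //; lra.
  have n0 : x != 0 by rewrite gt_eqF.
  have nk : x ^+ k != 0 by rewrite expf_neq0.
  have hk : is_derive x (1:R) (fun y : R => y ^+ k) (k%:R * x ^+ k.-1).
    have h := @is_deriveX R R id k x 1 1 (is_derive_id _ _).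
    have E : (fun y : R => y ^+ k) = (id : R -> R) ^+ k by rewrite exprfctE.
    by rewrite E; apply: (is_derive_eq h); rewrite /GRing.scale /= mulr1.
  have h1 := @is_deriveV R (fun y => y ^+ k) x _ 1 nk hk.
  have hi : is_derive x (1:R) (fun y : R => - y^-1) (x ^- 2).
    have := @is_deriveV R id x 1 1 n0 (is_derive_id _ _) => h.
    by apply: is_derive_eq; rewrite /GRing.scale /= mulr1 opprK.
  have h2 := @is_derive1_comp R expR _ x _ _ (is_derive_expR _) hi.
  have h3 := is_deriveM h1 h2.
  apply: (@is_derive_eq R _ _ _ _ _ _ _ h3).
  rewrite /flat x0 /GRing.scale /=.
  case: k nk {hk h1 h3} => [|k] nk /=; first by rewrite /= !expr0; field.
  rewrite -[_ *- _]/(- (k.+1%:R)); move: (k.+1%:R : R) => c.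
  have p0 : x ^+ k != 0 by rewrite expf_neq0.
  rewrite !exprS expr0; move: (x ^+ k) p0 => p p0.
  by field; rewrite p0 n0.
- rewrite x0 !flat_eq0 // mulr0 addr0.
  have D : (fun h : R => h^-1 *: ((flat k \o shift (0:R)) (h *: (1:R)) - flat k 0)) @ 0^' --> (0:R).
    apply/cvgrPdist_le => e e0.
    have f0 : 0 < (k.+2)`!%:R :> R by rewrite ltr0n fact_gt0.
    exists (e / (k.+2)`!%:R) => /=; first by rewrite divr_gt0.
    move=> h /=; rewrite sub0r normrN => hh hn0.
    rewrite /= addr0 [h%:A]mulr1 (flat_eq0 k (lexx 0)) subr0 sub0r normrN /GRing.scale /=.
    rewrite normrM normfV (ger0_norm (flat_ge0 k h)) mulrC ler_pdivrMr ?normr_gt0 //.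
    apply: (le_trans (flat_le k h)).
    rewrite -(real_normK (num_real h)) expr2 mulrA ler_wpM2r //.
    by rewrite mulrC -ler_pdivlMr // ltW.
  apply: DeriveDef; first by apply/cvg_ex; exists 0.
  by apply/cvg_lim => //; exact: Rhausdorff.
Qed.

Lemma diffn_flat n k : diffn n (flat k).
Proof.
elim: n k => [//|n IH] k.
exists (fun x => - k%:R * flat k.+1 x + flat k.+2 x) => [x|]; first exact: is_derive_flat.
by apply: diffnD => //; exact: diffnZ.
Qed.

Definition sbump (a c : R) x : R := flat 0 (1 * x + - a) * flat 0 (-1 * x + c).

Lemma diffn_bump n a c : diffn n (sbump a c).
Proof. by apply: diffnM; apply: diffn_affine; exact: diffn_flat. Qed.

Lemma bump_ge0 a c x : 0 <= sbump a c x.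
Proof. by rewrite mulr_ge0 // flat_ge0. Qed.

Lemma bump_gt0 a c x : a < x -> x < c -> 0 < sbump a c x.
Proof. by move=> ax xc; rewrite mulr_gt0 // flat_gt0 //; lra. Qed.

Lemma bump_eq0 a c x : x <= a \/ c <= x -> sbump a c x = 0.
Proof.
move=> [h|h]; rewrite /sbump.
  by rewrite (@flat_eq0 _ (1 * x + - a)) ?mul0r //; lra.
by rewrite (@flat_eq0 _ (-1 * x + c)) ?mulr0 //; lra.
Qed.

Lemma bump_shift a c h x : sbump (a + h) (c + h) (x + h) = sbump a c x.
Proof. by rewrite /sbump; congr (flat _ _ * flat _ _); ring. Qed.

Lemma bump_cont a c : continuous (sbump a c).
Proof.
have [f' df' _] := diffn_bump 1 a c.
exact: (is_derive_continuous df').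
Qed.

End smooth_bump.

(** * Weak derivatives of continuous functions *)

Section weak_derivatives.
Variable R : realType.
Implicit Types (F G f g w k phi : R -> R) (x t a b c A M : R).
Local Notation mu := (@lebesgue_measure R).

Lemma compact_dominated g A : continuous g -> (forall x, A < `|x| -> g x = 0) ->
  exists M, forall x, `|g x| <= M * lorentz x.
Proof.
move=> cg g0; pose A' := `|A|.
have AA : - A' <= A' by have := normr_ge0 A; rewrite -/A'; lra.
have [c cA cmax] := @EVT_max R (fun x => `|g x|) (- A') A' AA
  (continuous_subspaceT (fun x => cvg_norm (cg x))).
exists (`|g c| * (1 + A' ^+ 2)) => x.
have l0 := lorentz_ge0 x.
have [xA|xA] := leP `|x| A'; last first.
  have -> : g x = 0 by apply: g0; apply: le_lt_trans xA; exact: ler_norm.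
  by rewrite normr0 mulr_ge0 // mulr_ge0 // addr_ge0 // sqr_ge0.
have xI : x \in `[- A', A'] by rewrite in_itv /= -ler_norml.
apply: (le_trans (cmax x xI)); rewrite -mulrA ler_peMr //.
have ll : (1 + x ^+ 2) * lorentz x = 1.
  by rewrite mulfV // gt_eqF // ltr_wpDr ?sqr_ge0.
rewrite -[leLHS]ll ler_wpM2r // lerD2l -(real_normK (num_real x)) lerXn2r // nnegrE //.
exact: normr_ge0.
Qed.

Lemma test_derivable phi x : test_function phi -> is_derive x (1:R) phi (derive1 phi x).
Proof.
move=> [sm _]; have d := sm 0%N x; apply: (DeriveDef d).
by rewrite derive1E.
Qed.

Lemma test_derive_cont phi : test_function phi -> continuous (derive1 phi).
Proof.
move=> [sm _] x; apply: differentiable_continuous; apply/derivable1_diffP.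
exact: (sm 1%N x).
Qed.

Lemma test_cont phi : test_function phi -> continuous phi.
Proof. by move=> tp; apply: (is_derive_continuous (F' := derive1 phi)) => x; exact: test_derivable. Qed.

Lemma test_derive_support phi A : test_function phi ->
  (forall x, A < `|x| -> phi x = 0) -> forall x, A < `|x| -> derive1 phi x = 0.
Proof.
move=> tp h x xA.
have d0 : is_derive x (1:R) phi 0.
  have e0 : 0 < `|x| - A by lra.
  apply: (is_derive_locally (G := cst 0) e0) => y hy; apply: h.
  by have := ler_normD (x - y) y; rewrite subrK; lra.
by rewrite derive1E; have [] := d0.
Qed.

Lemma contM F G : continuous F -> continuous G -> continuous (fun x => F x * G x).
Proof. by move=> cF cG x; apply: cvgM; [exact: cF|exact: cG]. Qed.

Lemma test_integrable phi w : test_function phi -> continuous w ->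
  mu.-integrable setT (EFin \o (fun x => phi x * w x)) /\
  mu.-integrable setT (EFin \o (fun x => derive1 phi x * w x)).
Proof.
move=> tp cw; have [_ [A hA]] := tp.
have c1 := contM (test_cont tp) cw; have c2 := contM (test_derive_cont tp) cw.
have z1 x : A < `|x| -> phi x * w x = 0 by move=> xA; rewrite hA // mul0r.
have z2 x : A < `|x| -> derive1 phi x * w x = 0.
  by move=> xA; rewrite (test_derive_support tp hA) // mul0r.
have [M1 h1] := compact_dominated c1 z1; have [M2 h2] := compact_dominated c2 z2.
by split; [exact: dominated_integrable h1|exact: dominated_integrable h2].
Qed.

Lemma Rintegral_eventually g M c L : continuous g -> (forall x, `|g x| <= M * lorentz x) ->
  (forall x, c <= x -> lint g x = L) -> \int[mu]_x g x = L.
Proof.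
move=> cg hM gL.
apply/eqP; rewrite -subr_eq0 -normr_le0; apply/ler_addgt0Pl => e e0; rewrite addr0.
have [B hB] := vanishes_leftZ `|M| (@atan_vanishes_left R) e0.
pose x := Num.max c (- B).
have xB : - x <= B by rewrite lerNl le_max lexx orbT.
have xc : c <= x by rewrite le_max lexx.
have := Rintegral_lint x cg hM; rewrite gL // => h.
apply: (le_trans h); have := hB _ xB; rewrite atanN => h2; apply: le_trans h2.
rewrite [_ + pi / 2]addrC; apply: le_trans (ler_norm _).
by rewrite ler_wpM2r ?ler_norm // ltW // pi2_atan_gt0.
Qed.

Lemma integral_derivative_compact F f A : continuous f ->
  (forall x, is_derive x (1:R) F (f x)) ->
  (forall x, A < `|x| -> f x = 0) -> (forall x, A < `|x| -> F x = 0) ->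
  \int[mu]_x f x = 0.
Proof.
move=> cf dF f0 F0.
have [M hM] := compact_dominated cf f0.
have vF : vanishes_left F.
  move=> e e0; exists (- `|A| - 1) => x xA.
  have hx : A < `|x|.
    by have := ler_norm A; have := ler_norm (- x); rewrite normrN; lra.
  by rewrite F0 // normr0 ltW.
apply: (@Rintegral_eventually f M (`|A| + 1)) => // x xA.
rewrite -(@lint_unique R f F cf (left_dominatedW hM) dF vF x) F0 //.
by have := ler_norm A; have := ler_norm x; lra.
Qed.

Lemma test_by_parts phi F f : test_function phi -> continuous f ->
  (forall x, is_derive x (1:R) F (f x)) ->
  \int[mu]_x (derive1 phi x * F x) = - \int[mu]_x (phi x * f x).
Proof.
move=> tp cf dF; have [_ [A hA]] := tp.
have cF := is_derive_continuous dF.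
have [_ i1] := test_integrable tp cF; have [i2 _] := test_integrable tp cf.
apply/eqP; rewrite -subr_eq0 opprK -RintegralD //; apply/eqP.
apply: (@integral_derivative_compact (fun x => phi x * F x) _ A).
- move=> x; apply: cvgD; first exact: (contM (test_derive_cont tp) cF).
  exact: (contM (test_cont tp) cf).
- move=> x; have h1 := dF x; have h2 := test_derivable x tp.
  by apply: is_derive_eq; rewrite /GRing.scale /=; ring.
- by move=> x xA; rewrite hA // (test_derive_support tp hA) // !mul0r addr0.
- by move=> x xA; rewrite hA // mul0r.
Qed.

Lemma bump_dominated a c : a < c -> exists M, forall x, `|sbump a c x| <= M * lorentz x.
Proof.
move=> ac; apply: (@compact_dominated _ (`|a| + `|c|)); first exact: bump_cont.
move=> x h; apply: bump_eq0.
have [xa|ax] := leP x a; [by left|right].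
rewrite leNgt; apply/negP => xc.
have : `|x| <= `|a| + `|c|.
  rewrite ler_norml; have := ler_norm (- a); have := ler_norm c; rewrite normrN.
  have := normr_ge0 a; have := normr_ge0 c; lra.
lra.
Qed.

Section step.
Variables (a c : R).
Hypothesis ac : a < c.

(** A smooth increasing step from 0 to the mass of the bump. *)
Definition step x := lint (sbump a c) x.

Lemma step_derive x : is_derive x (1:R) step (sbump a c x).
Proof.
have [M hM] := bump_dominated ac.
exact: lint_derive (@bump_cont R a c) (left_dominatedW hM).
Qed.

Lemma step_vanish : vanishes_left step.
Proof.
have [M hM] := bump_dominated ac.
exact: lint_vanishes (@bump_cont R a c) (left_dominatedW hM).
Qed.

Lemma step_ndecr x y : x <= y -> step x <= step y.
Proof.
move=> xy; apply: (is_derive_ndecr (fun t _ => step_derive t) _ xy (lexx y)) => t _.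
exact: bump_ge0.
Qed.

Lemma step_left x : x <= a -> step x = 0.
Proof.
move=> xa; apply/eqP; rewrite -normr_le0.
apply: (@comparison_left R step (sbump a c) (fun=> 0) (fun=> 0)) => //.
- by move=> t _; exact: step_derive.
- exact: step_vanish.
- by move=> t tx; rewrite bump_eq0 ?normr0 //; left; lra.
Qed.

Lemma step_right x : c <= x -> step x = step c.
Proof.
move=> cx; apply/eqP; rewrite eq_le; apply/andP; split; last exact: step_ndecr.
rewrite -subr_ge0 -opprB oppr_ge0.
have [->|cx'] := eqVneq x c; first by rewrite subrr.
have cx2 : c < x by rewrite lt_neqAle eq_sym cx'.
have cs : {within `[c, x], continuous step}.
  by apply: continuous_subspaceT; exact: (is_derive_continuous step_derive).
have [t] := MVT cx2 (fun y _ => step_derive y) cs.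
rewrite in_itv /= => /andP[ct _] ->; rewrite bump_eq0 ?mul0r //; right; exact: ltW.
Qed.

Lemma step_gt0 : 0 < step c.
Proof.
rewrite lt_neqAle; apply/andP; split; last first.
  by rewrite -(step_left (lexx a)); apply: step_ndecr; exact: ltW.
apply/eqP => s0.
have cs : {within `[a, c], continuous step}.
  by apply: continuous_subspaceT; exact: (is_derive_continuous step_derive).
have [t] := MVT ac (fun y _ => step_derive y) cs.
rewrite in_itv /= => /andP[ta tc]; rewrite -s0 step_left // subrr => /esym/eqP.
rewrite mulf_eq0 (gt_eqF (bump_gt0 ta tc)) /= subr_eq0 => /eqP ca; lra.
Qed.

End step.

Lemma step_shift a c h x : a < c -> step (a + h) (c + h) x = step a c (x - h).
Proof.
move=> ac; have ac' : a + h < c + h by rewrite ltrD2r.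
have [M hM] := bump_dominated ac'.
apply/esym; apply: (@lint_unique R _ (fun x => step a c (x - h)) (@bump_cont R _ _) (left_dominatedW hM)).
- move=> t; have d := step_derive ac (t - h).
  have d2 : is_derive t (1:R) (fun y : R => y - h) 1.
    by apply: is_derive_eq; rewrite subr0.
  have := @is_derive1_comp R (step a c) (fun y => y - h) t _ _ d d2.
  by rewrite mulr1 -(bump_shift a c h (t - h)) subrK.
- move=> e e0; have [A hA] := step_vanish ac e0; exists (A + h) => y yA; apply: hA; lra.
Qed.

(** Outside [a, b + d] the two steps are both zero or both at their common height. *)
Lemma step_difference_eq0 a b d x : 0 < d -> a < b -> x <= a \/ b + d <= x ->
  step a (a + d) x - step b (b + d) x = 0.
Proof.
move=> d0 ab.
have ad : a < a + d by rewrite ltrDl.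
have bd : b < b + d by rewrite ltrDl.
move=> [xa|xb]; first by rewrite !step_left ?subrr //; lra.
rewrite !step_right //; last by lra.
have -> : step b (b + d) (b + d) = step (a + (b - a)) (a + d + (b - a)) (b + d).
  have -> : a + (b - a) = b by ring.
  by have -> : a + d + (b - a) = b + d by ring.
rewrite step_shift //.
have -> : b + d - (b - a) = a + d by ring.
by rewrite subrr.
Qed.

Lemma step_difference_derive a b d x : 0 < d ->
  is_derive x (1:R) (fun x => step a (a + d) x - step b (b + d) x)
    (sbump a (a + d) x - sbump b (b + d) x).
Proof.
move=> d0.
have ad : a < a + d by rewrite ltrDl.
have bd : b < b + d by rewrite ltrDl.
by have h1 := step_derive ad x; have h2 := step_derive bd x; apply: is_derive_eq.
Qed.

Lemma step_test a b d : 0 < d -> a < b ->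
  test_function (fun x => step a (a + d) x - step b (b + d) x).
Proof.
move=> d0 ab; split.
  apply: diffn_smooth => -[//|n]; exists (fun x => sbump a (a + d) x + (-1) * sbump b (b + d) x).
    by move=> x; rewrite mulN1r; exact: step_difference_derive.
  by apply: diffnD; [exact: diffn_bump|apply: diffnZ; exact: diffn_bump].
exists (`|a| + `|b| + d) => x h; apply: step_difference_eq0 => //.
have [xa|xa] := leP x a; [by left|right].
rewrite leNgt; apply/negP => xb.
have : `|x| <= `|a| + `|b| + d.
  rewrite ler_norml; have := ler_norm (- a); have := ler_norm b; rewrite normrN.
  have := normr_ge0 a; have := normr_ge0 b; lra.
lra.
Qed.

Lemma integral_bump a c : a < c -> \int[mu]_x sbump a c x = step a c c.
Proof.
move=> ac; have [M hM] := bump_dominated ac.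
by apply: (Rintegral_eventually (@bump_cont R a c) hM (c := c)) => x cx; exact: step_right.
Qed.

(** A continuous cut-off equal to 1 on [-N, N]. *)
Definition plateau (N : R) x := Num.max 0 (Num.min 1 (N + 1 - `|x|)).

Lemma plateau_cont N : continuous (plateau N).
Proof.
move=> x; apply: (@continuous_max _ _ (cst 0) (fun x => Num.min 1 (N + 1 - `|x|))); first exact: cvg_cst.
apply: (@continuous_min _ _ (cst 1) (fun x => (N + 1 - `|x|))); first exact: cvg_cst.
apply: cvgB; first exact: cvg_cst.
exact: norm_continuous.
Qed.

Lemma plateau1 N x : `|x| <= N -> plateau N x = 1.
Proof.
by move=> h; rewrite /plateau (min_idPl _) ?(max_idPr _) //; lra.
Qed.

Lemma plateau0 N x : N + 1 < `|x| -> plateau N x = 0.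
Proof.
move=> h; rewrite /plateau (max_idPl _) // ge_min; apply/orP; right; lra.
Qed.

(** The derivative of the difference of two steps is a bump at a minus a bump at b
    of equal mass, so testing compares averages of v near a and near b. *)
Lemma weak_zero_le N v a b : continuous v ->
  (forall phi, test_function phi -> (forall x, N < `|x| -> phi x = 0) ->
     \int[mu]_x (derive1 phi x * v x) = 0) ->
  - N < a -> a < b -> b < N -> v a <= v b.
Proof.
move=> cv hv Na ab bN; rewrite leNgt; apply/negP => vab.
pose e := (v a - v b) / 3.
have e0 : 0 < e by rewrite /e; lra.
have /cvgrPdist_lt /(_ e e0) [d1 /= d10 near_a] := cv a.
have /cvgrPdist_lt /(_ e e0) [d2 /= d20 near_b] := cv b.
have [d [d0 dd1 dd2 dN]] : exists d, [/\ 0 < d, d < d1, d < d2 & b + d < N].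
  have h1 : Num.min (Num.min d1 d2) (N - b) <= d1 by rewrite !ge_min lexx.
  have h2 : Num.min (Num.min d1 d2) (N - b) <= d2 by rewrite !ge_min lexx orbT.
  have h3 : Num.min (Num.min d1 d2) (N - b) <= N - b by rewrite !ge_min lexx orbT.
  have h4 : 0 < Num.min (Num.min d1 d2) (N - b) by rewrite !lt_min d10 d20 subr_gt0.
  by exists (Num.min (Num.min d1 d2) (N - b) / 2); clear -h1 h2 h3 h4; split; lra.
have ad : a < a + d by rewrite ltrDl.
have bd : b < b + d by rewrite ltrDl.
have tp := step_test d0 ab.
have p0 x : N < `|x| -> step a (a + d) x - step b (b + d) x = 0.
  move=> Nx; apply: step_difference_eq0 => //.
  have [xa|xa] := leP x a; [by left|right].
  rewrite leNgt; apply/negP => xb.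
  suff : `|x| <= N by rewrite leNgt Nx.
  by rewrite ler_norml; clear -Na xa xb dN; lra.
set phi := (fun x => _) in tp.
have dphi x : derive1 phi x = sbump a (a + d) x - sbump b (b + d) x.
  by rewrite derive1E; have [_ ->] := @step_difference_derive a b d x d0.
have [Ma hMa] := bump_dominated ad; have [Mb hMb] := bump_dominated bd.
have ia := dominated_integrable (@bump_cont R _ _) hMa.
have ib := dominated_integrable (@bump_cont R _ _) hMb.
have Iab : step b (b + d) (b + d) = step a (a + d) (a + d).
  have abd : a + d <= b + d by rewrite lerD2r ltW.
  apply/eqP; rewrite eq_sym -subr_eq0 -(step_right ad abd).
  by apply/eqP; apply: step_difference_eq0 => //; right.
have I0 := step_gt0 ad.
have [_ iv] := test_integrable tp cv.
have tot : \int[mu]_x (derive1 phi x * v x + (- (v a - e) * sbump a (a + d) x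
    + (v b + e) * sbump b (b + d) x)) = - e * step a (a + d) (a + d).
  have i2 := integrable_scale (- (v a - e)) measurableT ia.
  have i3 := integrable_scale (v b + e) measurableT ib.
  rewrite (RintegralD measurableT iv (integrable_add measurableT i2 i3)) (RintegralD measurableT i2 i3).
  rewrite (RintegralZl _ measurableT ia) (RintegralZl _ measurableT ib) (hv _ tp p0) !integral_bump // Iab.
  by rewrite /e; field.
have supp c x : ~ (c < x /\ x < c + d) -> sbump c (c + d) x = 0.
  move=> h; apply: bump_eq0; have [xc|xc] := leP x c; [by left|right].
  by rewrite leNgt; apply/negP => xd; apply: h.
have : 0 <= \int[mu]_x (derive1 phi x * v x + (- (v a - e) * sbump a (a + d) x
    + (v b + e) * sbump b (b + d) x)).
  apply: Rintegral_ge0 => x _; rewrite dphi.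
  have ka : 0 <= sbump a (a + d) x * (v x - (v a - e)).
    have [[h1 h2]|h] := pselect (a < x /\ x < a + d); last by rewrite supp // mul0r.
    apply: mulr_ge0 (bump_ge0 _ _ _) _.
    have xd : `|a - x| < d1 by rewrite ltr_norml; clear -h1 h2 dd1 d0; lra.
    have := near_a x xd; rewrite ltr_norml => /andP[n1 n2].
    by clear -n1 n2; lra.
  have kb : 0 <= sbump b (b + d) x * (v b + e - v x).
    have [[h1 h2]|h] := pselect (b < x /\ x < b + d); last by rewrite supp // mul0r.
    apply: mulr_ge0 (bump_ge0 _ _ _) _.
    have xd : `|b - x| < d2 by rewrite ltr_norml; clear -h1 h2 dd2 d0; lra.
    have := near_b x xd; rewrite ltr_norml => /andP[n1 n2].
    by clear -n1 n2; lra.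
  by clear -ka kb; lra.
by rewrite tot; have h := mulr_gt0 e0 I0; clear -h; lra.
Qed.

(** The difference of w and a primitive of k, cut off far away, has weak
    derivative zero on an interval; [weak_zero_le] for v and - v makes it
    constant there. *)
Lemma du_bois_reymond w k : continuous w -> continuous k ->
  (forall phi, test_function phi ->
     \int[mu]_x (derive1 phi x * w x) = - \int[mu]_x (phi x * k x)) ->
  forall x, is_derive x (1:R) w (k x).
Proof.
move=> cw ck hw x0.
pose N := `|x0| + 2.
pose kN x := plateau N x * k x.
have ckN : continuous kN by apply: contM => //; exact: plateau_cont.
have kN0 x : N + 1 < `|x| -> kN x = 0 by move=> h; rewrite /kN plateau0 // mul0r.
have [M hM] := compact_dominated ckN kN0.
pose F := lint kN.
have dF x : is_derive x (1:R) F (kN x) by exact: lint_derive ckN (left_dominatedW hM).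
have cF := is_derive_continuous dF.
pose v x := w x - F x.
have cv : continuous v by move=> x; apply: cvgB; [exact: cw|exact: cF].
have hv phi : test_function phi -> (forall x, N < `|x| -> phi x = 0) ->
    \int[mu]_x (derive1 phi x * v x) = 0.
  move=> tp p0.
  have [_ iw] := test_integrable tp cw; have [_ iF] := test_integrable tp cF.
  rewrite (_ : (fun x => _) = fun x => derive1 phi x * w x - derive1 phi x * F x); last first.
    by apply/funext => x; rewrite mulrBr.
  rewrite RintegralB // hw // (test_by_parts tp ckN dF) opprK addrC.
  apply/eqP; rewrite subr_eq0; apply/eqP; apply: eq_Rintegral => x _.
  have [h|h] := leP `|x| N; first by rewrite /kN plateau1 // mul1r.
  by rewrite p0 // !mul0r.
have hv' phi : test_function phi -> (forall x, N < `|x| -> phi x = 0) ->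
    \int[mu]_x (derive1 phi x * - v x) = 0.
  move=> tp p0; have [_ iv] := test_integrable tp cv.
  rewrite (_ : (fun x => _) = fun x => -1 * (derive1 phi x * v x)); last first.
    by apply/funext => x; rewrite mulN1r mulrN.
  by rewrite (RintegralZl _ measurableT iv) (hv _ tp p0) mulr0.
have cv' : continuous (fun x => - v x) by move=> x; apply: cvgN; exact: cv.
have vcst a b : - N < a -> a < b -> b < N -> v a = v b.
  move=> h1 h2 h3; apply/eqP; rewrite eq_le (weak_zero_le cv hv h1 h2 h3) /=.
  by rewrite -lerN2; exact: weak_zero_le cv' hv' h1 h2 h3.
have dv : is_derive x0 (1:R) v 0.
  apply: (is_derive_locally (G := cst (v x0)) ltr01) => y.
  rewrite ltr_norml => /andP[b1 b2].
  have a1 := ler_norm x0; have a2 := ler_norm (- x0); rewrite normrN in a2.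
  have [h|h|->//] := ltgtP y x0.
    by apply: vcst => //; rewrite /N; clear -a1 a2 b1 b2 h; lra.
  by apply/esym; apply: vcst => //; rewrite /N; clear -a1 a2 b1 b2 h; lra.
rewrite (_ : w = fun x => v x + F x); last by apply/funext => x; rewrite /v subrK.
have -> : k x0 = kN x0 by rewrite /kN plateau1 ?mul1r //; rewrite /N lerDl.
by have d1 := dF x0; apply: is_derive_eq; rewrite add0r.
Qed.

End weak_derivatives.

(** * The resolvent *)

Section resolvent.
Variable R : realType.
Implicit Types (q g h a b u v r : R -> R[i]) (x X s M C : R) (z w m l lam : R[i]).
Local Notation mu := (@lebesgue_measure R).

Lemma normc_lt_re (z : R[i]) (e : R) : `|z| < e%:C -> `|Re z| < e /\ `|Im z| < e.
Proof.
rewrite -[`|z|]/((ComplexField.Normc.normc z)%:C) ltcR; case: z => a b /= h.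
split; apply: le_lt_trans h; rewrite -sqrtr_sqr ler_sqrt ?addr_ge0 ?sqr_ge0 //.
  by rewrite lerDl sqr_ge0.
by rewrite lerDr sqr_ge0.
Qed.

(** The norm on columns induces the product topology. *)
Lemma cvg_colP (T : Type) (F : set_system T) (FF : Filter F) (v : T -> 'cV[R[i]]_2) (l : 'cV[R[i]]_2) :
  ((v x : 'cV[R[i]^o]_2) @[x --> F] --> (l : 'cV[R[i]^o]_2)) <->
  forall k : 'I_2, (Re (v x k 0) @[x --> F] --> Re (l k 0)) /\ (Im (v x k 0) @[x --> F] --> Im (l k 0)).
Proof.
split.
  move=> h k.
  have key (e : R) : 0 < e -> \forall x \near F, `|l k 0 - v x k 0| < e%:C.
    move=> e0.
    have e0' : 0 < e%:C by rewrite ltcR.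
    have /cvg_ballP /(_ _ e0') := h.
    apply: filterS => x [_ hb].
    by have := hb k 0; rewrite -ball_normE.
  split; apply/cvgrPdist_lt => e e0; apply: filterS (key e e0) => x hx.
    by have [hre _] := normc_lt_re hx; rewrite !reim in hre.
  by have [_ him] := normc_lt_re hx; rewrite !reim in him.
move=> h; apply/cvg_ballP => eps eps0.
have [e e0 ->] : exists2 e : R, 0 < e & eps = e%:C.
  move: eps0; rewrite ltcE => /andP[/eqP im re]; exists (Re eps) => //.
  by apply: complexP => //=.
have e3 : 0 < e / 3 by lra.
have nk (k : 'I_2) : \forall x \near F, `|l k 0 - v x k 0| < e%:C.
  have [/cvgrPdist_lt /(_ _ e3) hr /cvgrPdist_lt /(_ _ e3) hi] := h k.
  apply: filterS2 hr hi => x a b.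
  apply: (le_lt_trans (normc_le_cn _)); rewrite ltcR /cn !reim; lra.
apply: filterS2 (nk 0) (nk 1) => x h0 h1; split; first by rewrite ltcR.
move=> i j; rewrite (ord1 j) -ball_normE /=.
by have [->|->] := ord2P i.
Qed.

Lemma vcontinuousP (u : R -> 'cV[R[i]]_2) : vcontinuous u <-> forall k, ccont (fun x => u x k 0).
Proof.
split=> h.
  by move=> k; split=> x; have := (cvg_colP _ _ _).1 (h x) k => -[].
by move=> x; apply/cvg_colP => k; have [a b] := h k; split; [exact: a|exact: b].
Qed.

Definition col2 z w : 'cV[R[i]]_2 := \col_(k < 2) if k == 0 then z else w.

Lemma col20 z w : col2 z w 0 0 = z. Proof. by rewrite mxE. Qed.
Lemma col21 z w : col2 z w 1 0 = w. Proof. by rewrite mxE. Qed.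

(** The source of the resolvent equation that corresponds to f in [is_sol]. *)
Definition isig (f : R -> 'cV[R[i]]_2) := fun y : R => 'i%C *: (sigma3 R *m f y).

Lemma sigma3_mul (v : 'cV[R[i]]_2) : (sigma3 R *m v) 0 0 = v 0 0 /\ (sigma3 R *m v) 1 0 = - v 1 0.
Proof. by rewrite /sigma3 !diag2_mul /= mul1r mulN1r. Qed.

Lemma isig0 f y : isig f y 0 0 = 'i%C * f y 0 0.
Proof. by rewrite mxE (sigma3_mul _).1. Qed.
Lemma isig1 f y : isig f y 1 0 = - ('i%C * f y 1 0).
Proof. by rewrite mxE (sigma3_mul _).2 mulrN. Qed.

Lemma cdom_vL2 M (u : R -> 'cV[R[i]]_2) : (forall k, cdom M (fun x => u x k 0)) -> vL2 u.
Proof.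
move=> h k; have [[c1 c2] uM] := h k; split.
  exact: (@dominated_L2 R _ M c1 (fun x => le_trans (Re_le_cn _) (uM x))).
exact: (@dominated_L2 R _ M c2 (fun x => le_trans (Im_le_cn _) (uM x))).
Qed.

Lemma re_scale (p : R) (z : R[i]) : Re (p%:C * z) = p * Re z.
Proof. by rewrite reim /= mul0r subr0. Qed.
Lemma im_scale (p : R) (z : R[i]) : Im (p%:C * z) = p * Im z.
Proof. by rewrite reim /= mul0r addr0. Qed.

Lemma weak_derivativeP (u v : R -> 'cV[R[i]]_2) : weak_derivative u v <->
  forall phi, test_function phi -> forall k : 'I_2,
    (\int[mu]_x (derive1 phi x * Re (u x k 0)) = - \int[mu]_x (phi x * Re (v x k 0))) /\
    (\int[mu]_x (derive1 phi x * Im (u x k 0)) = - \int[mu]_x (phi x * Im (v x k 0))).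
Proof.
have E (p : R -> R) (y : R -> 'cV[R[i]]_2) (k : 'I_2) :
    vintegral setT (fun x => (p x)%:C *: y x) k 0 =
    (\int[mu]_x (p x * Re (y x k 0))) +i* (\int[mu]_x (p x * Im (y x k 0))).
  rewrite mxE /cintegral; congr (_ +i* _); apply: eq_Rintegral => x _; rewrite mxE.
    exact: re_scale.
  exact: im_scale.
split=> h phi tp.
  move=> k; have := congr1 (fun y : 'cV[R[i]]_2 => y k 0) (h phi tp).
  rewrite /= E => /esym; rewrite mxE E => e.
  have /= e1 := congr1 (@complex.Re R) e; have /= e2 := congr1 (@complex.Im R) e.
  by rewrite -e1 -e2.
apply/matrixP => k j; rewrite (ord1 j) E [RHS]mxE E.
by have [-> ->] := h phi tp k.
Qed.

(** Entries of T u when v is the derivative of u. *)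
Lemma opT_entries q x (v u : 'cV[R[i]]_2) :
  let w := 'i%C *: (sigma3 R *m v) - 'i%C *: (sigma3 R *m Qmx q x *m u) in
  w 0 0 = 'i%C * (v 0 0 - q x * u 1 0) /\ w 1 0 = - ('i%C * (v 1 0 - (q x)^* * u 0 0)).
Proof.
have n0 (s t : 'cV[R[i]]_2) (k : 'I_2) : ('i%C *: s - 'i%C *: t) k 0 = 'i%C * s k 0 - 'i%C * t k 0.
  by rewrite !mxE.
rewrite /= !n0 -!mulmxA (sigma3_mul v).1 (sigma3_mul v).2 !(sigma3_mul (Qmx q x *m u)).1
  (sigma3_mul (Qmx q x *m u)).2 Qmx_mul0 Qmx_mul1; split; ring.
Qed.

Lemma is_sol_graph C q z (f : R -> 'cV[R[i]]_2) u1 u2 M M' : qdom C q ->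
  (forall k, cdom M (fun x => f x k 0)) ->
  is_sol q z (fun x => f x 0 0) (fun x => f x 1 0) u1 u2 -> cdom M' u1 -> cdom M' u2 ->
  exists2 w, opT_graph q (fun x => col2 (u1 x) (u2 x)) w &
    {ae mu, forall x, w x - z *: col2 (u1 x) (u2 x) = isig f x}.
Proof.
move=> dq df [d1 d2] b1 b2.
pose v1 x := - ('i%C * z) * u1 x + q x * u2 x + f x 0 0.
pose v2 x := (q x)^* * u1 x + 'i%C * z * u2 x + f x 1 0.
pose U x := col2 (u1 x) (u2 x); pose V x := col2 (v1 x) (v2 x).
pose w x := 'i%C *: (sigma3 R *m V x) - 'i%C *: (sigma3 R *m Qmx q x *m U x).
have [C0 cq _] := dq.
have qC x : cn (q x) <= C.
  by apply: (le_trans (qdom_le x dq)); rewrite ger_pMr // lorentz_le1.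
have qC' x : cn ((q x)^*) <= C by rewrite cnC.
have [K kV1] : exists K, cdom K v1.
  eexists; apply: cdomD (df 0); apply: cdomD; first exact: (cdomZ _ b1).
  exact: (cdomM cq qC b2).
have [K' kV2] : exists K, cdom K v2.
  eexists; apply: cdomD (df 1); apply: cdomD; last exact: (cdomZ _ b2).
  exact: (cdomM (ccontC cq) qC' b1).
exists w; last first.
  apply: aeW => x; have [w0 w1] := opT_entries q x (V x) (U x).
  have n0 (y : 'cV[R[i]]_2) (k : 'I_2) : (y - z *: col2 (u1 x) (u2 x)) k 0 = y k 0 - z * col2 (u1 x) (u2 x) k 0.
    by rewrite !mxE.
  apply: col2P; rewrite n0 ?w0 ?w1 /U /V !col20 !col21 ?isig0 ?isig1 /v1 /v2.
    have i2 : 'i%C * 'i%C = -1 :> R[i] by rewrite -expr2 sqr_i.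
    transitivity (- ('i%C * 'i%C) * z * u1 x + 'i%C * f x 0 0 - z * u1 x); first by ring.
    by rewrite i2; ring.
  have i2 : 'i%C * 'i%C = -1 :> R[i] by rewrite -expr2 sqr_i.
  transitivity (- ('i%C * 'i%C) * z * u2 x - 'i%C * f x 1 0 - z * u2 x); first by ring.
  by rewrite i2; ring.
exists V; last by exact: aeW.
split.
- by apply/vcontinuousP => k; have [->|->] := ord2P k;
    [apply: ccont_ext (proj1 b1)|apply: ccont_ext (proj1 b2)] => x; rewrite ?col20 ?col21.
- apply: (@cdom_vL2 M') => k; have [->|->] := ord2P k.
    by rewrite (_ : (fun x => _) = u1) //; apply/funext => x; rewrite col20.
  by rewrite (_ : (fun x => _) = u2) //; apply/funext => x; rewrite col21.
- apply: (@cdom_vL2 (Num.max K K')) => k; have [->|->] := ord2P k.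
    rewrite (_ : (fun x => _) = v1); last by apply/funext => x; rewrite col20.
    by apply: cdom_le kV1; rewrite le_max lexx.
  rewrite (_ : (fun x => _) = v2); last by apply/funext => x; rewrite col21.
  by apply: cdom_le kV2; rewrite le_max lexx orbT.
apply/weak_derivativeP => phi tp k.
have [->|->] := ord2P k; split.
- under eq_Rintegral do rewrite col20; under [X in - X]eq_Rintegral do rewrite col20.
  apply: test_by_parts => //; first by have [[]] := kV1.
  by move=> x; have [] := d1 x.
- under eq_Rintegral do rewrite col20; under [X in - X]eq_Rintegral do rewrite col20.
  apply: test_by_parts => //; first by have [[]] := kV1.
  by move=> x; have [] := d1 x.
- under eq_Rintegral do rewrite col21; under [X in - X]eq_Rintegral do rewrite col21.
  apply: test_by_parts => //; first by have [[]] := kV2.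
  by move=> x; have [] := d2 x.
- under eq_Rintegral do rewrite col21; under [X in - X]eq_Rintegral do rewrite col21.
  apply: test_by_parts => //; first by have [[]] := kV2.
  by move=> x; have [] := d2 x.
Qed.

End resolvent.

Section resolvent_unique.
Variable R : realType.
Implicit Types (q g h a b u v r : R -> R[i]) (x X s M C : R) (z w m l lam : R[i]).
Local Notation mu := (@lebesgue_measure R).

Let aeF := ae_filter_ringOfSetsType mu.

Lemma ae_mono (P Q : R -> Prop) : (forall x, P x -> Q x) ->
  {ae mu, forall x, P x} -> {ae mu, forall x, Q x}.
Proof. by move=> h; exact: (@filterS _ _ aeF). Qed.

Lemma ae_mono2 (P Q S : R -> Prop) : (forall x, P x -> Q x -> S x) ->
  {ae mu, forall x, P x} -> {ae mu, forall x, Q x} -> {ae mu, forall x, S x}.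
Proof. by move=> h; exact: (@filterS2 _ _ aeF). Qed.

Lemma Lfun_measurable (F : R -> R) : F \in Lfun mu 2%:E ->
  measurable_fun [set: measurableTypeR R] F.
Proof. by move=> /sub_Lfun_mfun; rewrite inE. Qed.

(** An H^1 function whose weak derivative agrees almost everywhere with a
    continuous function is classically differentiable. *)
Lemma weak_derivative_cont (u v : R -> 'cV[R[i]]_2) (k : R -> 'cV[R[i]]_2) :
  H1_derivative u v -> (forall j, ccont (fun x => k x j 0)) ->
  {ae mu, forall x, v x = k x} -> forall j x, cderive (fun x => u x j 0) x (k x j 0).
Proof.
move=> [/vcontinuousP cu _ lv /weak_derivativeP wd] ck ae.
have key phi (F G : R -> R) : test_function phi -> measurable_fun [set: measurableTypeR R] F -> continuous G ->
    {ae mu, forall x, F x = G x} -> \int[mu]_x (phi x * F x) = \int[mu]_x (phi x * G x).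
  move=> tp mF cG FG; congr fine; apply: ae_eq_integral => //.
  - apply/measurable_EFinP; apply: measurable_funM => //.
    by apply: continuous_measurable_fun; exact: test_cont.
  - apply/measurable_EFinP; apply: continuous_measurable_fun.
    exact: contM (test_cont tp) cG.
  - by apply: ae_mono FG => x e _; rewrite /= e.
move=> j x; split.
  apply: (@du_bois_reymond R (fun x => Re (u x j 0)) (fun x => Re (k x j 0))).
  - by have [] := cu j.
  - by have [] := ck j.
  move=> phi tp; have [-> _] := wd phi tp j; congr (- _).
  apply: key => //; first by apply: Lfun_measurable; have [] := lv j.
    by have [] := ck j.
  by apply: ae_mono ae => y ->.
apply: (@du_bois_reymond R (fun x => Im (u x j 0)) (fun x => Im (k x j 0))).
- by have [] := cu j.
- by have [] := ck j.
move=> phi tp; have [_ ->] := wd phi tp j; congr (- _).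
apply: key => //; first by apply: Lfun_measurable; have [] := lv j.
  by have [] := ck j.
by apply: ae_mono ae => y ->.
Qed.

(** The equation determines v almost everywhere as a continuous expression in u. *)
Lemma graph_is_sol q z (f u : R -> 'cV[R[i]]_2) :
  ccont q -> (forall k, ccont (fun x => f x k 0)) ->
  (exists2 w, opT_graph q u w & {ae mu, forall x, w x - z *: u x = isig f x}) ->
  is_sol q z (fun x => f x 0 0) (fun x => f x 1 0) (fun x => u x 0 0) (fun x => u x 1 0) /\ vL2 u.
Proof.
move=> cq cf [w [v H wv] wf].
have [/vcontinuousP cu l2 _ _] := H.
split=> //.
pose k x := col2 (- ('i%C * z) * u x 0 0 + q x * u x 1 0 + f x 0 0)
   ((q x)^* * u x 0 0 + 'i%C * z * u x 1 0 + f x 1 0).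
have ck j : ccont (fun x => k x j 0).
  have [->|->] := ord2P j.
    rewrite (_ : (fun x => _) = fun x => - ('i%C * z) * u x 0 0 + q x * u x 1 0 + f x 0 0); last first.
      by apply/funext => x; rewrite col20.
    by apply: ccontD (cf 0); apply: ccontD; [exact: ccontZ|exact: ccontM].
  rewrite (_ : (fun x => _) = fun x => (q x)^* * u x 0 0 + 'i%C * z * u x 1 0 + f x 1 0); last first.
    by apply/funext => x; rewrite col21.
  apply: ccontD (cf 1); apply: ccontD; [|exact: ccontZ].
  by apply: ccontM => //; exact: ccontC.
have vk : {ae mu, forall x, v x = k x}.
  apply: ae_mono2 wv wf => x -> /[dup] /(congr1 (fun y : 'cV[R[i]]_2 => y 0 0)) /= e0
    /(congr1 (fun y : 'cV[R[i]]_2 => y 1 0)) /= e1.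
  have [w0 w1] := opT_entries q x (v x) (u x).
  have n0 (y : 'cV[R[i]]_2) (j : 'I_2) : (y - z *: u x) j 0 = y j 0 - z * u x j 0.
    by rewrite !mxE.
  have i2 : 'i%C * 'i%C = -1 :> R[i] by rewrite -expr2 sqr_i.
  rewrite n0 w0 isig0 in e0; rewrite n0 w1 isig1 in e1.
  apply: col2P; rewrite ?col20 ?col21.
    have -> : v x 0 0 = - ('i%C * 'i%C) * v x 0 0 by rewrite i2; ring.
    have -> : - ('i%C * 'i%C) * v x 0 0 =
      - 'i%C * ('i%C * (v x 0 0 - q x * u x 1 0) - z * u x 0 0) - 'i%C * z * u x 0 0
       - ('i%C * 'i%C) * q x * u x 1 0 by ring.
    rewrite e0; transitivity (- ('i%C * 'i%C) * f x 0 0 - 'i%C * z * u x 0 0 - ('i%C * 'i%C) * q x * u x 1 0); first by ring.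
    by rewrite i2; ring.
  have -> : v x 1 0 = - ('i%C * 'i%C) * v x 1 0 by rewrite i2; ring.
  have -> : - ('i%C * 'i%C) * v x 1 0 =
      'i%C * (- ('i%C * (v x 1 0 - (q x)^* * u x 0 0)) - z * u x 1 0) + 'i%C * z * u x 1 0
       - ('i%C * 'i%C) * (q x)^* * u x 0 0 by ring.
  rewrite e1; transitivity (- ('i%C * 'i%C) * f x 1 0 + 'i%C * z * u x 1 0 - ('i%C * 'i%C) * (q x)^* * u x 0 0); first by ring.
  by rewrite i2; ring.
have d := weak_derivative_cont H ck vk.
by split=> x; [apply: cderive_eq (d 0 x) _; rewrite col20|apply: cderive_eq (d 1 x) _; rewrite col21].
Qed.

Lemma vL2_sqn (u : R -> 'cV[R[i]]_2) k : vL2 u ->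
  mu.-integrable setT (EFin \o (fun x => sqn (u x k 0))).
Proof.
move=> l2; have [a b] := l2 k.
exact: (integrable_add _ (Lfun2_integrable_sqr a) (Lfun2_integrable_sqr b)).
Qed.

Lemma sqn_integrableB u v : ccont u -> ccont v ->
  mu.-integrable setT (EFin \o (fun x => sqn (u x))) ->
  mu.-integrable setT (EFin \o (fun x => sqn (v x))) ->
  mu.-integrable setT (EFin \o (fun x => sqn (u x + -1 * v x))).
Proof.
move=> cu cv iu iv.
have i2 : mu.-integrable setT (EFin \o (fun x => 2 * sqn (u x) + 2 * sqn (v x))).
  by apply: integrable_add => //; exact: integrable_scale.
have [c1 c2] := ccontD cu (ccontZ (-1) cv).
apply: le_integrable i2 => //.
  apply/measurable_EFinP; apply: measurable_funD; apply: measurable_funX;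
    exact: continuous_measurable_fun.
move=> x _; rewrite /= lee_fin ger0_norm ?sqn_ge0 // ger0_norm; last first.
  by apply: addr_ge0; apply: mulr_ge0; rewrite ?sqn_ge0.
rewrite /sqn !reim /=.
have := sqr_ge0 (Re (u x) + Re (v x)); have := sqr_ge0 (Im (u x) + Im (v x)).
lra.
Qed.

(** Existence of an element of the graph is [is_sol_graph]; uniqueness holds since
    the difference of two elements is a square-integrable homogeneous solution. *)
Theorem resolventE C q z (f : R -> 'cV[R[i]]_2) u1 u2 M M' : qdom C q -> Im z != 0 ->
  (forall k, cdom M (fun x => f x k 0)) ->
  is_sol q z (fun x => f x 0 0) (fun x => f x 1 0) u1 u2 -> cdom M' u1 -> cdom M' u2 ->
  forall x, resolvent q z (isig f) x = col2 (u1 x) (u2 x).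
Proof.
move=> dq z0 df su b1 b2.
have G := is_sol_graph dq df su b1 b2.
rewrite /resolvent; set S := [set u | _].
have Sx : S (xget (fun=> 0) S) by apply: xgetPex; exists (fun x => col2 (u1 x) (u2 x)).
set r := xget _ S in Sx *.
have [_ cq _] := dq.
have [sr l2] := graph_is_sol cq (fun k => proj1 (df k)) Sx.
have s := is_sol_combine (-1) sr su.
have cr j : ccont (fun x => r x j 0).
  have [->|->] := ord2P j; first exact: cderive_cont (proj1 sr).
  exact: cderive_cont (proj2 sr).
have s0 : is_sol q z (fun=> 0) (fun=> 0) (fun x => r x 0 0 + -1 * u1 x) (fun x => r x 1 0 + -1 * u2 x).
  by apply: is_sol_ext s => y; ring.
have h := homogeneous_L2_eq0 z0 s0
  (sqn_integrableB (cr 0) (proj1 b1) (vL2_sqn 0 l2) (sqn_integrable b1))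
  (sqn_integrableB (cr 1) (proj1 b2) (vL2_sqn 1 l2) (sqn_integrable b2)).
move=> x; have [h1 h2] := h x.
by apply: col2P; rewrite ?col20 ?col21; apply/eqP; rewrite -subr_eq0 -mulN1r; apply/eqP.
Qed.

End resolvent_unique.

(** * Dependence on the spectral parameter *)

Section solution_operator.
Variable R : realType.
Implicit Types (q f g h a b u v r : R -> R[i]) (x X s M C : R) (z w m l lam : R[i]).

(** A choice of the decaying solution as a total function of z and the source. *)
Definition usol q z f1 f2 : (R -> R[i]) * (R -> R[i]) :=
  xget (fun=> 0, fun=> 0) [set u | is_sol q z f1 f2 u.1 u.2 /\ exists M, cdom M u.1 /\ cdom M u.2].

Definition bnd C : R := 32 * pi * jB C ^+ 2.

Lemma usol_unique q z f1 f2 u1 u2 M : Im z != 0 -> is_sol q z f1 f2 u1 u2 ->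
  cdom M u1 -> cdom M u2 -> usol q z f1 f2 = (u1, u2).
Proof.
move=> z0 su b1 b2.
have : [set u | is_sol q z f1 f2 u.1 u.2 /\ exists M, cdom M u.1 /\ cdom M u.2] (usol q z f1 f2).
  by apply: xgetPex; exists (u1, u2); split => //; exists M.
move=> [sv [M' [c1 c2]]].
have h := is_sol_unique z0 sv su (cdom_le (M' := Num.max M M') _ c1) (cdom_le (M' := Num.max M M') _ c2)
  (cdom_le (M' := Num.max M M') _ b1) (cdom_le (M' := Num.max M M') _ b2).
rewrite !le_max !lexx !orbT in h; have {}h := h isT isT isT isT.
rewrite [LHS]surjective_pairing; congr (_, _); apply/funext => x; by have [] := h x.
Qed.

Lemma usol_spec C q (e0 : R) : qdom C q -> 0 < e0 -> exists2 K, 0 <= K &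
  forall z M f1 f2, e0 <= Im z -> cdom M f1 -> cdom M f2 ->
    [/\ is_sol q z f1 f2 (usol q z f1 f2).1 (usol q z f1 f2).2,
        cdom (K * M) (usol q z f1 f2).1, cdom (K * M) (usol q z f1 f2).2 &
        forall x, cn ((usol q z f1 f2).1 x) <= bnd C * M /\ cn ((usol q z f1 f2).2 x) <= bnd C * M].
Proof.
move=> dq e00; have [K K0 hK] := green_exists dq e00; exists K => // z M f1 f2 ez d1 d2.
have [u1 [u2 [su b1 b2 bb]]] := hK z M f1 f2 ez d1 d2.
by rewrite (usol_unique _ su b1 b2) // gt_eqF //; lra.
Qed.

Lemma usol_dom C q z M f1 f2 : qdom C q -> 0 < Im z -> cdom M f1 -> cdom M f2 ->
  [/\ is_sol q z f1 f2 (usol q z f1 f2).1 (usol q z f1 f2).2,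
      exists M', cdom M' (usol q z f1 f2).1 /\ cdom M' (usol q z f1 f2).2 &
      forall x, cn ((usol q z f1 f2).1 x) <= bnd C * M /\ cn ((usol q z f1 f2).2 x) <= bnd C * M].
Proof.
move=> dq z0 d1 d2; have [K K0 hK] := usol_spec dq z0.
by have [s1 s2 s3 s4] := hK z M f1 f2 (lexx _) d1 d2; split=> //; exists (K * M).
Qed.

(** The first resolvent identity. In terms of the sources of [is_sol], u itself
    corresponds to the source - i sigma_3 u. *)
Lemma usol_identity C q z w M f1 f2 : qdom C q -> 0 < Im z -> 0 < Im w -> cdom M f1 -> cdom M f2 ->
  let u := usol q z f1 f2 in let s := usol q w u.1 (fun x => - u.2 x) in
  forall x, (usol q w f1 f2).1 x = u.1 x + (- ('i%C * (w - z))) * s.1 x /\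
            (usol q w f1 f2).2 x = u.2 x + (- ('i%C * (w - z))) * s.2 x.
Proof.
move=> dq z0 w0 d1 d2 u s.
have [su [M1 [b1 b2]] _] := usol_dom dq z0 d1 d2; rewrite -/u in su b1 b2.
have b2' : cdom M1 (fun x => - u.2 x).
  by have [c2 h2] := b2; split; [exact: ccontN|move=> x; rewrite cnN].
have [ss [M2 [e1 e2]] _] := usol_dom dq w0 b1 b2'; rewrite -/s in ss e1 e2.
have su' : is_sol q w (fun x => f1 x + 'i%C * (w - z) * u.1 x) (fun x => f2 x - 'i%C * (w - z) * u.2 x) u.1 u.2.
  have [h1 h2] := su; split => x; first by apply: cderive_eq (h1 x) _; ring.
  by apply: cderive_eq (h2 x) _; ring.
have S := is_sol_combine (- ('i%C * (w - z))) su' ss.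
have S' : is_sol q w f1 f2 (fun x => u.1 x + (- ('i%C * (w - z))) * s.1 x)
   (fun x => u.2 x + (- ('i%C * (w - z))) * s.2 x).
  by apply: is_sol_ext S => x; ring.
have k1 := cdomD b1 (cdomZ (- ('i%C * (w - z))) e1).
have k2 := cdomD b2 (cdomZ (- ('i%C * (w - z))) e2).
by move=> x; rewrite (usol_unique _ S' k1 k2) // gt_eqF.
Qed.

(** The expansion point - i lies in the lower half-plane, so that this factor is
    analytic where the resolvent is expanded. *)
Definition kap z : R[i] := (z + 'i%C)^-1.

Lemma kapE z : 0 < Im z -> kap z * (z + 'i%C) = 1.
Proof.
move=> z0; rewrite mulVf //; apply/eqP => h.
have h2 : Im (z + 'i%C) = 0 by rewrite h.
by move: h2; rewrite reim /=; lra.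
Qed.

Definition C1dom M f f' := [/\ forall x, cderive f x (f' x), cdom M f & cdom M f'].

(** With g = i sigma_3 f, the vector (T + i) g equals i sigma_3 h for h = (hat1, hat2). *)
Definition hat1 q f1 f2 f1' (x : R) : R[i] := 'i%C * f1' x + 'i%C * q x * f2 x + 'i%C * f1 x.
Definition hat2 q f1 f2 f2' (x : R) : R[i] := - 'i%C * f2' x - 'i%C * (q x)^* * f1 x + 'i%C * f2 x.

Lemma qdom_bound C q x : qdom C q -> cn (q x) <= C.
Proof.
move=> dq; apply: (le_trans (qdom_le x dq)).
by rewrite ger_pMr ?lorentz_le1 //; case: dq.
Qed.

Lemma hat_dom C q M f1 f2 f1' f2' : qdom C q -> C1dom M f1 f1' -> C1dom M f2 f2' ->
  cdom ((2 + C) * M) (hat1 q f1 f2 f1') /\ cdom ((2 + C) * M) (hat2 q f1 f2 f2').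
Proof.
move=> dq [_ d1 d1'] [_ d2 d2']; have [_ cq _] := dq.
have iZ f : cdom M f -> cdom M (fun x => 'i%C * f x).
  by move=> d; have := cdomZ 'i%C d; rewrite cni mul1r.
have NiZ f : cdom M f -> cdom M (fun x => - 'i%C * f x).
  by move=> d; have := cdomZ (- 'i%C) d; rewrite cnN cni mul1r.
have iq f : cdom M f -> cdom (C * M) (fun x => 'i%C * q x * f x).
  move=> d; apply: cdomM d; first exact: ccontZ.
  by move=> x; apply: (le_trans (cnM _ _)); rewrite cni mul1r; exact: qdom_bound.
have iqc f : cdom M f -> cdom (C * M) (fun x => 'i%C * (q x)^* * f x).
  move=> d; apply: cdomM d; first by apply: ccontZ; exact: ccontC.
  by move=> x; apply: (le_trans (cnM _ _)); rewrite cni mul1r cnC; exact: qdom_bound.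
split.
  rewrite (_ : (2 + C) * M = M + C * M + M); last by ring.
  by apply: cdomD (iZ _ d1); apply: cdomD; [exact: iZ|exact: iq].
rewrite (_ : (2 + C) * M = M + C * M + M); last by ring.
by apply: cdomD (iZ _ d2); apply: cdomB; [exact: NiZ|exact: iqc].
Qed.

(** This is (T - z)^-1 g = (z + i)^-1 (- g + (T - z)^-1 (T + i) g). *)
Lemma usol_expansion C q z M f1 f2 f1' f2' : qdom C q -> 0 < Im z ->
  C1dom M f1 f1' -> C1dom M f2 f2' ->
  let s := usol q z (hat1 q f1 f2 f1') (hat2 q f1 f2 f2') in
  forall x, (usol q z f1 f2).1 x = kap z * (- 'i%C * f1 x + s.1 x) /\
            (usol q z f1 f2).2 x = kap z * ('i%C * f2 x + s.2 x).
Proof.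
move=> dq z0 D1 D2 s.
have [h1 h2] := hat_dom dq D1 D2.
have [ss [M2 [e1 e2]] _] := usol_dom dq z0 h1 h2; rewrite -/s in ss e1 e2.
have [p1 d1 _] := D1; have [p2 d2 _] := D2.
have S : is_sol q z f1 f2 (fun x => kap z * (- 'i%C * f1 x + s.1 x)) (fun x => kap z * ('i%C * f2 x + s.2 x)).
  have [t1 t2] := ss.
  have ii : ('i%C : R[i]) * 'i%C = -1 by rewrite -expr2 sqr_i.
  split=> x; apply: cderive_eq.
  - by apply: cderiveZ; apply: cderiveD; [apply: cderiveZ; exact: p1|exact: t1].
  - transitivity (kap z * (z + 'i%C) * f1 x + kap z * (- 'i%C * z * s.1 x + q x * s.2 x + 'i%C * q x * f2 x - z * f1 x)).
      by rewrite /hat1; ring.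
    rewrite kapE //.
    transitivity (('i%C * 'i%C) * kap z * z * f1 x + kap z * (- 'i%C * z * s.1 x + q x * s.2 x + 'i%C * q x * f2 x) + f1 x).
      by rewrite ii; ring.
    by ring.
  - by apply: cderiveZ; apply: cderiveD; [apply: cderiveZ; exact: p2|exact: t2].
  - transitivity (kap z * (z + 'i%C) * f2 x + kap z * ((q x)^* * s.1 x + 'i%C * z * s.2 x - 'i%C * (q x)^* * f1 x - z * f2 x)).
      by rewrite /hat2; ring.
    rewrite kapE //.
    transitivity (('i%C * 'i%C) * kap z * z * f2 x + kap z * ((q x)^* * s.1 x + 'i%C * z * s.2 x - 'i%C * (q x)^* * f1 x) + f2 x).
      by rewrite ii; ring.
    by ring.
have k1 := cdomZ (kap z) (cdomD (cdomZ (- 'i%C) d1) e1).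
have k2 := cdomZ (kap z) (cdomD (cdomZ 'i%C d2) e2).
pose Mx := Num.max (cn (kap z) * (cn (- 'i%C) * M + M2)) (cn (kap z) * (cn 'i%C * M + M2)).
have k1' : cdom Mx (fun x => kap z * (- 'i%C * f1 x + s.1 x)).
  by apply: cdom_le k1; rewrite le_max lexx.
have k2' : cdom Mx (fun x => kap z * ('i%C * f2 x + s.2 x)).
  by apply: cdom_le k2; rewrite le_max lexx orbT.
by move=> x; rewrite (usol_unique _ S k1' k2') // gt_eqF.
Qed.

End solution_operator.

(** * Integrals over the line *)

Section line_integrals.
Variable R : realType.
Implicit Types (F g : R -> R) (x t h M Y : R).
Local Notation mu := (@lebesgue_measure R).

Lemma Rintegral_lint_limit g M (L : R) : continuous g -> (forall x, `|g x| <= M * lorentz x) ->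
  (forall x, `|lint g x| <= L) -> `|\int[mu]_x g x| <= L.
Proof.
move=> cg hM gL; apply/ler_addgt0Pr => e e0.
have [B hB] := vanishes_leftZ `|M| (@atan_vanishes_left R) e0.
have := Rintegral_lint (- B) cg hM; rewrite -atanN opprK => h.
have h2 : M * (pi / 2 + atan B) <= e.
  rewrite addrC; apply: le_trans (hB B (lexx _)); apply: le_trans (ler_norm _).
  by rewrite ler_wpM2r ?ler_norm // ltW // atan_pi2_gt0.
have := ler_normD (\int[mu]_x g x - lint g (- B)) (lint g (- B)); rewrite subrK.
have := gL (- B); move: h h2; rewrite [pi / 2 + _]addrC; nra.
Qed.

(** Translation invariance, by uniqueness of the primitive; h is bounded by 1 so
    that the weights at x and at x + h are comparable. *)
Lemma Rintegral_shift g M h : continuous g -> (forall x, `|g x| <= M * lorentz x) -> `|h| <= 1 ->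
  \int[mu]_x g (x + h) = \int[mu]_x g x /\ (forall x, `|g (x + h)| <= 3 * M * lorentz x).
Proof.
move=> cg hM h1.
have M0 : 0 <= M.
  have := hM 0; rewrite /lorentz expr0n /= addr0 invr1 mulr1; exact: le_trans.
have sh x : lorentz (x + h) <= 3 * lorentz x.
  have a : 0 < 1 + x ^+ 2 by rewrite ltr_wpDr ?sqr_ge0.
  have b : 0 < 1 + (x + h) ^+ 2 by rewrite ltr_wpDr ?sqr_ge0.
  have h2 : h ^+ 2 <= 1 by rewrite -(real_normK (num_real h)) expr_le1.
  have key : 1 + x ^+ 2 <= 3 * (1 + (x + h) ^+ 2).
    by have := sqr_ge0 (x + h + h); have := sqr_ge0 (x + h); lra.
  by rewrite /lorentz ler_pdivlMr // mulrC ler_pdivrMr.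
have gs x : `|g (x + h)| <= 3 * M * lorentz x.
  apply: (le_trans (hM _)); rewrite [3 * M]mulrC -mulrA; exact: ler_wpM2l.
split=> //.
have cgs : continuous (fun x => g (x + h)).
  move=> x; apply: (@continuous_comp _ _ _ (fun x : R => x + h) g); last exact: cg.
  by apply: cvgD; [exact: cvg_id|exact: cvg_cst].
have E x : lint g (x + h) = lint (fun x => g (x + h)) x.
  apply: (@lint_unique R _ (fun x => lint g (x + h)) cgs (left_dominatedW gs)).
    move=> t; have d := lint_derive (t + h) cg (left_dominatedW hM).
    have d2 : is_derive t (1:R) (fun y : R => y + h) 1 by apply: is_derive_eq; rewrite addr0.
    by have := @is_derive1_comp R (lint g) (fun y => y + h) t _ _ d d2; rewrite mulr1.
  move=> e e0; have [A hA] := lint_vanishes cg (left_dominatedW hM) e0.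
  by exists (A - h) => y yA; apply: hA; lra.
apply/eqP; rewrite -subr_eq0 -normr_le0; apply/ler_addgt0Pl => e e0; rewrite addr0.
have e2 : 0 < e / 2 by lra.
have [B hB] := vanishes_leftZ (3 * M) (@atan_vanishes_left R) e2.
pose y := Num.max (- B) (- B - h).
have yB : - y <= B by rewrite lerNl le_max lexx.
have yhB : - (y + h) <= B.
  have : - B - h <= y by rewrite le_max lexx orbT.
  lra.
have a1 := Rintegral_lint y cgs gs; have a2 := Rintegral_lint (y + h) cg hM.
have b1 := hB _ yB; have b2 := hB _ yhB.
rewrite atanN ger0_norm in b1; last first.
  by rewrite mulr_ge0 ?mulr_ge0 // addrC ltW // pi2_atan_gt0.
rewrite atanN ger0_norm in b2; last first.
  by rewrite mulr_ge0 ?mulr_ge0 // addrC ltW // pi2_atan_gt0.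
have p2 := pi2_atan_gt0 (y + h).
have Mp : 0 <= M * (pi / 2 - atan (y + h)) by rewrite mulr_ge0 // ltW.
rewrite E in a2.
have := ler_normB (\int[mu]_x g (x + h) - lint (fun x => g (x + h)) y)
  (\int[mu]_x g x - lint (fun x => g (x + h)) y).
rewrite opprB addrA subrK => t.
apply: (le_trans t); clear -a1 a2 b1 b2 Mp; lra.
Qed.

Lemma Rintegral_lorentz : \int[mu]_x lorentz x = pi :> R.
Proof.
rewrite /Rintegral ge0_symfun_integralT.
- by rewrite -set_itvcy integral_lorentzy atan0 subr0 -EFinM /=; field.
- exact: lorentz_ge0.
- exact: lorentz_cont.
- by move=> x; rewrite /= lorentzN.
Qed.

Lemma Rintegral_le_pi g M : continuous g -> (forall x, `|g x| <= M * lorentz x) ->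
  `|\int[mu]_x g x| <= M * pi.
Proof.
move=> cg gM; rewrite -Rintegral_lorentz.
apply: Rintegral_dominated => //; first exact: lorentz_integrable.
exact: dominated_integrable gM.
Qed.

(** The Poisson kernel at height Y, up to the factor Y / pi. *)
Definition lorY Y t : R := (Y ^+ 2 + t ^+ 2)^-1.

Lemma lorY_gt0 Y t : 1 <= Y -> 0 < lorY Y t.
Proof. by move=> Y1; rewrite invr_gt0 ltr_wpDr ?sqr_ge0 // exprn_gt0 //; lra. Qed.

Lemma lorY_le Y t : 1 <= Y -> lorY Y t <= lorentz t.
Proof.
move=> Y1; rewrite /lorY /lorentz lef_pV2 ?posrE ?ltr_wpDr ?sqr_ge0 // ?exprn_gt0 //; last by lra.
by rewrite lerD2r exprn_ege1.
Qed.

Lemma lorY_cont Y : 1 <= Y -> continuous (lorY Y).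
Proof.
move=> Y1 t; apply: cvgV; first by rewrite gt_eqF // ltr_wpDr ?sqr_ge0 // exprn_gt0 //; lra.
apply: cvgD; first exact: cvg_cst.
exact: exprn_continuous.
Qed.

Lemma is_derive_atanY Y t : 1 <= Y -> is_derive t (1:R) (fun t => atan (t / Y)) (Y * lorY Y t).
Proof.
move=> Y1; have Y0 : Y != 0 by rewrite gt_eqF //; lra.
have d2 : is_derive t (1:R) (fun y : R => y / Y) Y^-1.
  by apply: is_derive_eq; rewrite /GRing.scale /=; ring.
have d := @is_derive1_comp R (@atan R) (fun y => y / Y) t _ _ (is_derive1_atan _) d2.
apply: (is_derive_eq d); rewrite /lorY.
have k0 : Y ^+ 2 + t ^+ 2 != 0 by rewrite gt_eqF // ltr_wpDr ?sqr_ge0 // exprn_gt0 //; lra.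
by field; rewrite k0 /= Y0.
Qed.

Lemma Rintegral_lorY_bound g M Y : 1 <= Y -> continuous g ->
  (forall x, `|g x| <= M * lorY Y x) -> `|\int[mu]_x g x| <= M / Y * pi.
Proof.
move=> Y1 cg gM.
have M0 : 0 <= M.
  have := le_trans (normr_ge0 _) (gM 0); rewrite pmulr_lge0 //; exact: lorY_gt0.
have gl x : `|g x| <= M * lorentz x.
  by apply: (le_trans (gM x)); rewrite ler_wpM2l // lorY_le.
apply: (Rintegral_lint_limit cg gl) => x.
have Y0 : 0 < Y by lra.
apply: (@le_trans _ _ (M / Y * (atan (x / Y) + pi / 2))); last first.
  by rewrite ler_wpM2l ?divr_ge0 // ?ltW //; have := atan_ltpi2 (x / Y); lra.
apply: (@comparison_left R (lint g) g (fun t => M / Y * (atan (t / Y) + pi / 2)) (fun t => M * lorY Y t)) => //.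
- by move=> t _; exact: lint_derive cg (left_dominatedW gl).
- exact: lint_vanishes cg (left_dominatedW gl).
- move=> t _; have d := is_derive_atanY t Y1.
  by apply: is_derive_eq; rewrite addr0 /GRing.scale /= mulrA divfK // gt_eqF.
- by move=> t _; rewrite mulr_ge0 ?divr_ge0 // ltW // atan_pi2_gt0.
Qed.

Lemma Rintegral_lorY Y : 1 <= Y -> \int[mu]_x (Y * lorY Y x) = pi.
Proof.
move=> Y1; have Y0 : 0 < Y by lra.
have cg : continuous (fun x => Y * lorY Y x).
  by move=> x; apply: cvgM; [exact: cvg_cst|exact: lorY_cont].
have gl x : `|Y * lorY Y x| <= Y * lorentz x.
  rewrite ger0_norm; last by rewrite mulr_ge0 // ltW // lorY_gt0.
  by rewrite ler_wpM2l ?lorY_le // ltW.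
have E x : lint (fun x => Y * lorY Y x) x = atan (x / Y) + pi / 2.
  apply/esym; apply: (@lint_unique R _ (fun x => atan (x / Y) + pi / 2) cg (left_dominatedW gl)).
    by move=> t; have d := is_derive_atanY t Y1; apply: is_derive_eq; rewrite addr0.
  move=> e e0; have [A hA] := @atan_vanishes_left R e e0; exists (A * Y) => t tA.
  by apply: hA; rewrite ler_pdivrMr.
apply/eqP; rewrite eq_le; apply/andP; split.
  apply: (le_trans (ler_norm _)); apply: (Rintegral_lint_limit cg gl) => x.
  rewrite E ger0_norm; last exact/ltW/atan_pi2_gt0.
  by have := atan_ltpi2 (x / Y); lra.
apply/ler_addgt0Pr => e e0; have e2 : 0 < e / 2 by lra.
have [A hA] := @atan_vanishes_left R _ e2.
have [B hB] := vanishes_leftZ Y (@atan_vanishes_left R) e2.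
pose x := Num.max (- A * Y) (- B).
have xB : - x <= B by rewrite lerNl le_max lexx orbT.
have xA : - (x / Y) <= A.
  rewrite lerNl ler_pdivlMr // mulNr -mulNr le_max lexx //.
have := Rintegral_lint x cg gl; rewrite E ler_norml => /andP[h _].
have := hA _ xA; have := hB _ xB; rewrite !atanN => b a.
have {}b := le_trans (ler_norm _) b; have {}a := le_trans (ler_norm _) a.
by clear -a b h; lra.
Qed.

End line_integrals.

(** * Cauchy's theorem in the upper half-plane *)

Section contour.
Variable R : realType.
Implicit Types (f g : R -> R[i]) (x t h M : R) (z w k : R[i]).

Definition ctotal f : R[i] := cintegral setT f.

Lemma cdom_integrable M f : cdom M f -> cintegrable setT f.
Proof.
move=> [[c1 c2] hM]; split.
  exact: (dominated_integrable c1 (fun x => le_trans (Re_le_cn _) (hM x))).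
exact: (dominated_integrable c2 (fun x => le_trans (Im_le_cn _) (hM x))).
Qed.

Lemma ctotal_bound M f : cdom M f -> cn (ctotal f) <= 2 * M * pi.
Proof.
move=> [[c1 c2] hM].
have a := Rintegral_le_pi c1 (fun x => le_trans (Re_le_cn _) (hM x)).
have b := Rintegral_le_pi c2 (fun x => le_trans (Im_le_cn _) (hM x)).
rewrite /cn /=; lra.
Qed.

Lemma ctotal_bound_lorY M f Y : 1 <= Y -> ccont f -> (forall x, cn (f x) <= M * lorY Y x) ->
  cn (ctotal f) <= 2 * (M / Y * pi).
Proof.
move=> Y1 [c1 c2] hM.
have a := Rintegral_lorY_bound Y1 c1 (fun x => le_trans (Re_le_cn _) (hM x)).
have b := Rintegral_lorY_bound Y1 c2 (fun x => le_trans (Im_le_cn _) (hM x)).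
rewrite /cn /=; lra.
Qed.

Lemma ctotal_shift M f h : cdom M f -> `|h| <= 1 ->
  ctotal (fun x => f (x + h)) = ctotal f /\ cdom (3 * M) (fun x => f (x + h)).
Proof.
move=> df h1; have M0 := cdom_ge0 df; have [[c1 c2] hM] := df.
have [a _] := Rintegral_shift c1 (fun x => le_trans (Re_le_cn _) (hM x)) h1.
have [b _] := Rintegral_shift c2 (fun x => le_trans (Im_le_cn _) (hM x)) h1.
split; first by apply: complexP.
have cs (F : R -> R) : continuous F -> continuous (fun x => F (x + h)).
  move=> cF x; apply: (@continuous_comp _ _ _ (fun x : R => x + h) F); last exact: cF.
  by apply: cvgD; [exact: cvg_id|exact: cvg_cst].
split; first by split; [exact: (cs _ c1)|exact: (cs _ c2)].
have [_ sh] := @Rintegral_shift _ (@lorentz R) 1 h (@lorentz_cont R)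
  (fun x => eq_ind _ (fun y => y <= 1 * lorentz x) (eq_ind _ (fun y => lorentz x <= y) (lexx _) _ (esym (mul1r _))) _ (esym (ger0_norm (lorentz_ge0 x)))) h1.
move=> x; apply: (le_trans (hM _)); have := sh x; rewrite ger0_norm ?lorentz_ge0 // mulr1 => s.
by rewrite [3 * M]mulrC -mulrA; apply: ler_wpM2l.
Qed.

Lemma ctotalD M M' f g : cdom M f -> cdom M' g -> ctotal (fun x => f x + g x) = ctotal f + ctotal g.
Proof. by move=> a b; apply: cintegralD => //; apply: cdom_integrable; eassumption. Qed.

Lemma ctotalZ M z f : cdom M f -> ctotal (fun x => z * f x) = z * ctotal f.
Proof. by move=> a; apply: cintegralZ => //; exact: cdom_integrable a. Qed.

Lemma ctotalB M M' f g : cdom M f -> cdom M' g -> ctotal (fun x => f x - g x) = ctotal f - ctotal g.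
Proof.
move=> a b; rewrite -mulN1r -(ctotalZ (-1) b) -(ctotalD a (cdomZ (-1) b)).
by apply: cintegral_ext => x; rewrite mulN1r.
Qed.

Lemma cnM_le z w (a b : R) : cn z <= a -> cn w <= b -> cn (z * w) <= a * b.
Proof. by move=> za wb; apply: (le_trans (cnM _ _)); apply: ler_pM; rewrite ?cn_ge0. Qed.

Lemma cnD_le z w (a b : R) : cn z <= a -> cn w <= b -> cn (z + w) <= a + b.
Proof. by move=> za wb; apply: (le_trans (cnD _ _)); apply: lerD. Qed.

Lemma cnB_le z w (a b : R) : cn z <= a -> cn w <= b -> cn (z - w) <= a + b.
Proof. by move=> za wb; apply: (le_trans (cnB _ _)); apply: lerD. Qed.

Lemma sqn_kap z : 0 < Im z -> sqn (kap z) = lorY (1 + Im z) (Re z).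
Proof.
move=> z0; have := kapE z0 => e.
have s : sqn (kap z) * ((1 + Im z) ^+ 2 + Re z ^+ 2) = 1.
  have <- : sqn (z + 'i%C) = (1 + Im z) ^+ 2 + Re z ^+ 2 by rewrite /sqn !reim /=; ring.
  by rewrite -sqnM e /sqn /= expr1n expr0n addr0.
have n0 : (1 + Im z) ^+ 2 + Re z ^+ 2 != 0.
  by apply/eqP => h; move: s; rewrite h mulr0 => /esym/eqP; rewrite oner_eq0.
by apply: (mulIf n0); rewrite s /lorY mulVf.
Qed.

Lemma cn_kap2 z : 0 < Im z -> cn (kap z ^+ 2) <= 2 * lorY (1 + Im z) (Re z).
Proof.
move=> z0; rewrite -sqn_kap // expr2.
apply: (le_trans (cnM _ _)); rewrite -expr2; exact: cn_le_sqn.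
Qed.

Lemma cn_kap z : 0 < Im z -> cn (kap z) <= 2.
Proof.
move=> z0; have Y1 : 1 <= 1 + Im z by lra.
have h : cn (kap z) ^+ 2 <= 2 ^+ 2.
  apply: (le_trans (cn_le_sqn _)); rewrite sqn_kap //.
  have := lorY_le (Re z) Y1; have := lorentz_le1 (Re z); lra.
by rewrite -(@ler_pXn2r _ 2) ?nnegrE ?cn_ge0.
Qed.

(** The resolvent identity for the scalar 1/(z + i). *)
Lemma kap_step z w : 0 < Im z -> 0 < Im w -> kap w = kap z - (w - z) * (kap z * kap w).
Proof.
move=> z0 w0.
transitivity (kap z * (z + 'i%C) * kap w); first by rewrite kapE // mul1r.
transitivity (kap z * (kap w * (w + 'i%C)) - (w - z) * (kap z * kap w)); first by ring.
by rewrite kapE // mulr1.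
Qed.

(** Complex differentiability with a remainder that is uniform in the half-plane
    Im z >= e0; this is how analyticity is used. *)
Definition second_order (e0 K : R) (B : R[i] -> R[i]) (wt : R -> R) :=
  forall z, e0 <= Im z -> exists2 B', cn B' <= K * wt (Re z) &
    forall w, e0 <= Im w -> cn (w - z) <= 1 ->
      cn (B w - B z - (w - z) * B') <= K * wt (Re z) * cn (w - z) ^+ 2.

Section main.
Variables (B : R[i] -> R[i]) (c : R[i]) (K0 : R).
Hypothesis B0 : forall z, 0 < Im z -> cn (B z) <= K0.
Hypothesis B1 : forall e0, 0 < e0 -> exists2 K, 0 <= K & second_order e0 K B (fun=> 1).

(** Two powers of 1/(z + i) give integrability along horizontal lines, with an
    integral that tends to zero as the line moves up. *)
Definition cG z := kap z ^+ 2 * (c + B z).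

Let c0 := cn c + K0.

Let cB z : 0 < Im z -> cn (c + B z) <= c0.
Proof. by move=> z0; apply: cnD_le => //; exact: B0. Qed.

Let c00 : 0 <= c0.
Proof.
rewrite addr_ge0 ?cn_ge0 //; apply: le_trans (B0 (z := 'i%C) _); first exact: cn_ge0.
exact: ltr01.
Qed.

Lemma cG_bound z : 0 < Im z -> cn (cG z) <= 2 * c0 * lorY (1 + Im z) (Re z).
Proof.
move=> z0; rewrite mulrAC; apply: cnM_le; [exact: cn_kap2|exact: cB].
Qed.

(** Taylor expansion of the product; the factor 1/(z + i)^2 provides the weight. *)
Lemma cG_second_order e0 : 0 < e0 -> exists2 K, 0 <= K & second_order e0 K cG (@lorentz R).
Proof.
move=> e00; have [K K1 hB] := B1 e00.
exists (2 * (9 * K + 20 * c0) + 2 * (K + 4 * c0)).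
  by rewrite !addr_ge0 ?mulr_ge0 ?addr_ge0 ?mulr_ge0.
move=> z ez; have z0 : 0 < Im z by lra.
have [B' hB' hr] := hB z ez; rewrite mulr1 in hB'.
have k2 : cn (kap z ^+ 2) <= 2 * lorentz (Re z).
  apply: (le_trans (cn_kap2 z0)); rewrite ler_wpM2l // lorY_le //; lra.
have kz := cn_kap z0.
have l0 := lorentz_ge0 (Re z).
have cBz := cB z0.
exists (kap z ^+ 2 * (B' - (kap z + kap z) * (c + B z))).
  apply: (@le_trans _ _ (2 * lorentz (Re z) * (K + (2 + 2) * c0))).
    apply: cnM_le => //; apply: cnB_le => //; apply: cnM_le => //; exact: cnD_le.
  have a : 0 <= lorentz (Re z) * K by exact: mulr_ge0.
  have b : 0 <= lorentz (Re z) * c0 by exact: mulr_ge0.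
  by clear -a b; lra.
move=> w ew kw; have w0 : 0 < Im w by lra.
have := hr w ew kw; rewrite mulr1; set r := _ - _ => hr2.
have kap_w := cn_kap w0; have cBw := cB w0.
set k := w - z in kw r hr2 *.
have bw : B w = B z + k * B' + r by rewrite /r; ring.
have step := kap_step z0 w0; rewrite -/k in step.
have sq : kap w ^+ 2 = kap z ^+ 2 * (1 - (k * kap w) * (1 + 1 - k * kap w)).
  transitivity ((kap z - k * (kap z * kap w)) ^+ 2); first by rewrite -step.
  by ring.
have tk : k * kap w = k * kap z * (1 - k * kap w).
  transitivity (k * (kap z - k * (kap z * kap w))); first by rewrite -step.
  by ring.
have sq2 : kap w ^+ 2 = kap z ^+ 2 * (1 - (k * kap z) * (1 + 1) +
    k * k * kap z * ((1 + 1 + 1) * kap w - k * kap w * kap w)).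
  rewrite sq; congr (_ * _).
  transitivity (1 - (k * kap z * (1 - k * kap w)) * (1 + 1 - k * kap w)); first by rewrite -tk.
  by ring.
have E : cG w - cG z - k * (kap z ^+ 2 * (B' - (kap z + kap z) * (c + B z))) =
  kap z ^+ 2 * (r - (k + k) * kap z * (k * B' + r) +
    k * k * kap z * ((1 + 1 + 1) * kap w - k * kap w * kap w) * (c + B w)).
  by rewrite /cG sq2 bw; ring.
rewrite E.
have ck := cn_ge0 k.
have r1 : cn r <= K * cn k.
  apply: (le_trans hr2); rewrite ler_wpM2l // expr2 ler_piMl //.
have x1 : cn (r - (k + k) * kap z * (k * B' + r) +
    k * k * kap z * ((1 + 1 + 1) * kap w - k * kap w * kap w) * (c + B w)) <=
    K * cn k ^+ 2 + (cn k + cn k) * 2 * (cn k * K + K * cn k) +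
    cn k * cn k * 2 * ((1 + 1 + 1) * 2 + 1 * 2 * 2) * c0.
  apply: cnD_le.
    apply: cnB_le => //; apply: cnM_le; last first.
      by apply: cnD_le => //; apply: cnM_le.
    by apply: cnM_le => //; apply: cnD_le.
  apply: cnM_le => //; apply: cnM_le.
    by apply: cnM_le => //; apply: cnM_le.
  apply: cnB_le; last by apply: cnM_le => //; apply: cnM_le.
  by apply: cnM_le => //; apply: cnD_le; rewrite ?cn1 //; apply: cnD_le; rewrite ?cn1.
apply: (le_trans (cnM_le k2 x1)).
have a : 0 <= lorentz (Re z) * K * cn k ^+ 2 by rewrite !mulr_ge0 ?sqr_ge0.
have b : 0 <= lorentz (Re z) * c0 * cn k ^+ 2 by rewrite !mulr_ge0 ?sqr_ge0.
by clear -a b; lra.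
Qed.

Definition line e x : R[i] := x +i* e.

Lemma cG_line_cont e : 0 < e -> ccont (fun x => cG (line e x)).
Proof.
move=> e0; have [K K1 hG] := cG_second_order e0.
have lip x y : `|x - y| <= 1 -> cn (cG (line e x) - cG (line e y)) <= 2 * K * `|x - y|.
  move=> h1; have [G' hG' hr] := hG (line e x) (lexx _).
  have E : line e y - line e x = (y - x)%:C by apply: complexP; rewrite !reim /= ?subrr.
  have := hr (line e y) (lexx _); rewrite E cnR distrC => /(_ h1) h2.
  have l1 := lorentz_le1 x; have l0 := lorentz_ge0 x.
  have -> : cG (line e x) - cG (line e y) = - ((cG (line e y) - cG (line e x) - (y - x)%:C * G') + (y - x)%:C * G') by ring.
  rewrite cnN; apply: (le_trans (cnD_le h2 (cnM_le (lexx _) hG'))).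
  rewrite cnR (distrC y x) /=.
  have d0 := normr_ge0 (x - y).
  have Kl : K * lorentz x <= K by rewrite ler_piMr.
  have Kl0 : 0 <= K * lorentz x by rewrite mulr_ge0.
  rewrite expr2 mulrA.
  have p1 : K * lorentz x * `|x - y| <= K * `|x - y| by rewrite ler_wpM2r.
  have p2 : K * lorentz x * `|x - y| * `|x - y| <= K * lorentz x * `|x - y|.
    by rewrite ler_piMr // mulr_ge0.
  lra.
have key (F : R[i] -> R) : (forall z w, `|F z - F w| <= cn (z - w)) -> continuous (fun x => F (cG (line e x))).
  move=> hF x; apply/cvgrPdist_le => d d0.
  have K2 : 0 < 2 * K + 1 by lra.
  have m0 : 0 < Num.min 1 (d / (2 * K + 1)) by rewrite lt_min ltr01 divr_gt0.
  exists (Num.min 1 (d / (2 * K + 1))) => //= y /=.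
  move=> hm.
  have h1 : `|x - y| < 1 by apply: (lt_le_trans hm); rewrite ge_min lexx.
  have h2 : `|x - y| < d / (2 * K + 1) by apply: (lt_le_trans hm); rewrite ge_min lexx orbT.
  apply: (le_trans (hF _ _)); apply: (le_trans (lip _ _ (ltW h1))).
  move: h2; rewrite ltr_pdivlMr // => h2; have := normr_ge0 (x - y); lra.
by split; apply: key => z w; have := Re_le_cn (z - w); have := Im_le_cn (z - w); rewrite !reim.
Qed.

Lemma cG_line_dom e : 0 < e -> cdom (2 * c0) (fun x => cG (line e x)).
Proof.
move=> e0; split; first exact: cG_line_cont.
move=> x; apply: (le_trans (cG_bound (z := line e x) e0)); rewrite ler_wpM2l ?mulr_ge0 //.
by apply: lorY_le => /=; lra.
Qed.

Let Phi e := ctotal (fun x => cG (line e x)).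

(** By translation invariance the integral of G(z + ih) - G(z) equals that of
    G(z + ih) - G(z) - i (G(z + h) - G(z)), in which the first-order terms cancel. *)
Lemma Phi_step e0 : 0 < e0 -> exists2 K, 0 <= K &
  forall e h, e0 <= e -> 0 < h -> h <= 1 -> cn (Phi (e + h) - Phi e) <= K * h ^+ 2.
Proof.
move=> e00; have [K K1 hG] := cG_second_order e00.
exists (2 * (2 * K) * pi); first by rewrite !mulr_ge0 // pi_ge0.
move=> e h ee h0 h1.
have ep : 0 < e by lra. have ehp : 0 < e + h by lra.
have d1 := cG_line_dom ehp; have d2 := cG_line_dom ep.
have hn : `|h| <= 1 by rewrite gtr0_norm.
have [sh d3] := ctotal_shift d2 hn.
pose E x := (cG (line (e + h) x) - cG (line e x)) - 'i%C * (cG (line e (x + h)) - cG (line e x)).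
have tE : ctotal E = Phi (e + h) - Phi e.
  rewrite (ctotalB (cdomB d1 d2) (cdomZ 'i%C (cdomB d3 d2))) (ctotalZ _ (cdomB d3 d2)).
  by rewrite (ctotalB d1 d2) (ctotalB d3 d2) sh subrr mulr0 subr0.
rewrite -tE.
have dE : cdom (2 * K * h ^+ 2) E.
  have [cE _] := cdomB (cdomB d1 d2) (cdomZ 'i%C (cdomB d3 d2)).
  split=> // x.
  have [G' hG' hr] := hG (line e x) ee.
  have k1 : line (e + h) x - line e x = 'i%C * h%:C by apply: complexP; rewrite !reim /=; ring.
  have k2 : line e (x + h) - line e x = h%:C by apply: complexP; rewrite !reim /=; ring.
  have n1 : cn ('i%C * h%:C) = h.
    have -> : ('i%C * h%:C : R[i]) = 0 +i* h by apply: complexP; rewrite !reim /=; ring.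
    by rewrite /cn /= normr0 add0r gtr0_norm.
  have n2 : cn h%:C = h by rewrite cnR gtr0_norm.
  have eh : e0 <= Im (line (e + h) x) by rewrite /=; lra.
  have r1 := hr (line (e + h) x) eh; rewrite k1 n1 in r1.
  have r2 := hr (line e (x + h)) ee; rewrite k2 n2 in r2.
  have -> : E x = (cG (line (e + h) x) - cG (line e x) - 'i%C * h%:C * G') -
     'i%C * (cG (line e (x + h)) - cG (line e x) - h%:C * G') by rewrite /E; ring.
  have i1 : cn ('i%C : R[i]) <= 1 by rewrite cni.
  apply: (le_trans (cnB_le (r1 h1) (cnM_le i1 (r2 h1)))).
  by rewrite /= le_eqVlt; apply/orP; left; apply/eqP; ring.
apply: (le_trans (ctotal_bound dE)).
by rewrite le_eqVlt; apply/orP; left; apply/eqP; ring.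
Qed.

(** A height L is crossed in n steps of size L / n, with total change O(1/n). *)
Lemma Phi_const a L : 0 < a -> 0 <= L -> Phi (a + L) = Phi a.
Proof.
move=> a0; rewrite le_eqVlt => /predU1P[<-|L0]; first by rewrite addr0.
have [K K1 hs] := Phi_step a0.
have steps h n : 0 < h -> h <= 1 -> cn (Phi (a + n%:R * h) - Phi a) <= n%:R * (K * h ^+ 2).
  move=> h0 h1; elim: n => [|n IH]; first by rewrite !mul0r addr0 subrr cn0.
  have an : a <= a + n%:R * h by rewrite lerDl mulr_ge0 // ltW.
  have := hs _ h an h0 h1; rewrite -addrA.
  have -> : n%:R * h + h = n.+1%:R * h by rewrite -natr1 mulrDl mul1r.
  have -> : Phi (a + n.+1%:R * h) - Phi a = (Phi (a + n.+1%:R * h) - Phi (a + n%:R * h)) + (Phi (a + n%:R * h) - Phi a) by ring.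
  move=> h2; apply: (le_trans (cnD_le h2 IH)).
  by rewrite -natr1 mulrDl mul1r addrC.
apply/eqP; rewrite -subr_eq0; apply/eqP; apply: cn_eq0.
apply/ler_addgt0Pl => e e0; rewrite addr0.
(* n >= L makes the steps admissible, n >= K L^2 / e makes the change at most e *)
pose bn := Num.max (L) (K * L ^+ 2 / e).
pose n := (Num.truncn bn).+1.
have bn0 : 0 <= bn by rewrite le_max (ltW L0).
have nb : bn < n%:R.
  by have := truncn_itv bn0; rewrite /n => /andP[].
have n0 : 0 < n%:R :> R by rewrite ltr0n.
have h0 : 0 < L / n%:R by rewrite divr_gt0.
have h1 : L / n%:R <= 1.
  rewrite ler_pdivrMr // mul1r; apply: ltW; apply: le_lt_trans nb; by rewrite le_max lexx.
have := steps (L / n%:R) n h0 h1.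
have -> : n%:R * (L / n%:R) = L by rewrite mulrC divfK // gt_eqF.
move=> h2; apply: (le_trans h2).
have -> : n%:R * (K * (L / n%:R) ^+ 2) = K * L ^+ 2 / n%:R.
  by field; rewrite gt_eqF.
rewrite ler_pdivrMr // [e * _]mulrC -ler_pdivrMr //; apply: ltW; apply: le_lt_trans nb.
by rewrite le_max lexx orbT.
Qed.

(** The integral does not depend on the height and tends to zero as the height
    grows. *)
Lemma contour_zero a : 0 < a -> ctotal (fun x => cG (line a x)) = 0.
Proof.
move=> a0; apply: cn_eq0; apply/ler_addgt0Pl => e e0; rewrite addr0 -/(Phi a).
pose L := 4 * c0 * pi / e.
have L0 : 0 <= L by rewrite divr_ge0 ?mulr_ge0 ?pi_ge0 // ltW.
rewrite -(Phi_const a0 L0).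
have Y1 : 1 <= 1 + (a + L) by lra.
have aL : 0 < a + L by lra.
have := @ctotal_bound_lorY (2 * c0) (fun x => cG (line (a + L) x)) _ Y1 (cG_line_cont aL)
  (fun x => cG_bound (z := line (a + L) x) aL).
move=> h; apply: (le_trans h).
have Y0 : 0 < 1 + (a + L) by lra.
have -> : 2 * (2 * c0 / (1 + (a + L)) * pi) = 4 * c0 * pi / (1 + (a + L)) by ring.
rewrite ler_pdivrMr //.
have Le : L * e = 4 * c0 * pi by rewrite /L divfK // gt_eqF.
by rewrite -Le; have := mulr_gt0 a0 e0; lra.
Qed.

End main.
End contour.

(** * Limits at the real axis *)

Section boundary_values.
Variable R : realType.
Implicit Types (q f g h a b u v r : R -> R[i]) (x X s M C : R) (z w m l : R[i]).

(** Sources with the additional power of decay used in [Lam_vertical_lipschitz]. *)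
Definition sdom M f := ccont f /\ forall s, (1 + `|s|) * cn (f s) <= M * lorentz s.

Lemma sdom_cdom M f : sdom M f -> cdom M f.
Proof.
move=> [cf h]; split=> // s; apply: le_trans (h s); rewrite mulrDl mul1r lerDl.
by rewrite mulr_ge0 ?cn_ge0.
Qed.

Lemma sdomM B M r f : ccont r -> (forall x, cn (r x) <= B) -> sdom M f ->
  sdom (B * M) (fun x => r x * f x).
Proof.
move=> cr rB [cf h]; split; first exact: ccontM.
move=> s; have B0 : 0 <= B by apply: le_trans (rB 0); exact: cn_ge0.
apply: (@le_trans _ _ (B * ((1 + `|s|) * cn (f s)))); last by rewrite -mulrA ler_wpM2l.
rewrite mulrCA ler_wpM2l ?addr_ge0 //; exact: cnM_le.
Qed.

Lemma sdomB M M' f g : sdom M f -> sdom M' g -> sdom (M + M') (fun x => f x - g x).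
Proof.
move=> [cf h] [cg k]; split; first exact: ccontB.
move=> s; apply: (@le_trans _ _ ((1 + `|s|) * (cn (f s) + cn (g s)))).
  by rewrite ler_wpM2l ?addr_ge0 // cnB.
by rewrite mulrDr [leRHS]mulrDl lerD.
Qed.

Lemma sdom_opparg M f : sdom M f -> sdom M (fun x => f (- x)).
Proof.
by move=> [cf h]; split; [exact: ccont_opparg|move=> s; rewrite -normrN -(lorentzN s)].
Qed.

(** Convergence as the parameter tends to 0 from the right, at a linear rate; the
    rate makes products and inverses immediate. *)
Definition lip0 (F : R -> R[i]) l := exists L, forall e, 0 < e -> e <= 1 -> cn (F e - l) <= L * e.

Lemma lip0D F G l m : lip0 F l -> lip0 G m -> lip0 (fun e => F e + G e) (l + m).
Proof.
move=> [L hL] [L' hL']; exists (L + L') => e e0 e1.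
rewrite opprD addrACA; apply: (le_trans (cnD _ _)).
by have := hL e e0 e1; have := hL' e e0 e1; lra.
Qed.

Lemma lip0M F G l m : lip0 F l -> lip0 G m -> lip0 (fun e => F e * G e) (l * m).
Proof.
move=> [L hL] [L' hL']; exists (L * (cn m + `|L'|) + cn l * L') => e e0 e1.
have -> : F e * G e - l * m = (F e - l) * G e + l * (G e - m) by ring.
have h1 := hL e e0 e1; have h2 := hL' e e0 e1.
have gb : cn (G e) <= cn m + `|L'|.
  have -> : G e = (G e - m) + m by ring.
  apply: (le_trans (cnD _ _)); rewrite addrC lerD2l; apply: (le_trans h2).
  apply: (@le_trans _ _ (`|L'| * e)); first by rewrite ler_wpM2r ?ler_norm // ltW.
  by rewrite ler_piMr.
have Le : 0 <= L * e by apply: le_trans h1; exact: cn_ge0.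
apply: (le_trans (cnD _ _)).
have a1 := cnM_le h1 gb; have a2 := cnM_le (lexx (cn l)) h2.
by apply: (le_trans (lerD a1 a2)); rewrite le_eqVlt; apply/orP; left; apply/eqP; ring.
Qed.

Lemma lip0N F l : lip0 F l -> lip0 (fun e => - F e) (- l).
Proof. by move=> [L h]; exists L => e e0 e1; rewrite -opprD cnN; exact: h. Qed.

Lemma lip0B F G l m : lip0 F l -> lip0 G m -> lip0 (fun e => F e - G e) (l - m).
Proof. by move=> a /lip0N; exact: lip0D. Qed.

Lemma lip0V F l : lip0 F l -> 1 <= sqn l -> (forall e, 0 < e -> 1 <= sqn (F e)) ->
  lip0 (fun e => (F e)^-1) l^-1.
Proof.
move=> [L hL] l1 F1; exists (2 * 2 * L) => e e0 e1.
have nz z : 1 <= sqn z -> z != 0.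
  by move=> h; apply/eqP => z0; move: h; rewrite z0 /sqn /= expr0n /= addr0; lra.
have V z : 1 <= sqn z -> cn z^-1 <= 2.
  by move=> h; have := @cnV_le R z 1 ltr01; rewrite divr1 expr1n; apply.
have n1 := nz _ l1; have n2 := nz _ (F1 e e0).
have -> : (F e)^-1 - l^-1 = (F e)^-1 * l^-1 * (- (F e - l)) by field; rewrite n1 n2.
rewrite -[X in _ <= X]mulrA; apply: cnM_le; last by rewrite cnN; exact: hL.
by apply: cnM_le; apply: V => //; exact: F1.
Qed.

Lemma Lam_bound_local m M N h x : Re m <= 0 -> cdom M h -> 0 <= N ->
  (forall s, s <= x -> cn (h s) <= N * lorentz s) -> cn (Lam m h x) <= 4 * N * pi.
Proof.
move=> m0 dh N0 hN.
apply: (@le_trans _ _ (2 * (2 * N * (atan x + pi / 2)))); last first.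
  have -> : 4 * N * pi = 2 * (2 * N * pi) by ring.
  by rewrite ler_pM2l // ler_wpM2l ?mulr_ge0 //; have := atan_ltpi2 x; lra.
apply: (@Lam_comparison R m M h (fun s => 2 * N * (atan s + pi / 2)) (fun s => 2 * N * lorentz s) x m0 dh).
- by move=> s _; apply: is_derive_eq; rewrite /GRing.scale /= /lorentz; ring.
- by move=> s _; rewrite !mulr_ge0 // ltW // atan_pi2_gt0.
- move=> s sx; have := hN s sx.
  have : expR (Re m * (x - s)) <= 1 by rewrite -expR0 ler_expR mulr_le0_ge0 // subr_ge0.
  have := expR_ge0 (Re m * (x - s)); have := cn_ge0 (h s); nra.
Qed.

(** Both the rate and the source vary; the source only needs to converge on the
    half-line on which it is integrated. *)
Lemma Lam_lip0 m M M' h (he : R -> R -> R[i]) x (L : R) : Re m <= 0 -> sdom M h -> 0 <= L ->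
  (forall e, 0 < e -> e <= 1 -> cdom M' (he e)) ->
  (forall e s, 0 < e -> e <= 1 -> s <= x -> cn (he e s - h s) <= L * e * lorentz s) ->
  lip0 (fun e => Lam (m - e%:C) (he e) x) (Lam m h x).
Proof.
move=> m0 dh L0 dhe hhe.
exists (4 * L * pi + 4 * pi * M * (1 + Num.max x 0)) => e e0 e1.
have me : Re (m - e%:C) <= 0 by rewrite !reim /=; lra.
have dc := sdom_cdom dh.
have -> : Lam (m - e%:C) (he e) x - Lam m h x =
  (Lam (m - e%:C) (he e) x - Lam (m - e%:C) h x) + (Lam (m - e%:C) h x - Lam m h x) by ring.
rewrite (LamB x me (dhe e e0 e1) dc) mulrDl; apply: cnD_le.
  have -> : 4 * L * pi * e = 4 * (L * e) * pi by ring.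
  apply: (Lam_bound_local me (cdomB (dhe e e0 e1) dc)).
    by rewrite mulr_ge0 // ltW.
  by move=> s sx; exact: hhe.
exact: Lam_vertical_lipschitz x m0 (ltW e0) (proj1 dh) (proj2 dh).
Qed.

Section vertical.
Variables (C : R) (q : R -> R[i]) (lam : R).
Variables (r1 r2 t1 t2 : R -> R[i]) (r1e r2e t1e t2e : R -> R -> R[i]).
Hypotheses (dq : qdom C q) (J : jpair q lam%:C r1 r2 t1 t2).
Hypothesis Je : forall e, 0 < e -> jpair q (lam +i* e) (r1e e) (r2e e) (t1e e) (t2e e).

Let C0 : 0 < C. Proof. by case: dq. Qed.
Let z0 : 0 <= Im (lam%:C : R[i]). Proof. by []. Qed.

Lemma mI_vertical (e : R) : mI (lam +i* e) = mI lam%:C - (2 * e)%:C.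
Proof. by apply: complexP; rewrite /mI !reim /=; ring. Qed.

Lemma iz_vertical (e : R) : 'i%C * (lam +i* e) = 'i%C * lam%:C - e%:C.
Proof. by apply: complexP; rewrite !reim /=; ring. Qed.

(** The constant of [jost_lipschitz], where the exponent 2 i z moves by 2 e. *)
Definition lipK : R := 32 * pi * (C * wmax C ^+ 2).

Lemma lipK_ge0 : 0 <= lipK.
Proof.
exact: mulr_ge0 (mulr_ge0 (ler0n _ 32) (pi_ge0 R)) (mulr_ge0 (ltW C0) (sqr_ge0 _)).
Qed.

Lemma left_lip X (e : R) x : 0 < e -> x <= X ->
  cn (r1e e x - r1 x) <= lipK * (1 + Num.max X 0) * e /\
  cn (r2e e x - r2 x) <= lipK * (1 + Num.max X 0) * e.
Proof.
move=> e0 xX.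
have J1 := proj1 (Je e0); rewrite mI_vertical in J1.
have e2 : 0 <= 2 * e by rewrite mulr_ge0 // ltW.
have [a b] := jost_lipschitz dq (mI_le0 z0) e2 (proj1 J) J1 xX.
have E : 16 * pi * (C * wmax C ^+ 2) * (1 + Num.max X 0) * (2 * e) = lipK * (1 + Num.max X 0) * e.
  by rewrite /lipK; ring.
by rewrite -E.
Qed.

Lemma right_lip X (e : R) x : 0 < e -> - x <= X ->
  cn (t1e e x - t1 x) <= lipK * (1 + Num.max X 0) * e /\
  cn (t2e e x - t2 x) <= lipK * (1 + Num.max X 0) * e.
Proof.
move=> e0 xX.
have J1 := proj2 (Je e0); rewrite mI_vertical in J1.
have e2 : 0 <= 2 * e by rewrite mulr_ge0 // ltW.
have [a b] := jost_lipschitz (qdom_hat dq) (mI_le0 z0) e2 (proj2 J) J1 xX.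
have E : 16 * pi * (C * wmax C ^+ 2) * (1 + Num.max X 0) * (2 * e) = lipK * (1 + Num.max X 0) * e.
  by rewrite /lipK; ring.
by rewrite !opprK in a b; rewrite -E.
Qed.

Lemma jost_lip0 x :
  [/\ lip0 (fun e => r1e e x) (r1 x), lip0 (fun e => r2e e x) (r2 x),
      lip0 (fun e => t1e e x) (t1 x) & lip0 (fun e => t2e e x) (t2 x)].
Proof.
split.
- by exists (lipK * (1 + Num.max x 0)) => e e0 _; have [] := left_lip e0 (lexx x).
- by exists (lipK * (1 + Num.max x 0)) => e e0 _; have [] := left_lip e0 (lexx x).
- by exists (lipK * (1 + Num.max (- x) 0)) => e e0 _; have [] := right_lip e0 (lexx (- x)).
- by exists (lipK * (1 + Num.max (- x) 0)) => e e0 _; have [] := right_lip e0 (lexx (- x)).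
Qed.

Variables (M : R) (f1 f2 : R -> R[i]).
Hypotheses (sf1 : sdom M f1) (sf2 : sdom M f2).

Let M0 : 0 <= M := cdom_ge0 (sdom_cdom sf1).

Lemma lipK_max_ge0 X : 0 <= lipK * (1 + Num.max X 0).
Proof. by rewrite mulr_ge0 ?lipK_ge0 // addr_ge0 // le_max lexx orbT. Qed.

Lemma gbeta_lip0 x : lip0 (fun e => gbeta (lam +i* e) (r1e e) (r2e e) f1 f2 x) (gbeta lam%:C r1 r2 f1 f2 x).
Proof.
have [c1 c2 _ _] := jpair_cont J.
have sg : sdom (jB C * M + jB C * M) (gsrc1 r1 r2 f1 f2).
  by apply: sdomB; apply: sdomM => // s; have [] := jpair_bound dq z0 J s.
have L0 := lipK_max_ge0 x.
have Le : 0 <= 2 * (lipK * (1 + Num.max x 0)) * M by rewrite mulr_ge0 // mulr_ge0.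
have := @Lam_lip0 ('i%C * lam%:C) _ (2 * jB C * M) _ (fun e => gsrc1 (r1e e) (r2e e) f1 f2) x _
  (iz_le0 z0) sg Le.
move=> H; have {}H : lip0 (fun e => Lam ('i%C * lam%:C - e%:C) (gsrc1 (r1e e) (r2e e) f1 f2) x) (gbeta lam%:C r1 r2 f1 f2 x).
  apply: H => [e e0 e1|e s e0 e1 sx].
    by apply: (gsrc1_dom dq _ (Je e0) (sdom_cdom sf1) (sdom_cdom sf2)) => /=; exact: ltW.
  have [h1 h2] := left_lip e0 sx.
  have -> : gsrc1 (r1e e) (r2e e) f1 f2 s - gsrc1 r1 r2 f1 f2 s =
    (r1e e s - r1 s) * f2 s - (r2e e s - r2 s) * f1 s by rewrite /gsrc1; ring.
  apply: (le_trans (cnB_le (cnM_le h1 (proj2 (sdom_cdom sf2) s)) (cnM_le h2 (proj2 (sdom_cdom sf1) s)))).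
  by rewrite le_eqVlt; apply/orP; left; apply/eqP; ring.
by have [L hL] := H; exists L => e e0 e1; rewrite /gbeta iz_vertical; exact: hL.
Qed.

Lemma galpha_lip0 x : lip0 (fun e => galpha (lam +i* e) (t1e e) (t2e e) f1 f2 x) (galpha lam%:C t1 t2 f1 f2 x).
Proof.
have [_ _ c1 c2] := jpair_cont J.
have sg : sdom (jB C * M + jB C * M) (fun s => gsrc2 t1 t2 f1 f2 (- s)).
  apply: (sdom_opparg (f := gsrc2 t1 t2 f1 f2)).
  rewrite (_ : gsrc2 t1 t2 f1 f2 = fun x => t2 x * f1 x - t1 x * f2 x); last first.
    by apply/funext => s; rewrite /gsrc2; ring.
  by apply: sdomB; apply: sdomM => // s; have [] := jpair_bound dq z0 J s.
have L0 := lipK_max_ge0 (- x).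
have Le : 0 <= 2 * (lipK * (1 + Num.max (- x) 0)) * M by rewrite mulr_ge0 // mulr_ge0.
have := @Lam_lip0 ('i%C * lam%:C) _ (2 * jB C * M) _ (fun e s => gsrc2 (t1e e) (t2e e) f1 f2 (- s)) (- x) _
  (iz_le0 z0) sg Le.
move=> H; have {}H : lip0 (fun e => Lam ('i%C * lam%:C - e%:C) (fun s => gsrc2 (t1e e) (t2e e) f1 f2 (- s)) (- x))
    (Lam ('i%C * lam%:C) (fun s => gsrc2 t1 t2 f1 f2 (- s)) (- x)).
  apply: H => [e e0 e1|e s e0 e1 sx].
    by apply: (gsrc2_dom dq _ (Je e0) (sdom_cdom sf1) (sdom_cdom sf2)) => /=; exact: ltW.
  have sx' : - - s <= - x by rewrite opprK.
  have [h1 h2] := right_lip e0 sx'.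
  have -> : gsrc2 (t1e e) (t2e e) f1 f2 (- s) - gsrc2 t1 t2 f1 f2 (- s) =
    (t2e e (- s) - t2 (- s)) * f1 (- s) - (t1e e (- s) - t1 (- s)) * f2 (- s) by rewrite /gsrc2; ring.
  apply: (le_trans (cnB_le (cnM_le h2 (proj2 (sdom_cdom sf1) (- s))) (cnM_le h1 (proj2 (sdom_cdom sf2) (- s))))).
  by rewrite lorentzN le_eqVlt; apply/orP; left; apply/eqP; ring.
have [L hL] := lip0N H; exists L => e e0 e1; rewrite /galpha iz_vertical; exact: hL.
Qed.

(** Green's formula is built by products from quantities that converge at the real
    axis; the inverse of the Wronskian is controlled by [jwr_ge1]. *)
Lemma green_lip0 x :
  lip0 (fun e => green1 (lam +i* e) (r1e e) (r2e e) (t1e e) (t2e e) f1 f2 x) (green1 lam%:C r1 r2 t1 t2 f1 f2 x) /\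
  lip0 (fun e => green2 (lam +i* e) (r1e e) (r2e e) (t1e e) (t2e e) f1 f2 x) (green2 lam%:C r1 r2 t1 t2 f1 f2 x).
Proof.
have [a1 a2 a3 a4] := jost_lip0 x; have [b1 b2 b3 b4] := jost_lip0 0.
have hb := gbeta_lip0 x; have ha := galpha_lip0 x.
have hw : lip0 (fun e => (jwr (r1e e) (r2e e) (t1e e) (t2e e) 0)^-1) (jwr r1 r2 t1 t2 0)^-1.
  apply: lip0V.
  - by apply: lip0B; exact: lip0M.
  - exact: jwr_ge1 dq z0 J.
  - by move=> e e0; apply: (jwr_ge1 dq _ (Je e0)) => /=; exact: ltW.
by split; apply: lip0M => //; apply: lip0D; exact: lip0M.
Qed.

End vertical.
End boundary_values.

(** * The jump across the real axis *)

Section jump.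
Variable R : realType.
Implicit Types (q f g h a b u v r w : R -> R[i]) (x X s M C : R) (z m l : R[i]).

Lemma cvanish_le f (G : R -> R) : vanishes_left G -> (forall x, cn (f x) <= G x) -> cvanish f.
Proof. by move=> vG h; apply: vanishes_left_le vG _ => x; rewrite ger0_norm ?cn_ge0. Qed.

Lemma cvanishM f g (B : R) : cvanish f -> (forall x, cn (g x) <= B) -> cvanish (fun x => f x * g x).
Proof.
move=> /(vanishes_leftZ B) v hg; apply: (cvanish_le v) => x.
by rewrite mulrC; apply: cnM_le.
Qed.

Lemma cvanish_ext f g : f =1 g -> cvanish f -> cvanish g.
Proof. by move=> /funext ->. Qed.

Lemma cvanishC f : cvanish f -> cvanish (fun x => (f x)^*).
Proof. by rewrite /cvanish; under [in X in _ -> X]eq_fun do rewrite cnC. Qed.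

Lemma cvanish_cst_eq0 z : cvanish (fun=> z : R[i]) -> z = 0.
Proof.
move=> v; apply: cn_eq0; apply/ler_addgt0Pl => e e0; rewrite addr0.
by have [A hA] := v e e0; have := hA A (lexx A); rewrite ger0_norm ?cn_ge0.
Qed.

Lemma ctotal_clint M f x : cdom M f -> cn (ctotal f - clint f x) <= 2 * (M * (pi / 2 - atan x)).
Proof.
move=> [[c1 c2] hM].
have a := Rintegral_lint x c1 (fun x => le_trans (Re_le_cn _) (hM x)).
have b := Rintegral_lint x c2 (fun x => le_trans (Im_le_cn _) (hM x)).
by rewrite /cn !reim /=; rewrite /lint in a b; lra.
Qed.

Lemma Re_iR (lam x : R) : Re ('i%C * lam%:C * x%:C : R[i]) = 0.
Proof. by rewrite !reim /=; ring. Qed.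

Lemma cn_phase (lam x : R) : cn (ce ('i%C * lam%:C * x%:C)) <= 2 /\ cn (ce (- ('i%C * lam%:C * x%:C))) <= 2.
Proof.
by split; apply: (le_trans (cn_ce _)); rewrite ?ReN Re_iR ?oppr0 expR0 mulr1.
Qed.

Section real_line.
Variables (C : R) (q : R -> R[i]) (lam : R).
Hypothesis dq : qdom C q.

Let z := (lam%:C : R[i]).
Let z0 : 0 <= Im z. Proof. by []. Qed.

Section pair.
Variables (r1 r2 t1 t2 : R -> R[i]).
Hypothesis J : jpair q z r1 r2 t1 t2.

Lemma is_sol_left : is_sol q z (fun=> 0) (fun=> 0)
  (fun x => ce (- ('i%C * z) * x%:C) * r1 x) (fun x => ce (- ('i%C * z) * x%:C) * r2 x).
Proof.
split=> x; have [d1 d2 d3 d4] := jpair_derive dq z0 J x; apply: cderive_eq.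
- by apply: cderiveM; [exact: cderive_ce_lin|exact: d1].
- by rewrite /=; ring.
- by apply: cderiveM; [exact: cderive_ce_lin|exact: d2].
- by rewrite /= /mI; ring.
Qed.

Lemma is_sol_right : is_sol q z (fun=> 0) (fun=> 0)
  (fun x => ce ('i%C * z * x%:C) * t1 x) (fun x => ce ('i%C * z * x%:C) * t2 x).
Proof.
split=> x; have [d1 d2 d3 d4] := jpair_derive dq z0 J x; apply: cderive_eq.
- by apply: cderiveM; [exact: cderive_ce_lin|exact: d3].
- by rewrite /= /mI; ring.
- by apply: cderiveM; [exact: cderive_ce_lin|exact: d4].
- by rewrite /=; ring.
Qed.

(** The Wronskian is constant, and it tends to zero at +oo because w does and v is
    bounded. *)
Lemma wronskian_vanish w1 w2 v1 v2 (B : R) :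
  is_sol q z (fun=> 0) (fun=> 0) w1 w2 -> is_sol q z (fun=> 0) (fun=> 0) v1 v2 ->
  (forall x, cn (v1 x) <= B /\ cn (v2 x) <= B) ->
  cvanish (fun x => w1 (- x)) -> cvanish (fun x => w2 (- x)) ->
  forall x, w1 x * v2 x = w2 x * v1 x.
Proof.
move=> [a1 a2] [b1 b2] hB k1 k2.
have d x : cderive (fun x => w1 x * v2 x - w2 x * v1 x) x 0.
  apply: cderive_eq.
    by apply: cderiveB; apply: cderiveM; [exact: a1|exact: b2|exact: a2|exact: b1].
  by rewrite /=; ring.
have cst := cderive0_cst d.
move=> x; apply/eqP; rewrite -subr_eq0; apply/eqP; rewrite (cst x 0).
apply: cvanish_cst_eq0.
apply: (cvanish_ext (f := fun x => w1 (- x) * v2 (- x) - w2 (- x) * v1 (- x))).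
  by move=> y; exact: cst.
by apply: cvanishB; apply: (@cvanishM _ _ B) => // y; have [] := hB (- y).
Qed.

(** Both Wronskians with the Jost solutions vanish, and the Jost solutions are
    linearly independent. *)
Lemma homogeneous_vanish w1 w2 : is_sol q z (fun=> 0) (fun=> 0) w1 w2 ->
  cvanish (fun x => w1 (- x)) -> cvanish (fun x => w2 (- x)) ->
  forall x, w1 x = 0 /\ w2 x = 0.
Proof.
move=> sw k1 k2 x.
have B1 (g : R -> R[i]) : (forall x, cn (g x) <= jB C) ->
    forall x, cn (ce (- ('i%C * z) * x%:C) * g x) <= 2 * jB C /\ cn (ce ('i%C * z * x%:C) * g x) <= 2 * jB C.
  move=> hg y; have [e1 e2] := cn_phase lam y.
  by split; apply: cnM_le => //; rewrite mulNr.
have bl y : cn (ce (- ('i%C * z) * y%:C) * r1 y) <= 2 * jB C /\ cn (ce (- ('i%C * z) * y%:C) * r2 y) <= 2 * jB C.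
  split; first by have [] := B1 r1 (fun x => let: And4 k _ _ _ := jpair_bound dq z0 J x in k) y.
  by have [] := B1 r2 (fun x => let: And4 _ k _ _ := jpair_bound dq z0 J x in k) y.
have br y : cn (ce ('i%C * z * y%:C) * t1 y) <= 2 * jB C /\ cn (ce ('i%C * z * y%:C) * t2 y) <= 2 * jB C.
  split; first by have [] := B1 t1 (fun x => let: And4 _ _ k _ := jpair_bound dq z0 J x in k) y.
  by have [] := B1 t2 (fun x => let: And4 _ _ _ k := jpair_bound dq z0 J x in k) y.
have l := wronskian_vanish sw is_sol_left bl k1 k2 x.
have r := wronskian_vanish sw is_sol_right br k1 k2 x.
have ee : ce (- ('i%C * z) * x%:C) * ce ('i%C * z * x%:C) = 1.
  by rewrite mulrC mulNr ceNK.
have n0 : ce (- ('i%C * z) * x%:C) != 0 by apply/eqP => h; move: ee; rewrite h mul0r => /esym/eqP; rewrite oner_eq0.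
have n1 : ce ('i%C * z * x%:C) != 0 by apply/eqP => h; move: ee; rewrite h mulr0 => /esym/eqP; rewrite oner_eq0.
have {}l : w1 x * r2 x = w2 x * r1 x by apply: (mulfI n0); rewrite mulrCA l; ring.
have {}r : w1 x * t2 x = w2 x * t1 x by apply: (mulfI n1); rewrite mulrCA r; ring.
have j0 := jwr_neq0 dq z0 J; rewrite -(jwr_cst dq z0 J x) /jwr in j0.
split; apply: (mulfI j0); rewrite mulr0.
  transitivity (r1 x * (w1 x * t2 x) - t1 x * (w1 x * r2 x)); first by ring.
  by rewrite l r; ring.
transitivity (t2 x * (w2 x * r1 x) - r2 x * (w2 x * t1 x)); first by ring.
by rewrite -l -r; ring.
Qed.

Variables (M : R) (f1 f2 : R -> R[i]).
Hypotheses (df1 : cdom M f1) (df2 : cdom M f2).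

(** Coefficient of the Jost solution from +oo in the asymptotics of Green's
    solution at +oo. *)
Definition jcoef : R[i] := (jwr r1 r2 t1 t2 0)^-1 *
  ctotal (fun s => ce (- ('i%C * z) * s%:C) * gsrc1 r1 r2 f1 f2 s).

Lemma jcoef_dom : cdom (2 * (2 * jB C * M)) (fun s => ce (- ('i%C * z) * s%:C) * gsrc1 r1 r2 f1 f2 s).
Proof.
apply: cdomM (gsrc1_dom dq z0 J df1 df2); first exact: cont_ce_lin.
by move=> s; rewrite mulNr; have [] := cn_phase lam s.
Qed.

(** One coefficient of Green's formula tends to a full integral, the other one to
    zero. *)
Lemma green_asymptotics :
  cvanish (fun x => green1 z r1 r2 t1 t2 f1 f2 (- x) - jcoef * (ce ('i%C * z * (- x)%:C) * t1 (- x))) /\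
  cvanish (fun x => green2 z r1 r2 t1 t2 f1 f2 (- x) - jcoef * (ce ('i%C * z * (- x)%:C) * t2 (- x))).
Proof.
set W := (jwr r1 r2 t1 t2 0)^-1.
set T := ctotal (fun s => ce (- ('i%C * z) * s%:C) * gsrc1 r1 r2 f1 f2 s).
have vb : cvanish (fun x => gbeta z r1 r2 f1 f2 (- x) - ce ('i%C * z * (- x)%:C) * T).
  have v := vanishes_leftZ (2 * (2 * (2 * (2 * jB C * M)))) (@atan_vanishes_left R).
  apply: (cvanish_le v) => x.
  have := ctotal_clint (- x) jcoef_dom; rewrite -/T atanN opprK => h.
  rewrite /gbeta /Lam -mulrBr.
  have e1 : cn (ce ('i%C * z * (- x)%:C)) <= 2 by have [] := cn_phase lam (- x).
  rewrite -cnN -mulrN opprB.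
  apply: (le_trans (cnM_le e1 h)); rewrite le_eqVlt; apply/orP; left; apply/eqP; ring.
have va : cvanish (fun x => galpha z t1 t2 f1 f2 (- x)).
  have v := Lam_vanish (iz_le0 z0) (gsrc2_dom dq z0 J df1 df2).
  by apply: (cvanish_le v) => x; rewrite /galpha cnN opprK.
have jb x := jpair_bound dq z0 J x.
split.
  apply: (cvanish_ext (f := fun x => W * ((gbeta z r1 r2 f1 f2 (- x) - ce ('i%C * z * (- x)%:C) * T) * t1 (- x)
    + galpha z t1 t2 f1 f2 (- x) * r1 (- x)))).
    by move=> x; rewrite /jcoef -/W -/T /green1 -/W; ring.
  by apply: cvanishZ; apply: cvanishD; apply: (@cvanishM _ _ (jB C)) => // x; have [] := jb (- x).
apply: (cvanish_ext (f := fun x => W * ((gbeta z r1 r2 f1 f2 (- x) - ce ('i%C * z * (- x)%:C) * T) * t2 (- x)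
    + galpha z t1 t2 f1 f2 (- x) * r2 (- x)))).
  by move=> x; rewrite /jcoef -/W -/T /green2 -/W; ring.
by apply: cvanishZ; apply: cvanishD; apply: (@cvanishM _ _ (jB C)) => // x; have [] := jb (- x).
Qed.

Lemma green_defect_sol : is_sol q z f1 f2
  (fun x => green1 z r1 r2 t1 t2 f1 f2 x + (- jcoef) * (ce ('i%C * z * x%:C) * t1 x))
  (fun x => green2 z r1 r2 t1 t2 f1 f2 x + (- jcoef) * (ce ('i%C * z * x%:C) * t2 x)).
Proof.
have s := is_sol_combine (- jcoef) (green_sol dq z0 J df1 df2) is_sol_right.
by apply: is_sol_ext s => x; rewrite mulr0 addr0.
Qed.

End pair.

(** After subtraction of their asymptotics the two Green solutions vanish at +oo
    and have the same source, so their difference is zero by [homogeneous_vanish]. *)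
Lemma jump (r1 r2 t1 t2 R1 R2 T1 T2 : R -> R[i]) M f1 f2 :
  jpair q z r1 r2 t1 t2 -> jpair q z R1 R2 T1 T2 -> cdom M f1 -> cdom M f2 ->
  let F1 := fun x => (f2 x)^* in let F2 := fun x => (f1 x)^* in
  forall x,
  green1 z r1 r2 t1 t2 f1 f2 x - (green2 z R1 R2 T1 T2 F1 F2 x)^* =
    jcoef r1 r2 t1 t2 f1 f2 * (ce ('i%C * z * x%:C) * t1 x) -
    (jcoef R1 R2 T1 T2 F1 F2 * (ce ('i%C * z * x%:C) * T2 x))^* /\
  green2 z r1 r2 t1 t2 f1 f2 x - (green1 z R1 R2 T1 T2 F1 F2 x)^* =
    jcoef r1 r2 t1 t2 f1 f2 * (ce ('i%C * z * x%:C) * t2 x) -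
    (jcoef R1 R2 T1 T2 F1 F2 * (ce ('i%C * z * x%:C) * T1 x))^*.
Proof.
move=> J J' d1 d2 F1 F2 x.
have D1 := cdomC d2 : cdom M F1; have D2 := cdomC d1 : cdom M F2.
have s := green_defect_sol J d1 d2.
have s' := is_sol_conj (green_defect_sol J' D1 D2).
have zz : z^* = z by apply: complexP; rewrite !reim //= oppr0.
rewrite zz in s'.
have [a1 a2] := green_asymptotics J d1 d2; have [b1 b2] := green_asymptotics J' D1 D2.
have {a1 b2} k1 := cvanishB a1 (cvanishC b2); have {a2 b1} k2 := cvanishB a2 (cvanishC b1).
have S := is_sol_combine (-1) s s'; clear s s'.
move: S k1 k2; set a := jcoef r1 _ _ _ _ _; set b := jcoef R1 _ _ _ _ _.
set g1 := green1 z r1 _ _ _ _ _; set g2 := green2 z r1 _ _ _ _ _.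
set G1 := green1 z R1 _ _ _ _ _; set G2 := green2 z R1 _ _ _ _ _.
clearbody a b g1 g2 G1 G2 => S k1 k2.
have S0 : is_sol q z (fun=> 0) (fun=> 0)
    (fun x => g1 x + - a * (ce ('i%C * z * x%:C) * t1 x) + -1 * (G2 x + - b * (ce ('i%C * z * x%:C) * T2 x))^*)
    (fun x => g2 x + - a * (ce ('i%C * z * x%:C) * t2 x) + -1 * (G1 x + - b * (ce ('i%C * z * x%:C) * T1 x))^*).
  by apply: is_sol_ext S => y; rewrite conjcK mulN1r subrr.
have [||h1 h2] := homogeneous_vanish J S0 _ _ x.
- by apply: cvanish_ext k1 => y; rewrite !mulNr mul1r.
- by apply: cvanish_ext k2 => y; rewrite !mulNr mul1r.
have cB (u v m n : R[i]) : u - v^* - (m - n^*) = u - m - (v - n)^*.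
  by apply: complexP; rewrite !reim /=; ring.
split; apply/eqP; rewrite -subr_eq0; apply/eqP; rewrite cB.
  by rewrite -[RHS]h1 !mulNr mul1r.
by rewrite -[RHS]h2 !mulNr mul1r.
Qed.

End real_line.
End jump.

(** * Scattering coefficients *)

Section scattering_data.
Variable R : realType.
Implicit Types (q a b : R -> R[i]) (f : R -> 'cV[R[i]]_2) (x s M C lam : R) (z : R[i]).

Lemma col2_entries a b : (fun x => col2 (a x) (b x) 0 0) = a /\ (fun x => col2 (a x) (b x) 1 0) = b.
Proof. by split; apply/funext => x; rewrite ?col20 ?col21. Qed.

Lemma conj_real lam : (lam%:C : R[i])^* = lam%:C.
Proof. by apply: complexP; rewrite !reim //= oppr0. Qed.

Section real_line.
Variables (C : R) (q : R -> R[i]) (lam : R).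
Hypothesis dq : qdom C q.

Let z := (lam%:C : R[i]).
Let m0 : Re (mI z) <= 0. Proof. by rewrite Re_mI /= mulr0. Qed.
Let dqh := qdom_hat dq.

(** The bounded solutions exist, so the functions chosen by [r1m] and [r2p] satisfy
    their Volterra equations. *)
Lemma jpair_plus : jpair q z (fun x => r1m q z x 0 0) (fun x => r1m q z x 1 0)
  (fun x => r2p q z x 0 0) (fun x => r2p q z x 1 0).
Proof.
split.
  apply: (volJ_jost dq m0); apply/r1m_volJ.
  apply: (@xgetPex _ _ [set r | volterra_left q (e1 R) (kernel1 z) r]).
  have [a [b ab]] := jost_exists dq m0; have [e0 e1] := col2_entries a b.
  exists (fun x => col2 (a x) (b x)); apply/r1m_volJ.
  by rewrite e0 e1; exact: jost_volJ dq m0 ab.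
apply: (volJ_jost dqh m0); apply/r2p_volJ.
apply: (@xgetPex _ _ [set r | volterra_right q (e2 R) (kernel2 z) r]).
have [a [b ab]] := jost_exists dqh m0; have [e0 e1] := col2_entries (fun x => b (- x)) (fun x => a (- x)).
exists (fun x => col2 (b (- x)) (a (- x))); apply/r2p_volJ.
rewrite (_ : (fun x => col2 _ _ 1 0) = a); last by apply/funext => x; rewrite col21 opprK.
rewrite (_ : (fun x => col2 _ _ 0 0) = b); last by apply/funext => x; rewrite col20 opprK.
exact: jost_volJ dqh m0 ab.
Qed.

Lemma jpair_minus : jpair q z (fun x => (r1p q z x 1 0)^*) (fun x => (r1p q z x 0 0)^*)
  (fun x => (r2m q z x 1 0)^*) (fun x => (r2m q z x 0 0)^*).
Proof.
have zz : z^* = z := conj_real lam.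
split.
  apply: (volJ_jost dq m0); rewrite -[in mI _]zz; apply/r1p_volJ.
  apply: (@xgetPex _ _ [set r | volterra_left q (e2 R) (kernel2 z) r]).
  have [a [b ab]] := jost_exists dq m0.
  exists (fun x => col2 (b x)^* (a x)^*); apply/r1p_volJ; rewrite zz.
  rewrite (_ : (fun x => (col2 _ _ 1 0)^*) = a); last by apply/funext => x; rewrite col21 conjcK.
  rewrite (_ : (fun x => (col2 _ _ 0 0)^*) = b); last by apply/funext => x; rewrite col20 conjcK.
  exact: jost_volJ dq m0 ab.
apply: (volJ_jost dqh m0); rewrite -[in mI _]zz; apply/r2m_volJ.
apply: (@xgetPex _ _ [set r | volterra_right q (e1 R) (kernel1 z) r]).
have [a [b ab]] := jost_exists dqh m0.
exists (fun x => col2 (a (- x))^* (b (- x))^*); apply/r2m_volJ; rewrite zz.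
rewrite (_ : (fun x => (col2 _ _ 0 0)^*) = a); last by apply/funext => x; rewrite col20 conjcK opprK.
rewrite (_ : (fun x => (col2 _ _ 1 0)^*) = b); last by apply/funext => x; rewrite col21 conjcK opprK.
exact: jost_volJ dqh m0 ab.
Qed.

Lemma det_row2 (u v : 'cV[R[i]]_2) : \det (row_mx u v) = u 0 0 * v 1 0 - u 1 0 * v 0 0.
Proof.
have h0 : (0 : 'I_(1 + 1)) = lshift 1 (0 : 'I_1) by apply: val_inj.
have h1 : (1 : 'I_(1 + 1)) = rshift 1 (0 : 'I_1) by apply: val_inj.
have E0 (k : 'I_2) : (row_mx u v : 'M[R[i]]_2) k 0 = u k 0 by rewrite h0 (row_mxEl u v).
have E1 (k : 'I_2) : (row_mx u v : 'M[R[i]]_2) k 1 = v k 0 by rewrite h1 (row_mxEr u v).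
rewrite -!E0 -!E1; move: (row_mx u v : 'M[R[i]]_2) => A.
rewrite (expand_det_row _ (0 : 'I_2)) big_ord_recl big_ord1 /cofactor !det_mx11 !mxE /=.
rewrite (_ : lift 0 0 = 1 :> 'I_2); last by apply: val_inj.
rewrite (_ : lift 1 0 = 0 :> 'I_2); last by apply: val_inj.
by rewrite /= !addn0 expr0 expr1; ring.
Qed.

Variables (M : R) (f : R -> 'cV[R[i]]_2).
Hypothesis df : forall k, cdom M (fun x => f x k 0).

Definition density lam x := c_plus q f lam *: m2p q lam%:C x + c_minus q f lam *: m2m q lam%:C x.

Let f1 x := f x 0 0.
Let f2 x := f x 1 0.
Let P := jcoef lam (fun x => r1m q z x 0 0) (fun x => r1m q z x 1 0)
  (fun x => r2p q z x 0 0) (fun x => r2p q z x 1 0) f1 f2.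
Let N := jcoef lam (fun x => (r1p q z x 1 0)^*) (fun x => (r1p q z x 0 0)^*)
  (fun x => (r2m q z x 1 0)^*) (fun x => (r2m q z x 0 0)^*) (fun x => (f2 x)^*) (fun x => (f1 x)^*).

Lemma ce_at0 : ce (- ('i%C * z * (0:R)%:C)) = 1 /\ ce ('i%C * z * (0:R)%:C) = 1.
Proof. by rewrite mulr0 oppr0 ce0. Qed.

Lemma c_plusE : c_plus q f lam = P.
Proof.
have [e0 e1] := ce_at0.
rewrite /c_plus /scat_a det_row2 /m1m /m2p ceE !mxE e0 e1 !mul1r.
congr (_ * _); apply: cintegral_ext => s; rewrite !mxE /gsrc1 (mulNr ('i%C * z)) /=; rewrite -/z /f1 /f2; ring.
Qed.

(** The integrand and the determinant are conjugates of those of the conjugate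
    problem. *)
Lemma c_minusE : c_minus q f lam = - N^*%C.
Proof.
have [e0 e1] := ce_at0.
rewrite /c_minus /scat_A det_row2 /m1p /m2m ceE !mxE e0 e1 !mul1r.
rewrite /N /jcoef mulNr; congr (- _).
have d := jcoef_dom dq jpair_minus (cdomC (df 1)) (cdomC (df 0)).
have W (u v m n : R[i]) : u * v - m * n = (v^*%C * u^*%C - n^*%C * m^*%C)^*%C.
  by apply: complexP; rewrite !reim /=; ring.
have G (e u v a b : R[i]) : e^*%C * u * a - e^*%C * v * b = (e * (u^*%C * a^*%C - v^*%C * b^*%C))^*%C.
  by apply: complexP; rewrite !reim /=; ring.
have E (u v : R[i]) : (u^-1 * v)^*%C = (u^*%C)^-1 * v^*%C by rewrite rmorphM fmorphV.
rewrite E /ctotal -cintegralC //; last exact: cdom_integrable d.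
congr (_^-1 * _).
  rewrite /jwr; exact: W.
apply: cintegral_ext => s; rewrite !mxE /gsrc1 (mulNr ('i%C * z)).
have -> : ce ('i%C * z * s%:C) = (ce (- ('i%C * z * s%:C)))^*%C.
  by rewrite -ceC; congr ce; apply: complexP; rewrite !reim /=; ring.
exact: G.
Qed.

Lemma density_entries x :
  density lam x 0 0 = P * (ce ('i%C * z * x%:C) * r2p q z x 0 0) -
    (N * (ce ('i%C * z * x%:C) * (r2m q z x 0 0)^*%C))^*%C /\
  density lam x 1 0 = P * (ce ('i%C * z * x%:C) * r2p q z x 1 0) -
    (N * (ce ('i%C * z * x%:C) * (r2m q z x 1 0)^*%C))^*%C.
Proof.
have E : ce (- ('i%C * z * x%:C)) = (ce ('i%C * z * x%:C))^*%C.
  by rewrite -ceC; congr ce; apply: complexP; rewrite !reim /=; ring.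
have G (p n e u v : R[i]) : p * (e * u) + - n^*%C * (e^*%C * v) = p * (e * u) - (n * (e * v^*%C))^*%C.
  by apply: complexP; rewrite !reim /=; ring.
have F (p n e e' : R[i]) (u v : 'cV[R[i]]_2) k :
    (p *: (e *: u) + n *: (e' *: v)) k 0 = p * (e * u k 0) + n * (e' * v k 0).
  by rewrite !mxE.
by rewrite /density c_plusE c_minusE /m2p /m2m ceE -/z E; split; rewrite F G.
Qed.

End real_line.
End scattering_data.

(** * The jump of the resolvent *)

Section spectral_jump.
Variable R : realType.
Implicit Types (q : R -> R[i]) (f : R -> 'cV[R[i]]_2) (x M C lam eps : R) (z : R[i]).

Section fixed.
Variables (C : R) (q : R -> R[i]) (f : R -> 'cV[R[i]]_2) (M : R).
Hypotheses (dq : qdom C q) (df : forall k, cdom M (fun x => f x k 0)).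

Let f1 x := f x 0 0.
Let f2 x := f x 1 0.
(** Source of the conjugate problem, see [is_sol_conj]. *)
Definition flip1 x : R[i] := (f x 1 0)^*%C.
Definition flip2 x : R[i] := (f x 0 0)^*%C.

Lemma resolvent_upper z x : 0 < Im z ->
  resolvent q z (isig f) x = col2 ((usol q z f1 f2).1 x) ((usol q z f1 f2).2 x).
Proof.
move=> z0; have [s [M' [b1 b2]] _] := usol_dom dq z0 (df 0) (df 1).
by apply: (resolventE dq _ df s b1 b2); rewrite gt_eqF.
Qed.

Lemma resolvent_lower z x : 0 < Im z ->
  resolvent q (z^*%C) (isig f) x = col2 ((usol q z flip1 flip2).2 x)^*%C ((usol q z flip1 flip2).1 x)^*%C.
Proof.
move=> z0; have [s [M' [b1 b2]] _] := usol_dom dq z0 (cdomC (df 1)) (cdomC (df 0)).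
have s' : is_sol q z^*%C f1 f2 (fun x => ((usol q z flip1 flip2).2 x)^*%C) (fun x => ((usol q z flip1 flip2).1 x)^*%C).
  by apply: is_sol_ext (is_sol_conj s) => y; rewrite conjcK.
apply: (resolventE dq _ df s' (cdomC b2) (cdomC b1)).
by rewrite reim oppr_eq0 gt_eqF.
Qed.

Definition jumpv x lam eps : 'cV[R[i]]_2 :=
  resolvent q (lam +i* eps) (isig f) x - resolvent q (lam -i* eps) (isig f) x.

Lemma jumpv_entries x lam eps : 0 < eps ->
  jumpv x lam eps 0 0 = (usol q (lam +i* eps) f1 f2).1 x - ((usol q (lam +i* eps) flip1 flip2).2 x)^*%C /\
  jumpv x lam eps 1 0 = (usol q (lam +i* eps) f1 f2).2 x - ((usol q (lam +i* eps) flip1 flip2).1 x)^*%C.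
Proof.
move=> e0; have z0 : 0 < Im (lam +i* eps) by [].
have := resolvent_lower x z0; rewrite [(_ +i* _)^*%C]/= => L.
by rewrite /jumpv (resolvent_upper x z0) L; split; rewrite !mxE /=.
Qed.

(** In the open half-plane Green's solution decays, so it is the chosen one. *)
Lemma usol_green z r1 r2 t1 t2 g1 g2 : 0 < Im z -> jpair q z r1 r2 t1 t2 ->
  cdom M g1 -> cdom M g2 ->
  usol q z g1 g2 = (green1 z r1 r2 t1 t2 g1 g2, green2 z r1 r2 t1 t2 g1 g2).
Proof.
move=> z0 J d1 d2; have [K K0 h] := green_decay dq z0.
have [b1 b2] := h _ _ _ _ _ _ _ _ (lexx _) J d1 d2.
apply: usol_unique (green_sol dq (ltW z0) J d1 d2) b1 b2; by rewrite gt_eqF.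
Qed.

End fixed.

Section boundary.
Variables (C : R) (q : R -> R[i]) (f : R -> 'cV[R[i]]_2) (M : R).
Hypotheses (dq : qdom C q) (sf : forall k, sdom M (fun x => f x k 0)).

Let df k : cdom M (fun x => f x k 0) := sdom_cdom (sf k).

Lemma sdomC (g : R -> R[i]) : sdom M g -> sdom M (fun x => (g x)^*%C).
Proof. by move=> [cg hg]; split; [exact: ccontC|move=> s; rewrite cnC]. Qed.

Lemma lip0C (F : R -> R[i]) l : lip0 F l -> lip0 (fun e => (F e)^*%C) l^*%C.
Proof.
move=> [L h]; exists L => e e0 e1; rewrite -cnC.
have -> : ((F e)^*%C - l^*%C)^*%C = F e - l by apply: complexP; rewrite !reim /=; ring.
exact: h.
Qed.

(** Jost solutions are chosen at every height; Green's formula with these converges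
    to Green's formula on the axis. *)
Lemma usol_lip0 r1 r2 t1 t2 g1 g2 lam x : jpair q lam%:C r1 r2 t1 t2 ->
  sdom M g1 -> sdom M g2 ->
  lip0 (fun e => (usol q (lam +i* e) g1 g2).1 x) (green1 lam%:C r1 r2 t1 t2 g1 g2 x) /\
  lip0 (fun e => (usol q (lam +i* e) g1 g2).2 x) (green2 lam%:C r1 r2 t1 t2 g1 g2 x).
Proof.
move=> J s1 s2.
have /choice[F hF] : forall e, exists p : (R -> R[i]) * (R -> R[i]) * ((R -> R[i]) * (R -> R[i])),
    0 < e -> jpair q (lam +i* e) p.1.1 p.1.2 p.2.1 p.2.2.
  move=> e; have [e0|e0] := ltP 0 e; last by exists ((fun=> 0, fun=> 0), (fun=> 0, fun=> 0)) => h; lra.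
  have [a1 [a2 [b1 [b2 J']]]] := jpair_exists (z := lam +i* e) dq (ltW e0).
  by exists ((a1, a2), (b1, b2)).
have [[L1 h1] [L2 h2]] := green_lip0 dq J hF s1 s2 x.
have E e : 0 < e -> _ := fun e0 => usol_green (M := M) dq (e0 : 0 < Im (lam +i* e)) (hF e e0) (sdom_cdom s1) (sdom_cdom s2).
by split; [exists L1|exists L2] => e e0 le1; rewrite (E e e0) /=; [exact: h1|exact: h2].
Qed.

(** Both resolvents converge by [usol_lip0], and [jump] identifies the limit. *)
Lemma jumpv_lip0 lam x k : lip0 (fun e => jumpv q f x lam e k 0) (density q f lam x k 0).
Proof.
have Jp := jpair_plus lam dq; have Jm := jpair_minus lam dq.
have [a1 a2] := usol_lip0 x Jp (sf 0) (sf 1).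
have [b1 b2] := usol_lip0 x Jm (sdomC (sf 1)) (sdomC (sf 0)).
have [j1 j2] := jump dq Jp Jm (df 0) (df 1) x.
have [p1 p2] := density_entries lam dq df x.
(* [jumpv_entries] holds for positive heights only *)
have ext F G l : (forall e : R, 0 < e -> F e = G e) -> lip0 G l -> lip0 F l.
  by move=> FG [L h]; exists L => e e0 e1; rewrite FG //; exact: h.
have [->|->] := ord2P k.
  rewrite p1 -j1; apply: ext (lip0B a1 (lip0C b2)) => e e0.
  by have [] := jumpv_entries dq df x lam e0.
rewrite p2 -j2; apply: ext (lip0B a2 (lip0C b1)) => e e0.
by have [] := jumpv_entries dq df x lam e0.
Qed.

End boundary.
End spectral_jump.

(** * Horizontal integrals of the resolvent *)

Section strip.
Variable R : realType.
Implicit Types (q f g h : R -> R[i]) (x M C lam eps e : R) (z w : R[i]).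

Section analytic.
Variables (C : R) (q : R -> R[i]) (M : R) (f1 f2 : R -> R[i]).
Hypotheses (dq : qdom C q) (d1 : cdom M f1) (d2 : cdom M f2).

Let M0 : 0 <= M := cdom_ge0 d1.
Let b0 : 0 <= bnd C.
Proof. exact: mulr_ge0 (mulr_ge0 (ler0n _ 32) (pi_ge0 R)) (sqr_ge0 _). Qed.

Lemma cdomNN K h : cdom K h -> cdom K (fun x => - h x).
Proof. by move=> [c hh]; split; [exact: ccontN|move=> x; rewrite cnN]. Qed.

(** The resolvent identity applied twice: the remainder carries the factor
    (w - z)^2 times a resolvent of a resolvent of u. *)
Lemma usol_second_order (e0 : R) x : 0 < e0 -> exists2 K, 0 <= K &
  second_order e0 K (fun z => (usol q z f1 f2).1 x) (fun=> 1) /\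
  second_order e0 K (fun z => (usol q z f1 f2).2 x) (fun=> 1).
Proof.
move=> e00; have [K K0 hK] := usol_spec dq e00.
pose L := bnd C * (K * M) + bnd C * (K * (K * M)).
have a0 : 0 <= bnd C * (K * M) by rewrite mulr_ge0 // mulr_ge0.
have a1 : 0 <= bnd C * (K * (K * M)) by rewrite mulr_ge0 // mulr_ge0 // mulr_ge0.
exists L; first exact: addr_ge0.
have key z : e0 <= Im z -> exists S1 S2, [/\ cn S1 <= bnd C * (K * M), cn S2 <= bnd C * (K * M) &
    forall w, e0 <= Im w -> exists T1 T2, [/\ cn T1 <= bnd C * (K * (K * M)), cn T2 <= bnd C * (K * (K * M)),
    (usol q w f1 f2).1 x = (usol q z f1 f2).1 x - 'i%C * (w - z) * S1 - (w - z) ^+ 2 * T1 &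
    (usol q w f1 f2).2 x = (usol q z f1 f2).2 x - 'i%C * (w - z) * S2 - (w - z) ^+ 2 * T2]].
  move=> ez; have z0 : 0 < Im z by lra.
  have [_ u1 u2 _] := hK z M f1 f2 ez d1 d2.
  set u := usol q z f1 f2 in u1 u2 *.
  have u2' := cdomNN u2.
  have [_ s1 s2 sb] := hK z (K * M) _ _ ez u1 u2'.
  set s := usol q z u.1 _ in s1 s2 sb.
  have [sb1 sb2] := sb x.
  exists (s.1 x), (s.2 x); split => // w ew; have w0 : 0 < Im w by lra.
  have [_ t1 t2 tb] := hK w (K * (K * M)) _ _ ew s1 (cdomNN s2).
  set t := usol q w s.1 _ in t1 t2 tb; have [tb1 tb2] := tb x.
  exists (t.1 x), (t.2 x); split=> //.
    have [-> _] := usol_identity dq z0 w0 d1 d2 x.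
    have [-> _] := usol_identity dq z0 w0 u1 u2' x.
    rewrite -/u -/s -/t.
    have ii : ('i%C : R[i]) * 'i%C = -1 by rewrite -expr2 sqr_i.
    transitivity (u.1 x - 'i%C * (w - z) * s.1 x + ('i%C * 'i%C) * (w - z) ^+ 2 * t.1 x); first by ring.
    by rewrite ii; ring.
  have [_ ->] := usol_identity dq z0 w0 d1 d2 x.
  have [_ ->] := usol_identity dq z0 w0 u1 u2' x.
  rewrite -/u -/s -/t.
  have ii : ('i%C : R[i]) * 'i%C = -1 by rewrite -expr2 sqr_i.
  transitivity (u.2 x - 'i%C * (w - z) * s.2 x + ('i%C * 'i%C) * (w - z) ^+ 2 * t.2 x); first by ring.
  by rewrite ii; ring.
have fin (B : R[i] -> R[i]) z S : cn S <= bnd C * (K * M) -> (forall w, e0 <= Im w -> exists2 T,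
     cn T <= bnd C * (K * (K * M)) & B w = B z - 'i%C * (w - z) * S - (w - z) ^+ 2 * T) ->
  exists2 B', cn B' <= L * 1 & forall w, e0 <= Im w -> cn (w - z) <= 1 ->
      cn (B w - B z - (w - z) * B') <= L * 1 * cn (w - z) ^+ 2.
  move=> hS hT; exists (- 'i%C * S).
    apply: (@le_trans _ _ (1 * (bnd C * (K * M)))); first by apply: cnM_le; rewrite ?cnN ?cni.
    by rewrite mul1r mulr1 lerDl.
  move=> w ew _; have [T hT1 ->] := hT w ew.
  have -> : B z - 'i%C * (w - z) * S - (w - z) ^+ 2 * T - B z - (w - z) * (- 'i%C * S) = - ((w - z) * (w - z) * T) by ring.
  rewrite cnN; apply: (le_trans (cnM_le (cnM_le (lexx _) (lexx _)) hT1)).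
  rewrite mulr1 -expr2 mulrC; apply: ler_wpM2r; first exact: sqr_ge0.
  by rewrite /L lerDr.
split=> z ez; have [S1 [S2 [h1 h2 hw]]] := key z ez.
  apply: (fin (fun z => (usol q z f1 f2).1 x) z S1) => // w ew.
  by have [T1 [T2 [k1 k2 k3 k4]]] := hw w ew; exists T1.
apply: (fin (fun z => (usol q z f1 f2).2 x) z S2) => // w ew.
by have [T1 [T2 [k1 k2 k3 k4]]] := hw w ew; exists T2.
Qed.

End analytic.

(** Sources for which the expansion at infinity can be done twice. *)
Definition C2dom q f1 f2 := exists M f1' f2' h1' h2',
  [/\ C1dom M f1 f1', C1dom M f2 f2', C1dom M (hat1 q f1 f2 f1') h1' & C1dom M (hat2 q f1 f2 f2') h2'].

(** Bounded and differentiable in the upper half-plane, as required by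
    [contour_zero]. *)
Definition admissible (B : R[i] -> R[i]) (K0 : R) :=
  (forall z, 0 < Im z -> cn (B z) <= K0) /\
  (forall e0, 0 < e0 -> exists2 K, 0 <= K & second_order e0 K B (fun=> 1)).

(** Two applications of [usol_expansion]; the last resolvent plays the role of B. *)
Lemma usol_cG C q f1 f2 x : qdom C q -> C2dom q f1 f2 -> exists c1 c2 B1 B2 K0,
  [/\ admissible B1 K0, admissible B2 K0 & forall z, 0 < Im z ->
    (usol q z f1 f2).1 x = kap z * (- 'i%C * f1 x) + cG B1 c1 z /\
    (usol q z f1 f2).2 x = kap z * ('i%C * f2 x) + cG B2 c2 z].
Proof.
move=> dq [M [f1' [f2' [h1' [h2' [D1 D2 E1 E2]]]]]].
set h1 := hat1 q f1 f2 f1' in E1; set h2 := hat2 q f1 f2 f2' in E2.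
have [k1 k2] := hat_dom dq E1 E2.
set g1 := hat1 q h1 h2 h1' in k1; set g2 := hat2 q h1 h2 h2' in k2.
exists (- 'i%C * h1 x), ('i%C * h2 x), (fun z => (usol q z g1 g2).1 x), (fun z => (usol q z g1 g2).2 x).
exists (bnd C * ((2 + C) * M)); split.
- split=> [z z0|e0 e00]; first by have [_ _ b] := usol_dom dq z0 k1 k2; have [] := b x.
  by have [K K0 [s _]] := usol_second_order dq k1 k2 x e00; exists K.
- split=> [z z0|e0 e00]; first by have [_ _ b] := usol_dom dq z0 k1 k2; have [] := b x.
  by have [K K0 [_ s]] := usol_second_order dq k1 k2 x e00; exists K.
move=> z z0.
have [-> ->] := usol_expansion dq z0 D1 D2 x.
have [e1 e2] := usol_expansion dq z0 E1 E2 x.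
rewrite -/h1 -/h2 -/g1 -/g2 in e1 e2 *.
by rewrite e1 e2 /cG; split; ring.
Qed.

Lemma kap_sub_conj lam e : 0 < e ->
  kap (lam +i* e) - (kap (lam +i* e))^*%C = - 'i%C * (2 * ((1 + e) * lorY (1 + e) lam))%:C.
Proof.
move=> e0; have z0 : 0 < Im (lam +i* e) by [].
have s := sqn_kap z0; have k := kapE z0.
have E : kap (lam +i* e) = (sqn (kap (lam +i* e)))%:C * (lam +i* e + 'i%C)^*%C.
  rewrite -[LHS]mulr1 /sqn.
  have <- : ((kap (lam +i* e)) * (lam +i* e + 'i%C))^*%C = 1 by rewrite k conjc1.
  by apply: complexP; rewrite !reim /=; ring.
rewrite s /= in E.
by rewrite E; apply: complexP; rewrite !reim /=; ring.
Qed.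

(** Only the Poisson kernel contributes. The factor 1 + e in the bound comes
    from comparing the Poisson kernel with a fixed weight. *)
Lemma strip_integral (B1 B2 : R[i] -> R[i]) (c1 c2 a : R[i]) (K0 : R) : admissible B1 K0 -> admissible B2 K0 ->
  exists2 K, 0 <= K & forall e, 0 < e ->
    let h := fun lam => a * ((1 + e) * lorY (1 + e) lam)%:C + cG B1 c1 (lam +i* e) - (cG B2 c2 (lam +i* e))^*%C in
    cdom ((1 + e) * K) h /\ ctotal h = a * (pi : R)%:C.
Proof.
move=> [b10 b11] [b20 b21].
have K00 : 0 <= K0 by apply: le_trans (b10 'i%C ltr01); exact: cn_ge0.
exists (cn a + 2 * (cn c1 + K0) + 2 * (cn c2 + K0)).
  by rewrite !addr_ge0 ?cn_ge0 // mulr_ge0 // addr_ge0 // cn_ge0.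
move=> e e0 h.
have Y1 : 1 <= 1 + e by rewrite lerDl ltW.
have p1 : cdom (2 * (cn c1 + K0)) (fun lam => cG B1 c1 (lam +i* e)) := cG_line_dom c1 b10 b11 e0.
have p2 : cdom (2 * (cn c2 + K0)) (fun lam => cG B2 c2 (lam +i* e)) := cG_line_dom c2 b20 b21 e0.
have P : cdom (1 + e) (fun lam => ((1 + e) * lorY (1 + e) lam)%:C : R[i]).
  split; first split.
  - by move=> x; apply: cvgM; [exact: cvg_cst|exact: lorY_cont].
  - by move=> x; exact: cvg_cst.
  - move=> x; rewrite cnR ger0_norm; first by rewrite ler_wpM2l ?lorY_le //; lra.
    by rewrite mulr_ge0 // ?ltW ?lorY_gt0 //; lra.
have pa := cdomZ a P.
have T1 : ctotal (fun lam => ((1 + e) * lorY (1 + e) lam)%:C : R[i]) = (pi : R)%:C.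
  apply: complexP => /=; first exact: Rintegral_lorY.
  by rewrite Rintegral_cst // mul0r.
have z1 : ctotal (fun lam => cG B1 c1 (lam +i* e)) = 0 := contour_zero c1 b10 b11 e0.
have z2 : ctotal (fun lam => cG B2 c2 (lam +i* e)) = 0 := contour_zero c2 b20 b21 e0.
split.
  apply: cdom_le (cdomB (cdomD pa p1) (cdomC p2)).
  have h1 : 0 <= e * (2 * (cn c1 + K0)) by rewrite mulr_ge0 ?(ltW e0) // mulr_ge0 // addr_ge0 // cn_ge0.
  have h2 : 0 <= e * (2 * (cn c2 + K0)) by rewrite mulr_ge0 ?(ltW e0) // mulr_ge0 // addr_ge0 // cn_ge0.
  by lra.
rewrite /h (ctotalB (cdomD pa p1) (cdomC p2)) (ctotalD pa p1) (ctotalZ a P) T1 z1.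
rewrite [X in _ - X](_ : _ = (ctotal (fun lam => cG B2 c2 (lam +i* e)))^*%C).
  by rewrite z2 conjc0 subr0 addr0.
by apply: cintegralC => //; exact: cdom_integrable p2.
Qed.

End strip.

(** * Exchange of limit and integral *)

Section boundary_limit.
Variable R : realType.
Implicit Types (x K L lam e : R).
Local Notation mu := (@lebesgue_measure R).

Lemma dominated_limit (h : nat -> R -> R) (F : R -> R) K (A : R) :
  (forall n, continuous (h n)) -> (forall n x, `|h n x| <= K * lorentz x) ->
  (forall x, h n x @[n --> \oo] --> F x) -> (forall n, \int[mu]_x h n x = A) ->
  mu.-integrable setT (EFin \o F) /\ \int[mu]_x F x = A.
Proof.
move=> ch hK hF hA.
have mh n : measurable_fun [set: measurableTypeR R] (h n) by exact: cont_measurable.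
have mF : measurable_fun [set: measurableTypeR R] F.
  by apply: (measurable_fun_cvg mh) => x _; exact: hF.
have ig : mu.-integrable setT (EFin \o (fun x => K * lorentz x)).
  by apply: integrable_scale => //; exact: lorentz_integrable.
have [] := @dominated_convergence _ _ _ mu setT measurableT (fun n => EFin \o h n) (EFin \o F)
  (EFin \o (fun x => K * lorentz x)) _ _ _ ig _.
- by move=> n; apply/measurable_EFinP.
- exact/measurable_EFinP.
- by apply: aeW => x _; apply: cvg_EFin; [exact: nearW|exact: hF].
- by apply: aeW => x n _; rewrite /= lee_fin.
move=> iF _ cI; split=> //.
have E n : (\int[mu]_x (EFin \o h n) x = A%:E)%E.
  rewrite -(hA n) /Rintegral fineK //.
  by apply: integrable_fin_num => //; exact: dominated_integrable (ch n) (hK n).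
have cA : (fun=> A%:E) @ \oo --> (\int[mu]_x (EFin \o F) x)%E.
  by move: cI; apply: cvg_trans; apply: near_eq_cvg; apply: nearW => n; exact: E.
have := cvg_unique (@ereal_hausdorff R) (cvg_cst A%:E) cA.
by rewrite /Rintegral => <-.
Qed.

Lemma lip_cvg_right (g : R -> R) l L : (forall e, 0 < e -> e <= 1 -> `|g e - l| <= L * e) ->
  g e @[e --> 0^'+] --> l.
Proof.
move=> h; apply/cvgrPdist_le => d d0.
have dL : 0 < d / (`|L| + 1) by rewrite divr_gt0 // ltr_wpDl.
near=> e.
have e0 : 0 < e by near: e; exact: nbhs_right_gt.
have e1 : e <= 1 by near: e; exact: nbhs_right_le.
have e2 : e <= d / (`|L| + 1) by near: e; exact: nbhs_right_le.
rewrite distrC; apply: (le_trans (h e e0 e1)).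
rewrite ler_pdivlMr ?ltr_wpDl // in e2; apply: le_trans e2.
rewrite mulrC; apply: ler_wpM2l; first exact: ltW.
by apply: (le_trans (ler_norm _)); rewrite lerDl.
Unshelve. all: by end_near. Qed.

Lemma lip0_cvg (F : R -> R[i]) l : lip0 F l ->
  (Re (F e) @[e --> 0^'+] --> Re l) /\ (Im (F e) @[e --> 0^'+] --> Im l).
Proof.
move=> [L h]; split; apply: (@lip_cvg_right _ _ L) => e e0 e1.
  by have := h e e0 e1; have := Re_le_cn (F e - l); rewrite !reim; exact: le_trans.
by have := h e e0 e1; have := Im_le_cn (F e - l); rewrite !reim; exact: le_trans.
Qed.

(** Applied along the heights 1/(n+1). *)
Lemma limit_integral (h : R -> R -> R[i]) (F : R -> R[i]) K A :
  (forall lam, lip0 (h lam) (F lam)) ->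
  (forall e, 0 < e -> e <= 1 -> cdom K (fun lam => h lam e) /\ ctotal (fun lam => h lam e) = A) ->
  cintegrable setT F /\ ctotal F = A.
Proof.
move=> hF hA; pose u n : R := n.+1%:R^-1.
have u0 n : 0 < u n by rewrite invr_gt0.
have u1 n : u n <= 1 by rewrite invf_le1 // ler1n.
have cu : u n @[n --> \oo] --> 0 by exact: cvg_harmonic.
have [i1 e1] := @dominated_limit (fun n lam => Re (h lam (u n))) (fun lam => Re (F lam)) K (Re A)
  (fun n => let: conj (conj (conj c _) _) _ := hA _ (u0 n) (u1 n) in c)
  (fun n x => let: conj (conj _ b) _ := hA _ (u0 n) (u1 n) in le_trans (Re_le_cn _) (b x))
  (fun lam => let: conj c _ := lip0_cvg (hF lam) in proj1 (cvg_at_rightP _ _ _) c u (conj u0 cu))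
  (fun n => let: conj _ b := hA _ (u0 n) (u1 n) in f_equal (@Re R) b).
have [i2 e2] := @dominated_limit (fun n lam => Im (h lam (u n))) (fun lam => Im (F lam)) K (Im A)
  (fun n => let: conj (conj (conj _ c) _) _ := hA _ (u0 n) (u1 n) in c)
  (fun n x => let: conj (conj _ b) _ := hA _ (u0 n) (u1 n) in le_trans (Im_le_cn _) (b x))
  (fun lam => let: conj _ c := lip0_cvg (hF lam) in proj1 (cvg_at_rightP _ _ _) c u (conj u0 cu))
  (fun n => let: conj _ b := hA _ (u0 n) (u1 n) in f_equal (@Im R) b).
by split; [split|apply: complexP].
Qed.

Lemma vlip0_cvg (v : R -> 'cV[R[i]]_2) (l : 'cV[R[i]]_2) :
  (forall k, lip0 (fun e => v e k 0) (l k 0)) -> cvg_0plus v /\ lim_0plus v = l.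
Proof.
move=> h.
have c : (v e : 'cV[R[i]^o]_2) @[e --> 0^'+] --> (l : 'cV[R[i]^o]_2).
  by apply/cvg_colP => k; exact: lip0_cvg (h k).
split; first by apply/cvg_ex; exists l.
by rewrite /lim_0plus; apply: (cvg_lim _ c); exact: norm_hausdorff.
Qed.

End boundary_limit.

(** * Schwartz functions *)

Section schwartz_class.
Variable R : realType.
Implicit Types (q f g h : R -> R[i]) (x M C : R).

(** Carries only the finitely many derivatives that the expansion of the resolvent
    needs, with the decay of [sdom]. *)
Fixpoint tame n f : Prop := (exists M, sdom M f) /\
  if n is n'.+1 then exists2 f', forall x, cderive f x (f' x) & tame n' f' else True.

Lemma tame_sdom n f : tame n f -> exists M, sdom M f. Proof. by case: n => [|n] []. Qed.

Lemma tameW n f : tame n.+1 f -> tame n f.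
Proof.
elim: n f => [|n IH] f [s [f' d t]]; first by split.
by split=> //; exists f' => //; exact: IH.
Qed.

Lemma sdomD M M' f g : sdom M f -> sdom M' g -> sdom (M + M') (fun x => f x + g x).
Proof.
move=> [cf h] [cg k]; split; first exact: ccontD.
move=> s; apply: (@le_trans _ _ ((1 + `|s|) * (cn (f s) + cn (g s)))).
  by rewrite ler_wpM2l ?addr_ge0 // cnD.
by rewrite mulrDr [leRHS]mulrDl lerD.
Qed.

Lemma sdom_bound M f x : sdom M f -> cn (f x) <= M.
Proof.
move=> /sdom_cdom d; have M0 := cdom_ge0 d; have [_ h] := d.
by apply: (le_trans (h x)); rewrite ler_piMr // lorentz_le1.
Qed.

Lemma tameD n f g : tame n f -> tame n g -> tame n (fun x => f x + g x).
Proof.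
elim: n f g => [|n IH] f g [[M s] k] [[M' s'] k']; split.
- by exists (M + M'); exact: sdomD.
- by [].
- by exists (M + M'); exact: sdomD.
have [f' d t] := k; have [g' d' t'] := k'.
by exists (fun x => f' x + g' x) => [x|]; [exact: cderiveD|exact: IH].
Qed.

Lemma tameM n f g : tame n f -> tame n g -> tame n (fun x => f x * g x).
Proof.
elim: n f g => [|n IH] f g tf tg; have [[M s] k] := tf; have [[M' s'] k'] := tg; split.
- by exists (M * M'); apply: sdomM => //; [case: s|move=> x; exact: sdom_bound].
- by [].
- by exists (M * M'); apply: sdomM => //; [case: s|move=> x; exact: sdom_bound].
have [f' d t] := k; have [g' d' t'] := k'.
exists (fun x => f' x * g x + f x * g' x) => [x|]; first exact: cderiveM.
by apply: tameD; apply: IH => //; exact: tameW.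
Qed.

Lemma tameZ n z f : tame n f -> tame n (fun x => z * f x).
Proof.
elim: n f => [|n IH] f [[M s] k]; split.
- by exists (cn z * M); apply: (sdomM (r := fun=> z)) s => //; exact: ccont_cst.
- by [].
- by exists (cn z * M); apply: (sdomM (r := fun=> z)) s => //; exact: ccont_cst.
by have [f' d t] := k; exists (fun x => z * f' x) => [x|]; [exact: cderiveZ|exact: IH].
Qed.

Lemma tameC n f : tame n f -> tame n (fun x => (f x)^*%C).
Proof.
elim: n f => [|n IH] f [[M s] k]; split.
- by exists M; exact: sdomC.
- by [].
- by exists M; exact: sdomC.
by have [f' d t] := k; exists (fun x => (f' x)^*%C) => [x|]; [exact: cderiveC|exact: IH].
Qed.

Lemma tame_C1dom n f : tame n.+1 f -> exists M f', C1dom M f f' /\ tame n f'.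
Proof.
move=> [[M s] [f' d t]]; have [M' s'] := tame_sdom t.
have c := sdom_cdom s; have c' := sdom_cdom s'.
exists (M + M'), f'; split => //; split=> //.
  by apply: cdom_le c; rewrite lerDl (cdom_ge0 c').
by apply: cdom_le c'; rewrite lerDr (cdom_ge0 c).
Qed.

Lemma C1dom_le M M' f f' : M <= M' -> C1dom M f f' -> C1dom M' f f'.
Proof. by move=> h [d a b]; split=> //; apply: cdom_le h _. Qed.

Lemma C1dom_ge0 M f f' : C1dom M f f' -> 0 <= M. Proof. by move=> [_ /cdom_ge0]. Qed.

Lemma tame_C2dom q f1 f2 : tame 1 q -> tame 2 f1 -> tame 2 f2 -> C2dom q f1 f2.
Proof.
move=> tq t1 t2.
have [M1 [f1' [D1 t1']]] := tame_C1dom t1; have [M2 [f2' [D2 t2']]] := tame_C1dom t2.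
have th1 : tame 1 (hat1 q f1 f2 f1').
  apply: tameD (tameZ _ (tameW t1)); apply: tameD; first exact: tameZ.
  by apply: tameM (tameZ _ tq) (tameW t2).
have th2 : tame 1 (hat2 q f1 f2 f2').
  apply: tameD (tameZ _ (tameW t2)).
  rewrite (_ : (fun x => _) = fun x => - 'i%C * f2' x + (- 'i%C * (q x)^*%C) * f1 x); last first.
    by apply/funext => x; rewrite !mulNr.
  apply: tameD; first exact: tameZ.
  by apply: tameM (tameZ _ (tameC tq)) (tameW t1).
have [M3 [h1' [E1 _]]] := tame_C1dom th1; have [M4 [h2' [E2 _]]] := tame_C1dom th2.
have a1 := C1dom_ge0 D1; have a2 := C1dom_ge0 D2; have a3 := C1dom_ge0 E1; have a4 := C1dom_ge0 E2.
exists (M1 + M2 + M3 + M4), f1', f2', h1', h2'.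
by split; [apply: C1dom_le D1|apply: C1dom_le D2|apply: C1dom_le E1|apply: C1dom_le E2]; lra.
Qed.

Lemma schwartz_derive (h : R -> R) : schwartz h -> schwartz (h^`())%classic.
Proof.
move=> [s b]; split=> [n x|j n]; first by rewrite -derive1Sn; exact: s.
by have [C hC] := b j n.+1; exists C => x; rewrite -derive1Sn.
Qed.

Lemma schwartz_is_derive (h : R -> R) x : schwartz h -> is_derive x (1:R) h ((h^`())%classic x).
Proof. by move=> [s _]; rewrite derive1E; apply: DeriveDef => //; exact: (s 0%N x). Qed.

(** The moments of order 0, 1, 2 and 3 add up to (1 + |x|) (1 + x^2). *)
Lemma schwartz_decay (h : R -> R) : schwartz h -> exists M, forall x, (1 + `|x|) * `|h x| <= M * lorentz x.
Proof.
move=> [_ b]; have [C0 h0] := b 0%N 0%N; have [C1 h1] := b 1%N 0%N.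
have [C2 h2] := b 2%N 0%N; have [C3 h3] := b 3%N 0%N.
exists (C0 + C1 + C2 + C3) => x.
rewrite /lorentz ler_pdivlMr ?ltr_pwDl ?sqr_ge0 //.
have := h0 x; have := h1 x; have := h2 x; have := h3 x.
rewrite /= expr0 mul1r expr1 -[x ^+ 2]real_normK ?num_real // => a3 a2 a1 a0.
have -> : (1 + `|x|) * `|h x| * (1 + `|x| ^+ 2) =
  `|h x| + `|x| * `|h x| + `|x| ^+ 2 * `|h x| + `|x| ^+ 3 * `|h x| by ring.
lra.
Qed.

Lemma cschwartz_tame n h : cschwartz h -> tame n h.
Proof.
have S (g : R -> R[i]) : cschwartz g -> exists M, sdom M g.
  move=> [s1 s2]; have [M1 b1] := schwartz_decay s1; have [M2 b2] := schwartz_decay s2.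
  exists (M1 + M2); split.
    split; first exact: is_derive_continuous (fun x => schwartz_is_derive x s1).
    exact: is_derive_continuous (fun x => schwartz_is_derive x s2).
  by move=> x; rewrite /cn mulrDr [leRHS]mulrDl lerD.
elim: n h => [|n IH] h sh; split=> //; try exact: S.
have [s1 s2] := sh.
exists (fun x => (fun t => Re (h t))^`()%classic x +i* (fun t => Im (h t))^`()%classic x).
  by move=> x; split=> /=; exact: schwartz_is_derive.
by apply: IH; split; exact: schwartz_derive.
Qed.

Lemma cschwartz_qdom q : cschwartz q -> exists C, qdom C q.
Proof.
move=> /(cschwartz_tame 0)[[M s] _]; have M0 := cdom_ge0 (sdom_cdom s); have [c h] := s.
exists (M + 1); split=> //; first by rewrite ltr_wpDl.
move=> t; apply: (le_trans (h t)).
by rewrite ler_wpM2r ?lorentz_ge0 // lerDl.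
Qed.

Lemma vschwartz_sdom (f : R -> 'cV[R[i]]_2) : vschwartz f -> exists M, forall k, sdom M (fun x => f x k 0).
Proof.
move=> hf; have [M0 s0] := tame_sdom (cschwartz_tame 0 (hf 0)).
have [M1 s1] := tame_sdom (cschwartz_tame 0 (hf 1)).
have a0 := cdom_ge0 (sdom_cdom s0); have a1 := cdom_ge0 (sdom_cdom s1).
have le M M' (g : R -> R[i]) : M <= M' -> sdom M g -> sdom M' g.
  move=> h [c k]; split=> // s; apply: (le_trans (k s)).
  by rewrite ler_wpM2r ?lorentz_ge0.
exists (M0 + M1) => k; have [->|->] := ord2P k.
  by apply: le s0; rewrite lerDl.
by apply: le s1; rewrite lerDr.
Qed.

End schwartz_class.

(** * The inversion formula *)

Section inversion.
Variable R : realType.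
Implicit Types (q : R -> R[i]) (f : R -> 'cV[R[i]]_2) (x M C lam eps e : R).

(** Both entries of the jump have this form: k is - i or i, a is an entry of f, and
    b the corresponding entry of the conjugate source. *)
Lemma strip_entry (k : R[i]) (P1 P2 G H a b : R[i]) (P : R) : P1 - P1^*%C = - 'i%C * (2 * P)%:C ->
  P2 = P1 -> b = a^*%C -> P1 * (k * a) + G - (P2 * (k^*%C * b) + H)^*%C = - 'i%C * (2%:R * k * a) * P%:C + G - H^*%C.
Proof.
move=> h -> ->.
have E : (P1 * (k^*%C * a^*%C) + H)^*%C = P1^*%C * (k * a) + H^*%C.
  by rewrite rmorphD !rmorphM /= !conjcK.
have D : (2 * P)%:C = 2%:R * P%:C :> R[i] by rewrite rmorphM rmorph_nat.
rewrite E; transitivity (k * a * (P1 - P1^*%C) + G - H^*%C); first by ring.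
by rewrite h D; ring.
Qed.

(** Each entry is a Poisson kernel times an entry of f plus boundary values covered
    by [contour_zero], for the problem and for its conjugate. *)
Lemma jumpv_integral C q f x M : qdom C q -> (forall k, cdom M (fun x => f x k 0)) ->
  C2dom q (fun x => f x 0 0) (fun x => f x 1 0) -> C2dom q (flip1 f) (flip2 f) ->
  exists2 K, 0 <= K & forall k e, 0 < e ->
    cdom ((1 + e) * K) (fun lam => jumpv q f x lam e k 0) /\
    ctotal (fun lam => jumpv q f x lam e k 0) = 2%:R * (pi : R)%:C * 'i%C * isig f x k 0.
Proof.
move=> dq df cf cF.
have [c1 [c2 [B1 [B2 [K0 [b1 b2 E]]]]]] := usol_cG x dq cf.
have [d1 [d2 [B1' [B2' [K0' [b1' b2' E']]]]]] := usol_cG x dq cF.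
pose N := Num.max K0 K0'.
have adm (B : R[i] -> R[i]) K : K <= N -> admissible B K -> admissible B N.
  by move=> KN [h h']; split=> // z z0; apply: le_trans KN; exact: h.
have l1 : K0 <= N by rewrite le_max lexx.
have l2 : K0' <= N by rewrite le_max lexx orbT.
have [Ka Ka0 ha] := strip_integral c1 d2 (- 'i%C * (2%:R * - 'i%C * f x 0 0)) (adm _ _ l1 b1) (adm _ _ l2 b2').
have [Kb Kb0 hb] := strip_integral c2 d1 (- 'i%C * (2%:R * 'i%C * f x 1 0)) (adm _ _ l1 b2) (adm _ _ l2 b1').
exists (Ka + Kb); first exact: addr_ge0.
have ci : ('i%C : R[i])^*%C = - 'i%C by apply: complexP; rewrite !reim /= ?oppr0.
have cni : (- 'i%C : R[i])^*%C = 'i%C by apply: complexP; rewrite !reim /= ?oppr0 ?opprK.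
move=> k e e0; have kE lam := kap_sub_conj lam e0.
have z0 lam : 0 < Im (lam +i* e) by [].
have mono K K' g : K <= K' -> cdom ((1 + e) * K) g -> cdom ((1 + e) * K') g.
  by move=> KK; apply: cdom_le; apply: ler_wpM2l => //; lra.
have [->|->] := ord2P k.
  have [p t] := ha e e0.
  rewrite (_ : (fun lam => _) = fun lam => - 'i%C * (2%:R * - 'i%C * f x 0 0) * ((1 + e) * lorY (1 + e) lam)%:C + cG B1 c1 (lam +i* e) - (cG B2' d2 (lam +i* e))^*%C).
    split; first by apply: mono p; rewrite lerDl.
    by rewrite t isig0; ring.
  apply/funext => lam; have [-> _] := jumpv_entries dq df x lam e0.
  have [-> _] := E _ (z0 lam); have [_ ->] := E' _ (z0 lam).
  by rewrite -(strip_entry _ _ _ (kE lam) erefl erefl) cni.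
have [p t] := hb e e0.
rewrite (_ : (fun lam => _) = fun lam => - 'i%C * (2%:R * 'i%C * f x 1 0) * ((1 + e) * lorY (1 + e) lam)%:C + cG B2 c2 (lam +i* e) - (cG B1' d1 (lam +i* e))^*%C).
  split; first by apply: mono p; rewrite lerDr.
  by rewrite t isig1; ring.
apply/funext => lam; have [_ ->] := jumpv_entries dq df x lam e0.
have [_ ->] := E _ (z0 lam); have [-> _] := E' _ (z0 lam).
by rewrite -(strip_entry _ _ _ (kE lam) erefl erefl) ci.
Qed.

End inversion.

Theorem mainTheorem2 (R : realType) (q : R -> R[i]) (f : R -> 'cV[R[i]]_2)
    (hq : cschwartz q) (hf : vschwartz f) (x : R) :
  let isf := fun y : R => 'i%C *: (sigma3 R *m f y) in
  let F := fun lam : R =>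
    c_plus q f lam *: m2p q lam%:C x + c_minus q f lam *: m2m q lam%:C x in
  let D := fun (lam eps : R) =>
    resolvent q (lam +i* eps) isf x - resolvent q (lam -i* eps) isf x in
  let c := (2%:R * (pi : R)%:C * 'i%C)^-1 : R[i] in
  (* all integrals converge absolutely and all limits exist *)
  [/\ vintegrable setT F,
      forall lam, cvg_0plus (D lam),
      vintegrable setT (fun lam => lim_0plus (D lam)),
      forall eps, 0 < eps -> vintegrable setT (fun lam => D lam eps) &
      cvg_0plus (fun eps => c *: vintegral setT (fun lam => D lam eps))] /\
  [/\ f x = - (((2%:R * pi)^-1 : R)%:C *: (sigma3 R *m vintegral setT F)),
      isf x = c *: vintegral setT F,
      c *: vintegral setT F =
        c *: vintegral setT (fun lam => lim_0plus (D lam)) &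
      c *: vintegral setT (fun lam => lim_0plus (D lam)) =
        lim_0plus (fun eps => c *: vintegral setT (fun lam => D lam eps))].
Proof.
move=> isf F D c.
have [C dq] := cschwartz_qdom hq; have [M sf] := vschwartz_sdom hf.
have tq := cschwartz_tame 1 hq; have tf k := cschwartz_tame 2 (hf k).
have cf := tame_C2dom tq (tf 0) (tf 1).
have cF : C2dom q (flip1 f) (flip2 f).
  by apply: (tame_C2dom tq); [exact: (tameC (tf 1))|exact: (tameC (tf 0))].
have [K K0 hD] := jumpv_integral x dq (fun k => sdom_cdom (sf k)) cf cF.
have DE : D = jumpv q f x by [].
have FE : F = fun lam => density q f lam x by [].
have isE : isf = isig f by [].
clearbody D F isf; subst D F isf.
pose k0 : R[i] := 2%:R * (pi : R)%:C * 'i%C.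
have k00 : k0 != 0.
  have pi0 : (pi : R) <> 0 by apply/eqP; rewrite gt_eqF ?pi_gt0.
  apply/eqP => k0E; have : Im k0 = 0 by rewrite k0E.
  rewrite /k0 !reim /= => h; apply: pi0; lra.
have L lam := vlip0_cvg (fun k => jumpv_lip0 dq sf lam x k).
have LE : (fun lam => lim_0plus (jumpv q f x lam)) = fun lam => density q f lam x.
  by apply/funext => lam; have [] := L lam.
have I k : cintegrable setT (fun lam => density q f lam x k 0) /\
    ctotal (fun lam => density q f lam x k 0) = k0 * isig f x k 0.
  apply: (@limit_integral _ (fun lam e => jumpv q f x lam e k 0) _ (2 * K)).
    by move=> lam; exact: jumpv_lip0 dq sf lam x k.
  move=> e e0 e1; have [a b] := hD k e e0; split=> //.
  by apply: cdom_le a; apply: ler_wpM2r => //; lra.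
have VF : vintegral setT (fun lam => density q f lam x) = k0 *: isig f x.
  by apply: col2P; rewrite [LHS]mxE [RHS]mxE; [exact: proj2 (I 0)|exact: proj2 (I 1)].
have VD e : 0 < e -> vintegral setT (fun lam => jumpv q f x lam e) = k0 *: isig f x.
  by move=> e0; apply: col2P; rewrite [LHS]mxE [RHS]mxE; [exact: proj2 (hD 0 e e0)|exact: proj2 (hD 1 e e0)].
have cE v : c *: (k0 *: v) = v :> 'cV[R[i]]_2 by rewrite scalerA mulVf // scale1r.
have [W WE] : cvg_0plus (fun eps => c *: vintegral setT (fun lam => jumpv q f x lam eps)) /\
    lim_0plus (fun eps => c *: vintegral setT (fun lam => jumpv q f x lam eps)) = isig f x.
  by apply: vlip0_cvg => k; exists 0 => e e0 _; rewrite VD // cE subrr cn0 mul0r.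
split; first split.
- by move=> k; have [] := I k.
- by move=> lam; have [] := L lam.
- by rewrite LE => k; have [] := I k.
- by move=> e e0 k; have [p _] := hD k e e0; exact: cdom_integrable p.
- exact: W.
rewrite LE VF cE WE; split=> //.
have gpk (p : R) : p != 0 -> ((2%:R * p)^-1 : R)%:C * (2%:R * p%:C * 'i%C) = 'i%C.
  move=> p0; apply: complexP; rewrite !reim /=; first by ring.
  by field.
have pk : ((2%:R * pi)^-1 : R)%:C * k0 = 'i%C by apply: gpk; rewrite gt_eqF ?pi_gt0.
have ii : ('i%C : R[i]) * 'i%C = -1 by rewrite -expr2 sqr_i.
have [s0 s1] := sigma3_mul (k0 *: isig f x).
have half (v : 'cV[R[i]]_2) k : (- (((2%:R * pi)^-1 : R)%:C *: v)) k 0 = - (((2%:R * pi)^-1 : R)%:C * v k 0).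
  by rewrite !mxE.
have scl k : (k0 *: isig f x) k 0 = k0 * isig f x k 0 by rewrite mxE.
apply: col2P; rewrite half.
  by rewrite s0 scl mulrA pk isig0 mulrA ii; ring.
by rewrite s1 scl mulrN mulrA pk isig1 mulrN opprK mulrA ii; ring.
Qed.
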